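(* Let $d\ge 1$. (1) There is a constant $c_d>0$ depending only on $d$ such that for all integers $p \geq q \geq d+1$ and all $r \geq c_d \binom{\frac{d-1}{d}p}{q-d}\binom{\frac{p}{d}}{d}$, \[ \mathsf{HD}_d(p,q)_r \leq \min\left(p-q+1,\ \frac{p}{d}-1\right). \] (2) For every $\varepsilon>0$ there exist $p_0=p_0(\varepsilon,d)$ and a constant $c_{d,\varepsilon}>0$ depending only on $d$ and $\varepsilon$ such that for all integers $p \geq q \geq d+1$ with $p>p_0$ and all $r \geq c_{d,\varepsilon}\, \frac{p^{\left(\frac{d-1}{d}+\varepsilon\right)q+1}}{(q-d)!}$, \[ \mathsf{HD}_d(p,q)_r \leq \min\left(p-q+1,\ p-p^{\frac{d-1}{d}+\varepsilon}+2\right). \]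
   Context: All families are finite families of compact convex sets in $\mathbb{R}^d$. A family $\mathcal{F}$ with $|\mathcal{F}|\ge p$ satisfies the $(p,q)_r$ property if among any $p$ elements of $\mathcal{F}$, at least $r$ of the $q$-element subfamilies have non-empty common intersection. A set $S\subset\mathbb{R}^d$ pierces $\mathcal{F}$ if every member of $\mathcal{F}$ meets $S$; the piercing number of $\mathcal{F}$ is the minimum size of a piercing set. $\mathsf{HD}_d(p,q)_r$ denotes the maximum piercing number over all such families $\mathcal{F}$ with $|\mathcal{F}|\ge p$ satisfying the $(p,q)_r$ property. Binomial coefficients with non-integer upper argument are generalized binomial coefficients $\binom{x}{k}=x(x-1)\cdots(x-k+1)/k!$.
   Formalization: In part (1) the binomial coefficient C(p/d, d) is assumed positive (automatic for p > d(d-1)) and r is assumed at least 1; as printed the claim fails, e.g. for d = 3, p = q = 4, r = 1, where the threshold is negative and HD is at least 1 > p/d - 1. *)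

(* Defs.v *)
From mathcomp Require Import all_boot all_order all_algebra.
From mathcomp Require Import finmap.
From mathcomp Require Import all_classical all_reals all_analysis.

Set Implicit Arguments.
Unset Strict Implicit.
Unset Printing Implicit Defensive.

Import Order.TTheory GRing.Theory Num.Theory.
Import numFieldTopology.Exports numFieldNormedType.Exports.

Local Open Scope classical_set_scope.
Local Open Scope ring_scope.

(* For x <= k - 1 this may vanish or be negative. *)
Definition gbinom (R : realType) (x : R) (k : nat) : R :=
  (\prod_(i < k) (x - i%:R)) / k`!%:R.

(* Members are required to be nonempty: an empty set cannot be pierced. *)
Definition compact_convex_family (R : realType) (d : nat)
    (F : {fset set 'rV[R]_d}) : Prop :=
  forall K, K \in F -> [/\ K !=set0, compact K & convex_set K].

Definition has_common_point (R : realType) (d : nat)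
    (Q : {fset set 'rV[R]_d}) : Prop :=
  exists x, forall K, K \in Q -> K x.

Definition pqr_property (R : realType) (d p q r : nat)
    (F : {fset set 'rV[R]_d}) : Prop :=
  forall G : {fset set 'rV[R]_d}, (G `<=` F)%fset -> #|` G| = p ->
    (r <= #|` [fset Q in fpowerset G
                | (#|` Q| == q) && `[< has_common_point Q >]]%fset|)%N.

Definition pierces (R : realType) (d : nat)
    (S : {fset 'rV[R]_d}) (F : {fset set 'rV[R]_d}) : Prop :=
  forall K, K \in F -> exists2 x, x \in S & K x.

Definition piercing_number (R : realType) (d : nat)
    (F : {fset set 'rV[R]_d}) : \bar R :=
  ereal_inf [set (#|` S|%:R)%:E | S in [set S | pierces S F]].

(* The supremum is taken in the extended reals: it is +oo if the piercing
   numbers are unbounded, and -oo if no family satisfies the constraints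
   (in particular if r > 'C(p, q)). *)
Definition HD (R : realType) (d p q r : nat) : \bar R :=
  ereal_sup [set piercing_number F | F in
    [set F : {fset set 'rV[R]_d} |
      [/\ compact_convex_family F, (p <= #|` F|)%N & pqr_property p q r F]]].

(* Main.v *)
(* Write tau for the piercing number and a = (d-1)/d. A point common to an intersecting
   subfamily can be taken to be the common point of least norm, and by Helly's theorem it
   is already determined by d members. Hence, if no point lies in k members of a family of
   p sets, at most C(p,d) C(k-1-d,q-d) of its q-tuples intersect; so a (p,q)_r property
   with larger r implies the (p,k) property, and it suffices to know for which (p,k) it
   gives tau <= p-k+1. For part (1) this is the Hadwiger-Debrunner range k > a p + 1, where
   one pierces greedily, removing d sets at a time and losing one from k.

   For part (2) the bound tau <= p-q+1 is needed as soon as q >= B p^(a+e). The argument is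
   an induction on p. Put p' of order p^(1/d-e) and let m be a large constant.
   - If the (p',m) property holds, the Alon-Kleitman argument bounds tau by p'^(d+o(1)),
     which is less than p/d <= p-q+1. It combines deep points, multiplicative weights and
     weak epsilon-nets of size r^(d+o(1)). The nets come from simplicial partitions, which
     come from cuttings; a cutting is obtained by sampling hyperplanes and locating each
     point by a flag of successive least-norm points of the faces of its cell.
   - Otherwise some p' sets contain no m that intersect. If they contain an intersecting
     pair outside a largest intersecting subfamily, removing them is free and induction
     applies.
   - Otherwise there is a large disjoint subfamily; let S be a largest one. Either removing
     S and boundedly many further sets is free, or the family outside S, up to one set, has
     a common point, which gives tau <= #|S| + 1. This suffices unless #|S| = p-q+1, and in
     that case every q-1 sets outside S meet inside some member of S; multiplicative weights
     then provide points in the members of S from which every other set misses few, and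
     Helly's theorem inside each member of S gives #|S| piercing points. *)
Require Import Defs.
From mathcomp Require Import all_boot all_order all_algebra.
From mathcomp Require Import finmap.
From mathcomp Require Import all_classical all_reals all_analysis.
From mathcomp Require Import fintype finset.
From mathcomp Require Import zify ring lra.
Set Implicit Arguments.
Unset Strict Implicit.
Unset Printing Implicit Defensive.
Import Order.TTheory GRing.Theory Num.Theory.
Import numFieldTopology.Exports numFieldNormedType.Exports.
Local Open Scope ring_scope.

(** * Helly's theorem and points of least norm *)

(* [lia] on the natural-number hypotheses only: real-valued ones make it very slow. *)
Ltac nlia := repeat match goal with
  | H : ?P |- _ => lazymatch P with
    | is_true (leq _ _) => fail
    | @eq nat _ _ => fail
    | nat => fail
    | is_true (andb (leq _ _) (leq _ _)) => fail
    | _ => clear H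
    end
  end; lia.

(** The order p^(1/d-e) of p' is forced from two sides. Removing s of the p sets lowers p^a', where
    a' = (d-1)/d+e, by order s p^(a'-1); to pay for a constant loss in q, s must have order at least
    p^(1-a') = p^(1/d-e). On the other side the Alon-Kleitman bound at p' has to stay below p/d. As
    (1/d-e)d = 1-de, this tolerates an exponent slightly above d and no more. Hence the nets of size
    r^(d+o(1)), and hence the large m: the depth of the points contributes a factor m/(m-d) to the
    exponent. Least-norm points also take the place of general position. They are unique by strict
    convexity, so degenerate families and degenerate arrangements of hyperplanes fall under the same
    definitions. Random samples are replaced by counting all samples, and linear programming duality
    by integer weights, which become multiplicities in a blow-up of the family. *)

Section Convexity.
Context {R : realType} {k : nat}.
Implicit Types (x y z : 'rV[R]_k) (A B : set 'rV[R]_k).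

Definition dotv x y : R := \sum_i x 0 i * y 0 i.

(** Convexity with a real parameter; [HD_le] derives it from [convex_set], whose parameter ranges
    over an interval type. *)
Definition cvx A := forall x y (t : R), 0 <= t -> t <= 1 -> A x -> A y ->
  A (t *: x + (1 - t) *: y).

Definition is_min A x := A x /\ forall y, A y -> dotv x x <= dotv y y.

Lemma dotvDl x y z : dotv (x + y) z = dotv x z + dotv y z.
Proof. by rewrite /dotv -big_split; apply: eq_bigr => i _; rewrite mxE mulrDl. Qed.

Lemma dotvC x y : dotv x y = dotv y x.
Proof. by apply: eq_bigr => i _; rewrite mulrC. Qed.

Lemma dotvZl a x y : dotv (a *: x) y = a * dotv x y.
Proof. by rewrite /dotv mulr_sumr; apply: eq_bigr => i _; rewrite mxE mulrA. Qed.

Lemma dotvDr x y z : dotv x (y + z) = dotv x y + dotv x z.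
Proof. by rewrite dotvC dotvDl !(dotvC x). Qed.

Lemma dotvZr a x y : dotv x (a *: y) = a * dotv x y.
Proof. by rewrite dotvC dotvZl dotvC. Qed.

Lemma dotv0l y : dotv 0 y = 0.
Proof. by rewrite -(scale0r 0) dotvZl mul0r. Qed.

Lemma dotv_ge0 x : 0 <= dotv x x.
Proof. by apply: sumr_ge0 => i _; rewrite -expr2 sqr_ge0. Qed.

Lemma dotv_eq0 x : dotv x x = 0 -> x = 0.
Proof.
move/eqP; rewrite psumr_eq0 => [/allP h|i _]; last by rewrite -expr2 sqr_ge0.
apply/matrixP => i j; rewrite ord1 mxE; apply/eqP.
by move: (h j (mem_index_enum j)) => /=; rewrite mulf_eq0 orbb.
Qed.

(** The subtracted term expresses strict convexity of the squared norm. Both the uniqueness of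
    least-norm points and the convexity of open balls come from it. *)
Lemma dotv_conv (t : R) x y : dotv (t *: x + (1 - t) *: y) (t *: x + (1 - t) *: y) =
  t * dotv x x + (1 - t) * dotv y y - t * (1 - t) * dotv (x - y) (x - y).
Proof.
rewrite -[- y]scaleN1r !(dotvDl, dotvDr, dotvZl, dotvZr) (dotvC y x); ring.
Qed.

Lemma is_min_unique A x y : cvx A -> is_min A x -> is_min A y -> x = y.
Proof.
move=> cA [Ax mx] [Ay my]; apply/eqP; rewrite -subr_eq0; apply/eqP/dotv_eq0.
have := mx _ (cA x y (2^-1) _ _ Ax Ay); rewrite dotv_conv.
have := dotv_ge0 (x - y); have := mx _ Ay; have := my _ Ax.
by move=> ? ? ? /(_ ltac:(lra) ltac:(lra)) ?; lra.
Qed.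

Lemma is_minS A B x : (forall y, B y -> A y) -> B x -> is_min A x -> is_min B x.
Proof. by move=> sBA Bx [_ m]; split => // y /sBA; exact: m. Qed.

Lemma cvx_lt (c : R) : cvx (fun y => dotv y y < c).
Proof.
move=> x y t t0 t1 xc yc; rewrite dotv_conv.
have h : 0 <= t * (1 - t) * dotv (x - y) (x - y).
  by rewrite mulr_ge0 ?dotv_ge0// mulr_ge0// subr_ge0.
have [->|tn] := eqVneq t 0; first by rewrite !(mul0r, subr0, mul1r, add0r).
have tp : 0 < t by rewrite lt_def tn.
nra.
Qed.

(** Induction over a list of indices: the partial sum divided by its weight lies in [A] as soon as
    that weight is positive. *)
Lemma cvx_sum A (I : finType) (P : pred I) (c : I -> R) (x : I -> 'rV[R]_k) :
  cvx A -> (forall i, P i -> 0 <= c i) -> \sum_(i | P i) c i = 1 ->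
  (forall i, P i -> c i != 0 -> A (x i)) -> A (\sum_(i | P i) c i *: x i).
Proof.
move=> cA c0 c1 Ax.
have key (s : seq I) : all P s -> let S := \sum_(i <- s) c i in
    0 <= S /\ (0 < S -> A (S^-1 *: \sum_(i <- s) c i *: x i)).
  elim: s => [|i s IH] /=; first by rewrite !big_nil ltxx lexx; split.
  case/andP => Pi Ps; move: (IH Ps) => {IH}; rewrite !big_cons.
  set S := \sum_(j <- s) c j; set X := \sum_(j <- s) _ => -[S0 AS].
  split; first by rewrite addr_ge0 ?c0.
  have ci0 := c0 _ Pi; move=> Sp.
  have [z|cn] := eqVneq (c i) 0.
    by rewrite z add0r scale0r add0r; apply: AS; rewrite z add0r in Sp.
  have [z|Sn] := eqVneq S 0.
    have -> : X = 0.
      rewrite /X big_seq big1// => j js.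
      have : c j = 0; last by move=> ->; rewrite scale0r.
      apply/eqP; move/eqP: z; rewrite /S big_seq psumr_eq0.
        by move/allP => /(_ j js); rewrite js.
      by move=> l ls; apply: c0; move/allP: Ps => /(_ l ls).
    by rewrite z addr0 addr0 scalerA mulVf// scale1r; exact: Ax.
  have Spos : 0 < S by rewrite lt_def Sn.
  have cpos : 0 < c i by rewrite lt_def cn.
  have -> : (c i + S)^-1 *: (c i *: x i + X) =
     (c i / (c i + S)) *: x i + (1 - c i / (c i + S)) *: (S^-1 *: X).
    rewrite scalerDr !scalerA; congr (_ *: _ + _ *: _); first by rewrite mulrC.
    by field; rewrite Sn /= lt0r_neq0.
  apply: cA; first by rewrite divr_ge0// ltW.
  - by rewrite ler_pdivrMr// mul1r lerDl.
  - exact: Ax.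
  - exact: AS.
have [] := key [seq i <- index_enum I | P i]; first exact: filter_all.
by rewrite !big_filter c1 => _; rewrite invr1 scale1r; apply.
Qed.

(** More than k + 1 rows (x i, 1) of length k + 1 are linearly dependent. The coefficients sum to 0
    and do not all vanish, so one of them is positive. *)
Lemma radon (T : finType) (A : {set T}) (x : T -> 'rV[R]_k) : (k.+1 < #|A|)%N ->
  exists c : T -> R, [/\ \sum_(i in A) c i = 0, \sum_(i in A) c i *: x i = 0 &
    exists2 i, i \in A & 0 < c i].
Proof.
move=> hA.
have /card_gt0P[a0 a0A] : (0 < #|A|)%N by apply: leq_trans hA.
pose M : 'M[R]_(#|A|, k + 1) := \matrix_i row_mx (x (enum_val i)) (const_mx 1).
have : kermx M != 0.
  rewrite kermx_eq0 /row_free neq_ltn; apply/orP; left.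
  by apply: leq_ltn_trans (rank_leq_col _) _; rewrite addn1.
case/rowV0Pn => u /sub_kermxP uM un.
pose c i := u 0 (enum_rank_in a0A i).
have sE (W : lmodType R) (F : T -> W) :
    \sum_(i in A) c i *: F i = \sum_j u 0 j *: F (enum_val j).
  rewrite [LHS]big_enum_val; apply: eq_bigr => j _.
  by rewrite /c enum_valK_in.
have uE : u *m M = \sum_j u 0 j *: row_mx (x (enum_val j)) (const_mx 1).
  rewrite mulmx_sum_row; apply: eq_bigr => j _; by rewrite rowK.
have E1 : \sum_j u 0 j *: x (enum_val j) = 0.
  have := congr1 lsubmx uM; rewrite uE !linear_sum /= linear0 => {2}<-.
  by apply: eq_bigr => j _; rewrite linearZ /= row_mxKl.
have E2 : \sum_j u 0 j = 0.
  have := congr1 (fun m : 'rV_(k + 1) => rsubmx m 0 0) uM.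
  rewrite uE linear_sum /= summxE linear0 mxE => {2}<-.
  by apply: eq_bigr => j _; rewrite linearZ /= row_mxKr !mxE mulr1.
have C1 : \sum_(i in A) c i = 0.
  rewrite -{2}E2; have := sE R^o (fun=> 1).
  by under eq_bigr do rewrite [_ *: _]mulr1; move=> ->; apply: eq_bigr => j _; rewrite [_ *: _]mulr1.
exists c; split => //; first by rewrite sE.
apply: contrapT => H.
have c0 i : i \in A -> c i <= 0.
  by move=> iA; rewrite leNgt; apply/negP => ci; apply: H; exists i.
have h0 i : i \in A -> c i = 0.
  move=> iA; apply/eqP; rewrite -oppr_eq0; apply/eqP.
  move: i iA; apply: (psumr_eq0P (P := mem A)) => [i iA|]; first by rewrite oppr_ge0 c0.
  by rewrite sumrN C1 oppr0.
case/negP: un; apply/eqP/matrixP => i j; rewrite ord1 mxE.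
by have := h0 _ (enum_valP j); rewrite /c enum_valK_in.
Qed.

Definition inter (T : finType) (K : T -> set 'rV[R]_k) (Q : {set T}) : set 'rV[R]_k :=
  fun x => forall i, i \in Q -> K i x.

Definition meets (T : finType) (K : T -> set 'rV[R]_k) (Q : {set T}) :=
  exists x, inter K Q x.

Lemma cvx_inter (T : finType) (K : T -> set 'rV[R]_k) Q :
  (forall i, cvx (K i)) -> cvx (inter K Q).
Proof. by move=> cK x y t t0 t1 Ax Ay i iQ; apply: cK => //; [exact: Ax|exact: Ay]. Qed.

Lemma meetsS (T : finType) (K : T -> set 'rV[R]_k) (P Q : {set T}) :
  P \subset Q -> meets K Q -> meets K P.
Proof. by move=> /fintype.subsetP sPQ [x h]; exists x => i /sPQ; exact: h. Qed.

(** Radon's argument. Let x i lie in every member of [A] except possibly the i-th. The positive and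
    the negative part of an affine dependence of these points represent the same point z, and [K j]
    contains all points of the part to which j does not belong. *)
Theorem helly (T : finType) (K : T -> set 'rV[R]_k) (A : {set T}) :
  (forall i, cvx (K i)) ->
  (forall Q : {set T}, Q \subset A -> (#|Q| <= k.+1)%N -> meets K Q) -> meets K A.
Proof.
move=> cK; have [n] := ubnP #|A|; elim: n A => // n IH A /ltnSE hn hA.
have [small|big] := leqP #|A| k.+1; first exact: hA.
have pt i : exists x, i \in A -> inter K (A :\ i) x.
  have [iA|] := boolP (i \in A); last by exists 0.
  have [|Q sQ|x hx] := IH (A :\ i); last by exists x.
    by apply: leq_trans hn; rewrite (cardsD1 i A) iA.
  by apply: hA; apply: fintype.subset_trans sQ (subD1set _ _).
have [x hx] := choice pt.
have [c [c0 cx [i0 i0A ci0]]] := radon x big.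
pose S := \sum_(i in A | 0 < c i) c i.
have Sp : 0 < S.
  rewrite /S (bigD1 i0) ?i0A//=; apply: ltr_pwDl => //.
  by apply: sumr_ge0 => i /andP[/andP[_ /ltW]].
have SN : S = \sum_(i in A | ~~ (0 < c i)) - c i.
  by rewrite sumrN; apply/eqP; rewrite -addr_eq0 /S -bigID c0.
pose z := S^-1 *: \sum_(i in A | 0 < c i) c i *: x i.
have zN : z = \sum_(i in A | ~~ (0 < c i)) (- c i / S) *: x i.
  under eq_bigr do rewrite mulrC -scalerA scaleNr.
  rewrite -scaler_sumr sumrN /z; congr (_ *: _); apply/eqP.
  by rewrite -addr_eq0 -bigID cx.
have zP : z = \sum_(i in A | 0 < c i) (c i / S) *: x i.
  by rewrite /z scaler_sumr; apply: eq_bigr => i _; rewrite scalerA mulrC.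
exists z => j jA; case: (boolP (0 < c j)) => cj.
  rewrite zN; apply: cvx_sum => //.
  - by move=> i /andP[_]; rewrite -leNgt => h; rewrite divr_ge0 ?(ltW Sp)// oppr_ge0.
  - by rewrite -mulr_suml -SN divff// lt0r_neq0.
  - move=> i /andP[iA cin] _; apply: (hx i iA); rewrite !inE jA andbT.
    by apply: contraNneq cin => <-.
rewrite zP; apply: cvx_sum => //.
- by move=> i /andP[_ h]; rewrite divr_ge0 ?(ltW Sp)// ltW.
- by rewrite -mulr_suml divff// lt0r_neq0.
- move=> i /andP[iA cin] _; apply: (hx i iA); rewrite !inE jA andbT.
  by apply: contraTneq cin => <-.
Qed.

(* The sets [K i] with [i \in Q], together with the open ball of radius [|x|],
   have no common point, so by Helly some [k] of the [K i] already avoid that ball. *)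
Lemma is_min_basis (T : finType) (K : T -> set 'rV[R]_k) (Q : {set T}) x :
  (forall i, cvx (K i)) -> is_min (inter K Q) x ->
  exists D : {set T}, [/\ D \subset Q, (#|D| <= k)%N & is_min (inter K D) x].
Proof.
move=> cK [Qx mx].
pose K' (o : option T) : set 'rV[R]_k :=
  if o is Some i then K i else fun y => dotv y y < dotv x x.
have cK' o : cvx (K' o) by case: o => [i|]; [exact: cK|exact: cvx_lt].
apply: contrapT => H.
have [|y hy] := @helly _ K' (None |: Some @: Q) cK'.
  move=> Q' sQ' cQ'.
  pose D := [set i | Some i \in Q'].
  have sD : D \subset Q.
    apply/fintype.subsetP => i; rewrite inE => /(fintype.subsetP sQ'); rewrite !inE /=.
    by rewrite mem_imset//; exact: Some_inj.
  have Dx : inter K D x by move=> i /(fintype.subsetP sD); exact: Qx.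
  have [nQ|nQ] := boolP (None \in Q'); last first.
    exists x => -[i iQ|/idPn[]//]; by apply: Dx; rewrite inE.
  have cD : (#|D| <= k)%N.
    rewrite -ltnS; apply: leq_trans cQ'; rewrite (cardsD1 None) nQ add1n ltnS.
    rewrite -(card_imset (mem D) Some_inj); apply: subset_leq_card.
    by apply/fintype.subsetP => _ /imsetP[i iD ->]; rewrite !inE /=; rewrite inE in iD.
  have : ~ is_min (inter K D) x by move=> m; apply: H; exists D.
  move=> nm; apply: contrapT => nmeet; apply: nm; split => // y Dy.
  rewrite leNgt; apply/negP => lt; apply: nmeet; exists y => -[i iQ|_] //=.
  by apply: Dy; rewrite inE.
have Qy : inter K Q y.
  by move=> i iQ; apply: (hy (Some i)); rewrite !inE /= mem_imset//; exact: Some_inj.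
by have := hy None (setU11 _ _); rewrite /= ltNge mx.
Qed.

Lemma continuous_dotvl x : continuous (fun y => dotv x y).
Proof.
rewrite /dotv; apply: continuous_big => [|i _ y]; first exact: add_continuous.
have h := @coord_continuous R 1 k 0 i y.
exact: (cvgM (cvg_cst (x 0 i)) h).
Qed.

Lemma continuous_dotv : continuous (fun y => dotv y y).
Proof.
rewrite /dotv; apply: continuous_big => [|i _ y]; first exact: add_continuous.
have h := @coord_continuous R 1 k 0 i y.
exact: (cvgM h h).
Qed.

Lemma is_min_exists A : (A !=set0)%classic -> compact A -> exists x, is_min A x.
Proof.
move=> A0 cA; have [|x xA mx] := EVT_min_rV A0 cA (f := fun y => dotv y y).
  exact/continuous_subspaceT/continuous_dotv.
by exists x; split; [exact: set_mem|move=> y yA; apply: mx; exact: mem_set].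
Qed.

End Convexity.

(** * The (p, q) property and the Hadwiger-Debrunner theorem *)

Lemma subset_card_between (T : finType) (A B : {set T}) m :
  A \subset B -> (#|A| <= m <= #|B|)%N ->
  exists C : {set T}, [/\ A \subset C, C \subset B & #|C| = m].
Proof.
move=> sAB /andP[]; have [n] := ubnP (m - #|A|); elim: n A sAB => // n IH A sAB hn Am mB.
have [e|ne] := eqVneq #|A| m; first by exists A.
have lt : (#|A| < m)%N by rewrite ltn_neqAle ne.
have /properP[_ [i iB iA]] : A \proper B.
  by rewrite properEcard sAB; exact: leq_trans lt mB.
have cA : #|i |: A| = #|A|.+1 by rewrite cardsU1 iA.
have [|||//|C [sC CB mC]] := IH (i |: A).
- by rewrite subUset sub1set iB.
- by rewrite cA; lia.
- by rewrite cA.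
by exists C; split => //; apply: subset_trans sC; rewrite subsetUr.
Qed.

Section Families.
Context {R : realType} {d : nat} {T : finType}.
Variable K : T -> set 'rV[R]_d.
Implicit Types (A B D G Q : {set T}) (p q m n : nat).

Definition pq p q A := forall G, G \subset A -> #|G| = p ->
  exists Q, [/\ Q \subset G, #|Q| = q & meets K Q].

Definition pierced m A := exists2 s : seq 'rV[R]_d, (size s <= m)%N &
  forall i, i \in A -> exists2 x, x \in s & K i x.

Lemma piercedS m n A B : (m <= n)%N -> B \subset A -> pierced m A -> pierced n B.
Proof.
move=> mn /subsetP sBA [s sm h]; exists s; first exact: leq_trans mn.
by move=> i /sBA; exact: h.
Qed.

Lemma piercedU m n A B : pierced m A -> pierced n B -> pierced (m + n) (A :|: B).
Proof.
move=> [s sm hs] [t tn ht]; exists (s ++ t); first by rewrite size_cat leq_add.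
move=> i; rewrite inE => /orP[/hs|/ht] [x xs Kx]; exists x => //.
  by rewrite mem_cat xs.
by rewrite mem_cat xs orbT.
Qed.

Lemma pierced_meets Q : meets K Q -> pierced 1 Q.
Proof. by move=> [x hx]; exists [:: x] => // i iQ; exists x; [rewrite inE|exact: hx]. Qed.

Hypothesis K0 : forall i, (K i !=set0)%classic.

Lemma pierced_card A : pierced #|A| A.
Proof.
have [x hx] := choice K0.
exists [seq x i | i <- enum A]; first by rewrite size_map -cardE.
by move=> i iA; exists (x i) => //; apply/mapP; exists i; rewrite ?mem_enum.
Qed.

Lemma pierced_sub_meets A Q : Q \subset A -> meets K Q -> pierced (#|A| - #|Q|).+1 A.
Proof.
move=> sQ mQ; have := piercedU (pierced_meets mQ) (pierced_card (A :\: Q)).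
rewrite cardsD (setIidPr sQ) add1n; apply: piercedS => //.
by apply/subsetP => i iA; rewrite !inE iA andbT orbN.
Qed.

Hypothesis Kcvx : forall i, cvx (K i).
Hypothesis Kcpt : forall i, compact (K i).

Lemma is_min_inter_exists D : D != set0 -> meets K D ->
  exists x, is_min (inter K D) x.
Proof.
move=> /set0Pn[i iD] mD; apply: is_min_exists => //.
have -> : inter K D = (\bigcap_(j in [set` D]) K j)%classic by [].
apply: (@subclosed_compact _ _ (K i)) => //.
  by apply: closed_bigI => j _; apply: compact_closed => //; exact: norm_hausdorff.
by move=> x; apply.
Qed.

(** A sigma type, so that [min_pt] is a single function of [D]; elsewhere its value is 0. *)
Lemma min_pt_choice : { v : {set T} -> 'rV[R]_d |
  forall D, D != set0 -> meets K D -> is_min (inter K D) (v D) }.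
Proof.
pose P D x := D != set0 -> meets K D -> is_min (inter K D) x.
have [D|f hf] := @choice _ _ P; last by exact: cid (ex_intro _ f hf).
rewrite /P; have [D0|Dn] := eqVneq D set0; first by exists 0.
have [m|nm] := pselect (meets K D); last by exists 0.
by have [x hx] := is_min_inter_exists Dn m; exists x.
Qed.

Definition min_pt := sval min_pt_choice.

Lemma min_ptP D : D != set0 -> meets K D -> is_min (inter K D) (min_pt D).
Proof. exact: (svalP min_pt_choice). Qed.

(** A basis of fewer than d members is filled up inside [Q]: the intersection shrinks but keeps its
    least-norm point. Exactly d members are needed to count bases by a binomial coefficient. *)
Lemma min_pt_basis Q : (0 < d)%N -> (d <= #|Q|)%N -> meets K Q ->
  exists D, [/\ D \subset Q, #|D| = d, meets K D & min_pt D = min_pt Q].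
Proof.
move=> d0 dQ mQ.
have Q0 : Q != set0 by rewrite -card_gt0; exact: leq_trans dQ.
have mn := min_ptP Q0 mQ.
have [E [EQ Ed mE]] := is_min_basis Kcvx mn.
have [|D [ED DQ cD]] := @subset_card_between _ E Q d EQ; first by rewrite Ed.
have mD : meets K D by exact: meetsS DQ mQ.
exists D; split => //; apply: (is_min_unique (cvx_inter (Q := D) Kcvx)).
  by apply: min_ptP => //; rewrite -card_gt0 cD.
apply: is_minS mE => [y Dy i iE|i iD]; first exact: (Dy _ (subsetP ED _ iE)).
by case: mn => h _; exact: (h _ (subsetP DQ _ iD)).
Qed.

(** An intersecting [Q] is encoded by d of its members [D] with the same least-norm point, together
    with [Q :\: D]. The latter consists of members of [G] through that point, of which at most c lie
    outside [D]. *)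
Lemma card_meets_le G q c : (0 < d)%N -> (d <= q)%N ->
  (forall Q, Q \subset G -> meets K Q -> (#|Q| <= c + d)%N) ->
  (#|[set Q : {set T} | [&& Q \subset G, #|Q| == q & `[< meets K Q >] ]]|
    <= 'C(#|G|, d) * 'C(c, q - d))%N.
Proof.
move=> d0 dq hc.
pose dr B m := [set E : {set T} | E \subset B & #|E| == m].
pose Bd D := [set i in G :\: D | `[< K i (min_pt D) >]].
pose im D := if `[< meets K D >] then [set D :|: E | E : {set T} in dr (Bd D) (q - d)%N]
             else set0.
apply: (@leq_trans #|\bigcup_(D in dr G d) im D|).
  apply: subset_leq_card; apply/subsetP => Q; rewrite inE => /and3P[QG /eqP cQ /asboolP mQ].
  have [|D [DQ cD mD eD]] := min_pt_basis d0 _ mQ; first by rewrite cQ.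
  apply/bigcupP; exists D; first by rewrite inE cD eqxx (subset_trans DQ QG).
  rewrite /im (asboolT mD); apply/imsetP; exists (Q :\: D); last first.
    by apply/setP => i; rewrite !inE; case: (boolP (i \in D)) => // /(subsetP DQ) ->.
  rewrite inE cardsD (setIidPr DQ) cQ cD eqxx andbT.
  apply/subsetP => i; rewrite !inE => /andP[iD iQ]; rewrite iD (subsetP QG)//=.
  apply/asboolP; rewrite eD; have [] : is_min (inter K Q) (min_pt Q); last by move=> h _; exact: h.
  by apply: min_ptP => //; apply/set0Pn; exists i.
apply: leq_trans (_ : \sum_(D in dr G d) 'C(c, q - d) <= _)%N; last first.
  by rewrite sum_nat_const -/(dr G d) /dr cards_draws.
apply: leq_trans (_ : \sum_(D in dr G d) #|im D| <= _)%N.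
  elim/big_rec2: _ => [|D m U _ h]; first by rewrite cards0.
  by apply: leq_trans (leq_card_setU _ _) _; rewrite leq_add2l.
apply: leq_sum => D; rewrite inE => /andP[DG /eqP cD]; rewrite /im.
case: asboolP => [mD|_]; last by rewrite cards0.
apply: leq_trans (leq_imset_card _ _) _; rewrite cards_draws; apply: leq_bin2l.
have D0 : D != set0 by rewrite -card_gt0 cD.
have [mn _] := min_ptP D0 mD.
rewrite -(leq_add2r d) -{1}cD.
have <- : #|Bd D :|: D| = (#|Bd D| + #|D|)%N.
  rewrite cardsU; suff -> : Bd D :&: D = set0 by rewrite cards0 subn0.
  by apply/setP => i; rewrite !inE; case: (i \in D); rewrite /= ?andbF.
apply: hc.
  by rewrite subUset DG andbT; apply/subsetP => i; rewrite !inE => /andP[/andP[]].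
exists (min_pt D) => i; rewrite !inE => /orP[/andP[_ /asboolP]//|]; exact: mn.
Qed.

End Families.

Section HadwigerDebrunner.
Context {R : realType} {d : nat} {T : finType}.
Variable K : T -> set 'rV[R]_d.
Implicit Types (A B D G Q : {set T}) (p q m n : nat).
Hypotheses (K0 : forall i, (K i !=set0)%classic) (Kcvx : forall i, cvx (K i))
  (Kcpt : forall i, compact (K i)).

Lemma pq_le p q A : (p <= #|A|)%N -> pq K p q A -> (q <= p)%N.
Proof.
move=> pA h; have [|G [_ GA cG]] := @subset_card_between _ set0 A p (sub0set _); first by rewrite cards0.
by have [Q [QG <- _]] := h G GA cG; rewrite -cG subset_leq_card.
Qed.

Lemma helly_card A q : (d < q)%N -> (q <= #|A|)%N ->
  (forall Q, Q \subset A -> #|Q| = q -> meets K Q) -> meets K A.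
Proof.
move=> dq qA h; apply: helly => // Q QA cQ.
have [|G [QG GA cG]] := @subset_card_between _ Q A q QA; first by rewrite (leq_trans cQ).
exact: meetsS QG (h G GA cG).
Qed.

(* The pierced point is the farthest from the origin among the least-norm points
   of the intersecting [d]-tuples; a [q]-tuple containing the extremal [D] can then
   only consist of sets through that point. *)
Theorem hadwiger_debrunner p q A : (0 < d)%N -> (d.-1 * p + d < d * q)%N ->
  (p <= #|A|)%N -> pq K p q A -> pierced K (p.+1 - q) A.
Proof.
move=> d0; have [n] := ubnP p; elim: n p q A => // n IH p q A /ltnSE pn hq pA hpq.
have qp := pq_le pA hpq.
have dq : (d < q)%N by move: hq qp; case: d d0 => // e _ /=; nia.
have [epq|npq] := eqVneq p q.
  rewrite epq subSnn; apply: pierced_meets; apply: (@helly_card _ q) => //; first by rewrite -epq.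
  move=> Q QA cQ; have [|Q' [Q'Q cQ' mQ']] := hpq Q QA; first by rewrite epq.
  by have -> : Q = Q' by apply/esym/eqP; rewrite eqEcard Q'Q cQ cQ' leqnn.
have ltqp : (q < p)%N by rewrite ltn_neqAle eq_sym npq.
have [|G0 [_ G0A cG0]] := @subset_card_between _ set0 A p (sub0set _); first by rewrite cards0.
have [Q0 [Q0G cQ0 mQ0]] := hpq G0 G0A cG0.
have [|D0 [D0Q cD0 mD0 _]] := min_pt_basis Kcvx Kcpt d0 _ mQ0; first by rewrite cQ0 ltnW.
pose good D := [&& D \subset A, #|D| == d & `[< meets K D >] ].
pose v := min_pt Kcpt; pose nv D := dotv (v D) (v D).
have gD0 : good D0.
  by rewrite /good cD0 eqxx (asboolT mD0) (subset_trans D0Q (subset_trans Q0G G0A)).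
have [D /and3P[DA /eqP cD /asboolP mD] Dmax] := arg_maxP nv gD0.
have Dn0 : D != set0 by rewrite -card_gt0 cD.
have vD : is_min (inter K D) (v D) by exact: min_ptP.
pose A' := [set i in A | ~~ `[< K i (v D) >] ].
(* The least-norm point of [j |: D] is that of d of its members, so by maximality its norm is at
   most that of [v D]. As it lies in all members of [D], it equals [v D], which the j-th set
   misses. *)
have key j Q : j \in A' -> Q \subset A -> meets K Q -> D \subset Q -> j \in Q -> False.
  move=> jA' QA mQ DQ jQ; have sQ : j |: D \subset Q by rewrite subUset sub1set jQ.
  have mjD := meetsS sQ mQ.
  have jD0 : j |: D != set0 by apply/set0Pn; exists j; rewrite setU11.
  have [|E [ED cE mE vE]] := min_pt_basis Kcvx Kcpt d0 _ mjD.
    by rewrite -cD subset_leq_card// subsetUr.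
  have [hw mw] : is_min (inter K (j |: D)) (v (j |: D)) by exact: min_ptP.
  have w_le : nv (j |: D) <= nv D.
    rewrite /nv /v -vE; apply: Dmax.
    by rewrite /good cE eqxx (asboolT mE) (subset_trans ED (subset_trans sQ QA)).
  have wD : is_min (inter K D) (v (j |: D)).
    split; first by move=> i iD; apply: hw; rewrite setU1r.
    by move=> y yD; apply: le_trans w_le _; case: vD => _; apply.
  have := is_min_unique (cvx_inter Kcvx) vD wD => e.
  by move: jA'; rewrite inE => /andP[_ /asboolP[]]; rewrite e; apply: hw; rewrite setU11.
have cov m : pierced K m A' -> pierced K m.+1 A.
  have p1 : pierced K 1 (A :\: A').
    apply: pierced_meets; exists (v D) => i; rewrite !inE => /andP[+ iA].
    by rewrite iA /= negbK => /asboolP.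
  move=> pm; rewrite -add1n; apply: piercedS (piercedU p1 pm) => //.
  by apply/subsetP => i iA; rewrite !inE iA !andbT; case: `[< _ >].
have DA' : D :&: A' = set0.
  apply/setP => i; rewrite !inE; apply/negP => /and3P[iD _ /asboolP]; apply.
  by case: vD => + _; apply.
have sA'A : A' \subset A by apply/subsetP => i; rewrite inE => /andP[].
suff : pierced K (p - q) A' by move/cov; rewrite subSn.
(* By [key] an intersecting q-tuple that reaches into [A'] omits a member of [D]. Removing [D] thus
   takes d from p but only d - 1 from q, and p - q drops by the one point already spent. *)
have [big|small] := leqP (p - d) #|A'|.
  have -> : (p - q = (p - d).+1 - (q - d.-1))%N by nlia.
  apply: (IH (p - d)%N) => //; first nlia.
    move: hq dq ltqp; case: d d0 => // e _ /= hq dq ltqp.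
    have -> : p = (p - e.+1 + e.+1)%N by nlia.
    have -> : q = (q - e + e)%N by nlia.
    by rewrite !addnK; nia.
  move=> G GA' cG.
  have GDA : G :|: D \subset A by rewrite subUset DA (subset_trans GA').
  have GD : G :&: D = set0.
    by apply/eqP; rewrite -subset0 -DA' setIC setIS.
  have cGD : #|G :|: D| = p by rewrite cardsU GD cards0 cG cD subn0 subnK//; nlia.
  have [Q [QG cQ mQ]] := hpq _ GDA cGD.
  have cQD : (#|Q :&: D| <= d.-1)%N.
    rewrite leqNgt; apply/negP => h.
    have DQ : D \subset Q.
      have /eqP <- : Q :&: D == D by rewrite eqEcard subsetIr cD; nlia.
      exact: subsetIl.
    have /properP[_ [j jQ jD]] : D \proper Q by rewrite properEcard DQ cD cQ.
    apply: (key j Q) => //; last exact: subset_trans QG GDA.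
    by move: (subsetP QG j jQ); rewrite inE (negPf jD) orbF => /(subsetP GA').
  have cQG : (q - d.-1 <= #|Q :&: G|)%N.
    have : (#|Q| <= #|Q :&: G| + #|Q :&: D|)%N.
      by apply: leq_trans (leq_card_setU _ _); rewrite -setIUr (setIidPl QG).
    by rewrite cQ; nlia.
  have [|Q' [_ Q'Q cQ']] := @subset_card_between _ set0 (Q :&: G) (q - d.-1) (sub0set _).
    by rewrite cards0.
  exists Q'; split => //; first exact: subset_trans Q'Q (subsetIr _ _).
  by apply: meetsS mQ; exact: subset_trans Q'Q (subsetIl _ _).
have [sA'|bA'] := leqP #|A'| (p - q); first exact: piercedS sA' _ (pierced_card K0 A').
(* Here [A'] is too small for induction but larger than p - q. An intersecting q-tuple of a p-set
   containing [A'] and [D] reaches into [A'], hence omits a member of [D], so more than q - (p -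
   #|A'|) of its members lie in [A'] and share one point. *)
have [||G [sG GA cG]] := @subset_card_between _ (A' :|: D) A p.
- by rewrite subUset sA'A.
- by rewrite pA andbT cardsU setIC DA' cards0 cD; nlia.
have [Q [QG cQ mQ]] := hpq G GA cG.
have [A'G DG] : A' \subset G /\ D \subset G by move: sG; rewrite subUset => /andP[].
have cGA : (#|G :\: A'| = p - #|A'|)%N by rewrite cardsD (setIidPr A'G) cG.
have hc : (#|Q :\: A'| <= p - #|A'|)%N by rewrite -cGA subset_leq_card ?setSD.
have cQA : (#|Q| = #|Q :&: A'| + #|Q :\: A'|)%N by rewrite cardsID.
have /set0Pn[j] : Q :&: A' != set0 by rewrite -card_gt0; nlia.
rewrite inE => /andP[jQ jA'].
have nDQ : ~~ (D \subset Q).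
  by apply/negP => DQ; apply: (key j Q) => //; exact: subset_trans QG GA.
have hc2 : (#|Q :\: A'| < p - #|A'|)%N.
  rewrite -cGA; apply: proper_card; apply/properP.
  split; first exact: setSD.
  case/subsetPn: nDQ => i iD iQ; exists i; last by rewrite inE (negPf iQ) andbF.
  rewrite inE (subsetP DG)// andbT; apply/negP => iA'.
  by move/setP/(_ i): DA'; rewrite !inE iD /= => h; move: iA'; rewrite inE h.
have mQA : meets K (Q :&: A') by apply: meetsS mQ; exact: subsetIl.
apply: piercedS (pierced_sub_meets K0 (subsetIr Q A') mQA) => //; nlia.
Qed.

End HadwigerDebrunner.

(** * Points of large depth *)

Lemma card_draws_above (T : finType) (Q : {set T}) (m P : nat) : #|Q| = m ->
  (#|[set G : {set T} | (Q \subset G) && (#|G| == P)]| <= 'C(#|T| - m, P - m))%N.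
Proof.
move=> cQ; have -> : (#|T| - m = #|~: Q|)%N by rewrite cardsCs setCK cQ.
rewrite -cards_draws; apply: leq_trans (leq_imset_card (fun E => Q :|: E) _).
apply: subset_leq_card; apply/subsetP => G; rewrite inE => /andP[QG /eqP cG].
apply/imsetP; exists (G :\: Q); last first.
  by apply/setP => i; rewrite !inE; case: (boolP (i \in Q)) => // /(subsetP QG) ->.
rewrite inE cardsD (setIidPr QG) cG cQ eqxx andbT.
by apply/subsetP => i; rewrite !inE => /andP[].
Qed.

Lemma bin_trinomial n P m : (m <= P)%N -> (P <= n)%N ->
  ('C(n, P) * 'C(P, m) = 'C(n, m) * 'C(n - m, P - m))%N.
Proof.
move=> mP Pn; apply/eqP; rewrite -(eqn_pmul2r (fact_gt0 m)) -(eqn_pmul2r (fact_gt0 (P - m))).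
rewrite -(eqn_pmul2r (fact_gt0 (n - P))); apply/eqP.
have e1 := bin_fact mP; have e2 := bin_fact Pn.
have e3 : ('C(n, m) * (m`! * (n - m)`!) = n`!)%N by apply: bin_fact; nlia.
have : ('C(n - m, P - m) * ((P - m)`! * (n - m - (P - m))`!) = (n - m)`!)%N by apply: bin_fact; nlia.
have -> : (n - m - (P - m) = n - P)%N by nlia.
move=> e4.
transitivity ('C(n, P) * ('C(P, m) * (m`! * (P - m)`!)) * (n - P)`!)%N; first by ring.
rewrite e1 -mulnA e2 -e3 -e4; ring.
Qed.

(* de Caen-type averaging over the [P]-element subsets. *)
Lemma card_hitting_family (T : finType) (mt : pred {set T}) (m P : nat) :
  (m <= P)%N -> (P <= #|T|)%N ->
  (forall G : {set T}, #|G| = P -> exists Q : {set T}, [/\ Q \subset G, #|Q| = m & mt Q]) ->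
  ('C(#|T|, m) <= 'C(P, m) * #|[set Q : {set T} | (#|Q| == m) && mt Q]|)%N.
Proof.
move=> mP PT h; set N := #|_|.
have hCP : ('C(#|T|, P) <= N * 'C(#|T| - m, P - m))%N.
  rewrite -cardsT -cards_draws cardsT /N -sum_nat_const.
  apply: leq_trans (_ : _ <= #|\bigcup_(Q in [set Q : {set T} | (#|Q| == m) && mt Q])
      [set G : {set T} | (Q \subset G) && (#|G| == P)]|)%N _.
    apply: subset_leq_card; apply/subsetP => G; rewrite inE => /andP[_ /eqP cG].
    have [Q [QG cQ mQ]] := h G cG; apply/bigcupP; exists Q; first by rewrite inE cQ eqxx.
    by rewrite inE QG cG eqxx.
  apply: leq_trans (_ : \sum_(Q in [set Q : {set T} | (#|Q| == m) && mt Q])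
      #|[set G : {set T} | (Q \subset G) && (#|G| == P)]| <= _)%N.
    elim/big_rec2: _ => [|D m' U _ h']; first by rewrite cards0.
    by apply: leq_trans (leq_card_setU _ _) _; rewrite leq_add2l.
  by apply: leq_sum => Q; rewrite inE => /andP[/eqP cQ _]; exact: card_draws_above.
have C0 : (0 < 'C(#|T| - m, P - m))%N by rewrite bin_gt0; nlia.
rewrite -(leq_pmul2r C0) -bin_trinomial// mulnC -mulnA leq_mul2l; apply/orP; right.
exact: hCP.
Qed.

(** * Weighted fractional Helly theorems and multiplicative weights *)

Section Depth.
Context {R : realType} {d : nat} {T : finType}.
Variable K : T -> set 'rV[R]_d.
Implicit Types (A B D G Q S W : {set T}) (p q m n : nat) (w : T -> nat).

Definition depth w A (x : 'rV[R]_d) : nat := (\sum_(i in A | `[< K i x >]) w i)%N.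

(** [w i] copies of each member of [A]. Indices outside [A] get an empty fibre, so that weighted
    counts over [A] become cardinalities. *)
Definition blowup w A : finType := {i : T & 'I_(if i \in A then w i else 0)}.

Lemma card_blowup w A (P : pred T) :
  #|[set u : blowup w A | P (tag u)]| = (\sum_(i in A | P i) w i)%N.
Proof.
transitivity (\sum_(i | P i) \sum_(j : 'I_(if i \in A then w i else 0)) 1)%N; last first.
  rewrite [RHS]big_mkcondl /=; apply: eq_bigr => i _.
  by rewrite sum1_card card_ord.
rewrite (sig_big_dep P (fun i => predT) (fun (i : T) (j : 'I_(if i \in A then w i else 0)) => 1%N)).
by rewrite -sum1_card; apply: eq_bigl => u; rewrite inE andbT.
Qed.

Lemma card_blowupT w A : #|blowup w A| = (\sum_(i in A) w i)%N.
Proof.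
transitivity (\sum_(i in A | predT i) w i)%N; last by apply: eq_bigl => i; rewrite andbT.
by rewrite -card_blowup -cardsT; apply: eq_card => u; rewrite !inE.
Qed.

Lemma tag_blowup w A (u : blowup w A) : tag u \in A.
Proof. by case: u => i /=; case: (i \in A) => // -[]. Qed.

Lemma leq_expn_ffact n j : ((n - j) ^ j <= n ^_ j)%N.
Proof.
rewrite ffact_prod -[X in (_ ^ X <= _)%N](card_ord j) -prod_nat_const.
by apply: leq_prod => i _; have := ltn_ord i; nlia.
Qed.

Lemma leq_ffact_expn n j : (n ^_ j <= n ^ j)%N.
Proof.
rewrite ffact_prod -[X in (_ <= _ ^ X)%N](card_ord j) -prod_nat_const.
by apply: leq_prod => i _; rewrite leq_subr.
Qed.

Lemma leq_bin_exp2 m j : ('C(m, j) <= 2 ^ m)%N.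
Proof.
have := subset_leq_card (subsetT [set B : {set 'I_m} | #|B| == j]).
by rewrite card_draws -powersetT card_powerset cardsT !card_ord.
Qed.

(** Factor by factor, (c - i) / (n - i) <= c / n. *)
Lemma bin_exp_ratio c n j : (c <= n)%N -> (n ^ j * 'C(c, j) <= c ^ j * 'C(n, j))%N.
Proof.
move=> cn; rewrite -(leq_pmul2r (fact_gt0 j)) -!mulnA !bin_ffact !ffact_prod.
rewrite -[in (n ^ _)%N](card_ord j) -[in (c ^ _)%N](card_ord j) -!prod_nat_const -!big_split /=.
apply: leq_prod => i _; move: (val i) => l; nia.
Qed.

Lemma leq_bin_expn m j : ('C(m, j) <= m ^ j)%N.
Proof.
by apply: leq_trans (leq_ffact_expn m j); rewrite -bin_ffact leq_pmulr ?fact_gt0.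
Qed.

Lemma bin_ratio n m j X Y : (j <= m)%N -> (m <= n)%N -> ('C(n, m) <= X * ('C(n, j) * Y))%N ->
  ('C(n - j, m - j) <= 'C(m, j) * X * Y)%N.
Proof.
move=> jm mn h; have C0 : (0 < 'C(n, j))%N by rewrite bin_gt0; nlia.
rewrite -(leq_pmul2l C0) -bin_trinomial//.
apply: leq_trans (_ : X * ('C(n, j) * Y) * 'C(m, j) <= _)%N; first by rewrite leq_mul2r h orbT.
by apply/eq_leq; ring.
Qed.

Lemma depth_blowup w A (Q : {set blowup w A}) x :
  inter (fun u : blowup w A => K (tag u)) Q x -> (#|Q| <= depth w A x)%N.
Proof.
move=> h; rewrite /depth -(card_blowup w A (fun i => `[< K i x >])); apply: subset_leq_card.
by apply/subsetP => u uQ; rewrite inE; apply/asboolP/h.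
Qed.

Hypotheses (K0 : forall i, (K i !=set0)%classic) (Kcvx : forall i, cvx (K i))
  (Kcpt : forall i, compact (K i)).

(* Among [m * p] members of the blow-up either one set occurs [m] times or [p]
   different sets occur. *)
Lemma pq_blowup p m A w : (0 < m)%N -> (0 < p)%N -> pq K p m A ->
  forall G : {set blowup w A}, #|G| = (m * p)%N -> exists Q : {set blowup w A},
    [/\ Q \subset G, #|Q| = m & meets (fun u : blowup w A => K (tag u)) Q].
Proof.
move=> m0 p0 hpq G cG; pose fib i := [set u in G | tag u == i].
have [pI|Ip] := leqP p #|[set tag u | u in G]|.
  have [|I1 [_ I1s cI1]] := @subset_card_between _ set0 _ p (sub0set [set tag u | u in G]).
    by rewrite cards0.
  have [|Q [QI cQ [x hx]]] := hpq I1 _ cI1.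
    by apply: subset_trans I1s _; apply/subsetP => _ /imsetP[u _ ->]; exact: tag_blowup.
  have /card_gt0P[u0 _] : (0 < #|G|)%N by rewrite cG muln_gt0 m0.
  pose f i := odflt u0 [pick u in fib i].
  have fP i : i \in Q -> f i \in G /\ tag (f i) = i.
    move=> /(subsetP QI)/(subsetP I1s)/imsetP[u uG ->]; rewrite /f; case: pickP => [v|].
      by rewrite inE => /andP[? /eqP].
    by move/(_ u); rewrite !inE uG eqxx.
  exists (f @: Q); split.
  - by apply/subsetP => _ /imsetP[i iQ ->]; case: (fP i iQ).
  - rewrite card_in_imset// => i j iQ jQ e.
    by case: (fP i iQ) => _ <-; case: (fP j jQ) => _ <-; rewrite e.
  - by exists x => _ /imsetP[i iQ ->]; case: (fP i iQ) => _ ->; exact: hx.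
have [i [iI ci]] : exists i, i \in A /\ (m <= #|fib i|)%N.
  apply: contrapT => H.
  have : (#|G| <= \sum_(i in [set tag u | u in G]) m.-1)%N.
    rewrite -sum1_card (partition_big (fun u => tag u) (mem [set tag u | u in G])) /=; last first.
      by move=> u uG; apply/imsetP; exists u.
    apply: leq_sum => i /imsetP[u _ ei]; rewrite -ltnS prednK// ltnNge; apply/negP => h; apply: H.
    exists i; rewrite ei; split; first exact: tag_blowup.
    apply: leq_trans h _; rewrite -ei sum1_card; apply/eq_leq/eq_card => v.
    by rewrite !inE.
  rewrite sum_nat_const cG => h.
  have : (m * p <= p.-1 * m.-1)%N by apply: leq_trans h _; rewrite leq_mul2r; apply/orP; right; nlia.
  by case: m p m0 p0 {H h cG fib hpq Ip} => // m [|p] //= _ _; nia.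
have [|Q [_ QF cQ]] := @subset_card_between _ set0 (fib i) m (sub0set _); first by rewrite cards0.
have [x Kx] := K0 i.
exists Q; split => //; first by apply: subset_trans QF _; apply/subsetP => u; rewrite inE => /andP[].
by exists x => u /(subsetP QF); rewrite inE => /andP[_ /eqP ->].
Qed.

(** A fractional Helly theorem by counting: at least a fraction 1 / 'C(m p, m) of the m-tuples of
    copies intersect, while [card_meets_le] bounds their number through the largest intersecting set
    of copies. Weights of at least 2m make n - m at least n / 2, which absorbs the falling
    factorials. *)
Lemma pq_deep p m A w : (0 < d)%N -> (d < m)%N -> (0 < p)%N -> (p <= #|A|)%N ->
  pq K p m A -> (forall i, i \in A -> (2 * m <= w i)%N) ->
  exists x, ((\sum_(i in A) w i) ^ (m - d) <=
             2 ^ (m - d + m) * (m * p) ^ m * depth w A x ^ (m - d))%N.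
Proof.
move=> d0 dm p0 pA hpq hw; set n := (\sum_(i in A) w i)%N.
pose K' (u : blowup w A) := K (tag u).
have m0 : (0 < m)%N by nlia.
have cT : #|blowup w A| = n by exact: card_blowupT.
have hn : (2 * m * p <= n)%N.
  apply: leq_trans (_ : \sum_(i in A) (2 * m) <= _)%N; last exact: leq_sum.
  by rewrite sum_nat_const mulnC leq_mul2r pA orbT.
have [|Q0 mQ0 Qmax] := @arg_maxnP _ (set0 : {set blowup w A}) (fun Q : {set blowup w A} => `[< meets K' Q >]) (fun Q : {set blowup w A} => #|Q|).
  by apply/asboolP; exists 0 => u; rewrite inE.
move: mQ0 => /asboolP[x hx].
have hit : ('C(n, m) <= 'C(m * p, m) * ('C(n, d) * 'C(#|Q0| - d, m - d)))%N.
  rewrite -cT; apply: leq_trans (@card_hitting_family _ (fun Q : {set blowup w A} => `[< meets K' Q >]) m (m * p)%N _ _ _) _.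
  - by rewrite leq_pmulr.
  - rewrite cT; nia.
  - move=> G cG; have [Q [QG cQ mQ]] := pq_blowup m0 p0 hpq cG.
    by exists Q; split => //; apply/asboolP.
  rewrite leq_mul2l -cardsT; apply/orP; right.
  apply: leq_trans (card_meets_le (K := K') (G := setT) (q := m) (c := #|Q0| - d) _ _ d0 _ _) => //.
  - by apply: subset_leq_card; apply/subsetP => Q; rewrite !inE subsetT.
  - by move=> u; exact: Kcvx.
  - by move=> u; exact: Kcpt.
  - exact: ltnW.
  - by move=> Q _ mQ; have := Qmax Q (asboolT mQ); nlia.
have mn : (m <= n)%N by nia.
have := bin_ratio (ltnW dm) mn hit; rewrite -(leq_pmul2r (fact_gt0 (m - d))) -mulnA !bin_ffact => h.
exists x; apply: leq_trans (_ : 2 ^ (m - d) * (n - m) ^ (m - d) <= _)%N.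
  by rewrite -expnMn leq_exp2r; nia.
rewrite expnD -!mulnA leq_pmul2l ?expn_gt0//.
apply: leq_trans (_ : (n - d) ^_ (m - d) <= _)%N.
  by apply: leq_trans (leq_expn_ffact _ _); rewrite -subnDA subnKC// ltnW.
apply: leq_trans h _; rewrite -mulnA; apply: leq_mul; first exact: leq_bin_exp2.
apply: leq_mul; first exact: leq_bin_expn.
apply: leq_trans (leq_ffact_expn _ _) _; rewrite leq_exp2r ?subn_gt0//.
by apply: leq_trans (leq_subr _ _) _; exact: depth_blowup.
Qed.

(** The count of [pq_deep], made inside each [K s] separately. Every m-tuple of copies meets inside
    some [K s], so a factor [#|S|] replaces 'C(m p, m); when m is large compared with the logarithm
    of [#|S|], the depth is a fraction of the weight close to 1. *)
Lemma transversal_deep m A S w : (0 < d)%N -> (d < m)%N ->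
  (forall W : {set T}, W \subset A -> (#|W| <= m)%N -> exists2 s, s \in S & meets K (s |: W)) ->
  (m <= \sum_(i in A) w i)%N ->
  exists s x, [/\ s \in S, K s x & ((\sum_(i in A) w i - d) ^ (m - d) <=
             m ^ d * #|S| * depth w A x ^ (m - d))%N].
Proof.
move=> d0 dm hS; set n := (\sum_(i in A) w i)%N => mn.
apply: contrapT => H.
have {}H s x : s \in S -> K s x -> (m ^ d * #|S| * depth w A x ^ (m - d) < (n - d) ^ (m - d))%N.
  by move=> sS Kx; rewrite ltnNge; apply/negP => h; apply: H; exists s, x.
have cT : #|blowup w A| = n by exact: card_blowupT.
pose K' s (u : blowup w A) := (K (tag u) `&` K s)%classic.
have j0 : (0 < m - d)%N by rewrite subn_gt0.
have [s0 s0S [x0 hx0]] := hS set0 (sub0set _) ltac:(by rewrite cards0).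
have S0 : (0 < #|S|)%N by apply/card_gt0P; exists s0.
have mS0 : (0 < m ^ d * #|S|)%N by rewrite muln_gt0 expn_gt0 S0 andbT; nlia.
pose good c := [forall s in S, `[< forall x, K s x -> (depth w A x <= c)%N >] ].
have exc : exists c, good c.
  exists n; apply/forallP => s; apply/implyP => sS; apply/asboolP => x _.
  by rewrite /depth /n [leqRHS](bigID (fun i => `[< K i x >])) leq_addr.
case: (ex_minnP exc) => c /forallP gc cmin.
have dep s x : s \in S -> K s x -> (depth w A x <= c)%N.
  by move=> sS Kx; have /implyP/(_ sS)/asboolP := gc s; exact.
(* Minimality of [c]: by [H] a depth equal to [c] satisfies the strict inequality, so if [c]
   violated it, all depths would be at most [c.-1]. *)
have cub : (m ^ d * #|S| * c ^ (m - d) < (n - d) ^ (m - d))%N.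
  have [c0|c0] := posnP c.
    by rewrite c0 exp0n// muln0 expn_gt0; apply/orP; left; nlia.
  apply: contrapT => /negP; rewrite -leqNgt => hc.
  have : good c.-1.
    apply/forallP => s; apply/implyP => sS; apply/asboolP => x Kx.
    rewrite -ltnS prednK// ltn_neqAle (dep s)// andbT; apply/eqP => e.
    by have := H s x sS Kx; rewrite e ltnNge hc.
  by move/cmin; rewrite leqNgt ltn_predL c0.
have hit : ('C(n, m) <= #|S| * ('C(n, d) * 'C(c, m - d)))%N.
  rewrite -cT -cardsT -cards_draws -sum_nat_const.
  apply: leq_trans (_ : _ <= #|\bigcup_(s in S) [set Q : {set blowup w A} |
      [&& Q \subset setT, #|Q| == m & `[< meets (K' s) Q >] ] ]|)%N _.
    apply: subset_leq_card; apply/subsetP => Q; rewrite inE => /andP[_ /eqP cQ].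
    have [||s sS [x hx]] := hS [set tag u | u in Q].
    - by apply/subsetP => _ /imsetP[u _ ->]; exact: tag_blowup.
    - by rewrite -cQ leq_imset_card.
    apply/bigcupP; exists s => //; rewrite inE cQ eqxx subsetT; apply/asboolP.
    exists x => u uQ; split; last by apply: hx; rewrite setU11.
    by apply: hx; rewrite setU1r//; apply/imsetP; exists u.
  apply: leq_trans (_ : \sum_(s in S) #|[set Q : {set blowup w A} |
      [&& Q \subset setT, #|Q| == m & `[< meets (K' s) Q >] ] ]| <= _)%N.
    elim/big_rec2: _ => [|D m' U _ h']; first by rewrite cards0.
    by apply: leq_trans (leq_card_setU _ _) _; rewrite leq_add2l.
  apply: leq_sum => s sS.
  apply: leq_trans (card_meets_le (K := K' s) (G := setT) (q := m) (c := c) _ _ d0 _ _) _.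
  - by move=> u x y t t0 t1 [? ?] [? ?]; split; apply: Kcvx.
  - move=> u; apply: (@subclosed_compact _ _ (K s)) => //; last by move=> x [].
    by apply: closedI; apply: compact_closed => //; exact: norm_hausdorff.
  - exact: ltnW.
  - move=> Q _ [x hx]; have [->|/set0Pn[u uQ]] := eqVneq Q set0; first by rewrite cards0.
    apply: leq_trans (leq_trans (dep s x sS _) (leq_addr _ _)); last by case: (hx u uQ).
    by apply: depth_blowup => v vQ; case: (hx v vQ).
  - by rewrite cardsT.
have := bin_ratio (ltnW dm) mn hit => {}hit.
move: (cub); rewrite ltnNge => /negP; apply.
have cnd : (c <= n - d)%N.
  rewrite -(leq_exp2r _ _ j0); apply: ltnW; apply: leq_ltn_trans cub.
  by rewrite leq_pmull.
have C0 : (0 < 'C(n - d, m - d))%N by rewrite bin_gt0; apply: leq_sub2r.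
rewrite -(leq_pmul2r C0); apply: leq_trans (_ : (n - d) ^ (m - d) * (m ^ d * #|S| * 'C(c, m - d)) <= _)%N.
  rewrite leq_mul2l; apply/orP; right; apply: leq_trans hit _.
  by rewrite !leq_mul2r leq_bin_expn !orbT.
by rewrite mulnCA -!mulnA leq_pmul2l ?expn_gt0 ?(leq_ltn_trans _ dm)// leq_mul2l bin_exp_ratio ?orbT.
Qed.

Definition miss (i : T) (s : seq 'rV[R]_d) := count (fun x => ~~ `[< K i x >]) s.

(* Multiplicative weights: each new point doubles the weight of the sets it misses. *)
Lemma multiplicative_weights A (X : set 'rV[R]_d) (M : nat) (b : R) : (0 < M)%N -> b <= 2 ->
  (forall w, (forall i, i \in A -> (M <= w i)%N) ->
    exists2 x, X x & b * (\sum_(i in A) w i)%:R <= (depth w A x)%:R) ->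
  forall n, exists s : seq 'rV[R]_d, [/\ size s = n, (forall x, x \in s -> X x) &
    forall i, i \in A -> (2 ^ miss i s)%:R <= #|A|%:R * (2 - b) ^+ n].
Proof.
move=> M0 b2 deep n.
suff [s [sn sX hs]] : exists s : seq 'rV[R]_d, [/\ size s = n, (forall x, x \in s -> X x) &
    (\sum_(i in A) 2 ^ miss i s)%:R <= #|A|%:R * (2 - b) ^+ n :> R].
  exists s; split => // i iA; apply: le_trans hs; rewrite ler_nat (bigD1 i)//=.
  exact: leq_addr.
elim: n => [|n [s [sn sX hs]]].
  by exists [::]; split => //; rewrite expr0 mulr1 sum1_card.
(* The factor [M] meets the lower bound on the weights and cancels afterwards. *)
have [|x Xx hx] := deep (fun i => M * 2 ^ miss i s)%N.
  by move=> i _; rewrite leq_pmulr// expn_gt0.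
exists (x :: s); split => //=; first by rewrite sn.
  by move=> y; rewrite inE => /orP[/eqP ->//|]; exact: sX.
move: hx; rewrite /depth -!big_distrr /= !natrM mulrCA ler_pM2l ?ltr0n// => hx.
have -> : (\sum_(i in A) 2 ^ miss i (x :: s))%:R =
    2 * (\sum_(i in A) 2 ^ miss i s)%:R - (\sum_(i in A | `[< K i x >]) 2 ^ miss i s)%:R :> R.
  apply/eqP; rewrite eq_sym subr_eq -natrM -natrD eqr_nat; apply/eqP.
  rewrite big_distrr /= !(bigID (fun i => `[< K i x >]) (mem A)) /=.
  under [X in (X + _ + _)%N]eq_bigr => i /andP[_ h] do rewrite /miss /= h add0n.
  under [X in (_ + X + _)%N]eq_bigr => i /andP[_ h] do rewrite /miss /= h add1n expnS.
  rewrite -[X in (X + _)%N = _]big_distrr /= /miss; ring.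
rewrite exprS mulrCA; apply: le_trans (_ : (2 - b) * (\sum_(i in A) 2 ^ miss i s)%:R <= _).
  by rewrite mulrBl lerB.
by rewrite ler_wpM2l// subr_ge0.
Qed.

End Depth.

(** * Sign patterns of affine functionals *)

Section Shattering.
Variable X : finType.
Implicit Types (D J A B : {set X}) (F : {set {set X}}).

Definition shatters F J := [forall (B : {set X} | B \subset J), exists A in F, A :&: J == B].

Lemma shattersP F J :
  reflect (forall B, B \subset J -> exists2 A, A \in F & A :&: J = B) (shatters F J).
Proof.
apply: (iffP forall_inP) => h B BJ.
  by have /exists_inP[A AF /eqP] := h B BJ; exists A.
by have [A AF e] := h B BJ; apply/exists_inP; exists A; rewrite ?e.
Qed.

(* Pajor's strengthening of the Sauer-Shelah lemma. *)
Lemma pajor F : (#|F| <= #|[set J | shatters F J]|)%N.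
Proof.
suff key D : (forall A, A \in F -> A \subset D) ->
    (#|F| <= #|[set J : {set X} | (J \subset D) && shatters F J]|)%N.
  apply: leq_trans (key setT (fun A _ => subsetT A)) _.
  by apply: subset_leq_card; apply/subsetP => J; rewrite !inE => /andP[].
have [n] := ubnP #|D|; elim: n D F => // n IH D F /ltnSE Dn FD.
have [D0|/set0Pn[a aD]] := eqVneq D set0.
  have [->|/set0Pn[A0 A0F]] := eqVneq F set0; first by rewrite cards0.
  have sF : F \subset [set set0].
    by apply/subsetP => A /FD; rewrite D0 subset0 inE.
  apply: leq_trans (subset_leq_card sF) _; rewrite cards1 card_gt0; apply/set0Pn.
  exists set0; rewrite inE sub0set; apply/shattersP => B; rewrite subset0 => /eqP ->.
  by exists A0; rewrite ?setI0.
pose F0 := [set A in F | a \notin A]; pose F1 := [set A :\ a | A in F :\: F0].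
have F1P B : B \in F1 -> (a |: B \in F) /\ (a \notin B).
  case/imsetP => A; rewrite !inE negb_and negbK => /andP[/orP[/negP//|aA] AF] ->.
  by rewrite setD1K// !inE eqxx.
have cF : (#|F| = #|F0| + #|F1|)%N.
  rewrite card_in_imset; last first.
    move=> A B; rewrite !inE !negb_and !negbK => /andP[+ AF] /andP[+ BF] e.
    by rewrite AF BF /= => aA aB; rewrite -(setD1K aA) e setD1K.
  rewrite -(cardsID F0 F) (setIidPr _)//.
  by apply/subsetP => A; rewrite inE => /andP[].
pose D' := D :\ a; pose sh G := [set J : {set X} | (J \subset D') && shatters G J].
have cD' : (#|D'| < n)%N by apply: leq_trans Dn; rewrite (cardsD1 a D) aD.
have h0 : (#|F0| <= #|sh F0|)%N.
  apply: IH => // A; rewrite inE => /andP[AF aA].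
  by apply/subsetP => x xA; rewrite !inE (subsetP (FD A AF))// andbT; apply: contraNneq aA => <-.
have h1 : (#|F1| <= #|sh F1|)%N.
  apply: IH => // B /F1P[BF aB]; apply/subsetP => x xB.
  rewrite !inE (subsetP (FD _ BF)) ?setU1r// andbT.
  by apply: contraNneq aB => <-.
have naJ G J : J \in sh G -> a \notin J.
  by rewrite inE => /andP[/subsetP JD _]; apply/negP => /JD; rewrite !inE eqxx.
(* A set shattered by both halves is counted twice, once as it is and once with [a] added. *)
pose U := sh F0 :|: sh F1; pose I := [set a |: J | J in sh F0 :&: sh F1].
have cI : #|I| = #|sh F0 :&: sh F1|.
  apply: card_in_imset => J1 J2; rewrite !inE => /andP[j1 _] /andP[j2 _] e.
  have n1 : a \notin J1 by apply: (naJ F0); rewrite inE.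
  have n2 : a \notin J2 by apply: (naJ F0); rewrite inE.
  by rewrite -(setU1K n1) e setU1K.
have UI : U :&: I = set0.
  apply/setP => J; rewrite [in RHS]inE; apply/negP; rewrite inE => /andP[JU /imsetP[J' _ e]].
  have : a \notin J by move: JU; rewrite inE => /orP[]; exact: naJ.
  by rewrite e setU11.
apply: leq_trans (_ : #|U :|: I| <= _)%N.
  rewrite cardsU UI cards0 subn0 cI cF; apply: leq_trans (leq_add h0 h1) _.
  by rewrite -cardsUI.
apply: subset_leq_card; apply/subsetP => J.
have sD'D : D' \subset D by exact: subD1set.
have sh0 B : shatters F0 B -> shatters F B.
  move/shattersP => h; apply/shattersP => C /h[A]; rewrite inE => /andP[AF _] <-.
  by exists A.
have sh1 B : a \notin B -> shatters F1 B -> shatters F B.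
  move=> aB /shattersP h; apply/shattersP => C /h[A /F1P[AF aA] <-].
  exists (a |: A) => //; apply/setP => x; rewrite !inE.
  by case: eqVneq => //= ->; rewrite (negPf aB) andbF.
rewrite in_setU => /orP[|/imsetP[J' + ->]].
  rewrite in_setU => /orP[] Jsh; have aJ := naJ _ _ Jsh; move: Jsh; rewrite !inE => /andP[JD hJ].
    by rewrite (subset_trans JD)//= sh0.
  by rewrite (subset_trans JD)//= sh1.
move=> /setIP[j0 j1]; have aJ' := naJ _ _ j0; move: j0 j1; rewrite !inE => /andP[JD /shattersP s0] /andP[_ /shattersP s1].
rewrite subUset sub1set aD (subset_trans JD)//=; apply/shattersP => B BJ.
have sB : B :\ a \subset J' by rewrite subDset.
have [aB|aB] := boolP (a \in B).
  have [A /F1P[AF aA] e] := s1 _ sB; exists (a |: A) => //.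
  by rewrite -setUIr e setD1K.
have [A] := s0 _ sB; rewrite inE => /andP[AF aA] e; exists A => //.
apply/setP => x; move/setP/(_ x): e; rewrite !inE.
by case: eqVneq => [->|_] /=; rewrite ?(negPf aB) ?(negPf aA).
Qed.

Lemma card_small_sets m : (#|[set J : {set X} | (#|J| <= m)%N]| <= #|X|.+1 ^ m)%N.
Proof.
pose f (g : {ffun 'I_m -> option X}) : {set X} := [set x | [exists i, g i == Some x]].
apply: leq_trans (_ : #|f @: setT| <= _)%N; last first.
  by apply: leq_trans (leq_imset_card _ _) _; rewrite cardsT card_ffun card_option card_ord.
apply: subset_leq_card; apply/subsetP => J; rewrite inE => cJ; apply/imsetP.
exists [ffun i : 'I_m => onth (enum J) i] => //; apply/setP => x; rewrite inE.
apply/idP/existsP => [xJ|[i]].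
  have lt : (index x (enum J) < m)%N by apply: leq_trans cJ; rewrite cardE index_mem mem_enum.
  by exists (Ordinal lt); rewrite ffunE (onthE _) (nth_map x) ?index_mem ?mem_enum// nth_index ?mem_enum.
rewrite ffunE onthE => /eqP e.
have lt : (i < size (enum J))%N.
  by rewrite ltnNge; apply/negP => h; rewrite nth_default ?size_map in e.
by move: e; rewrite (nth_map x)// => -[<-]; rewrite -mem_enum mem_nth.
Qed.

End Shattering.

Section AffinePatterns.
Context {R : realType} {d : nat}.
Implicit Types (x : 'rV[R]_d).

Definition aff (n : nat) : Type := ('rV[R]_n * R)%type.

Definition ev (h : aff d) x : R := dotv h.1 x + h.2.

(** [radon] for the vectors together with 0, indexed by [None]. If no coefficient in [J] is
    positive, the negated coefficients serve. *)
Lemma lin_dep (T : finType) (J : {set T}) (u : T -> 'rV[R]_d) : (d < #|J|)%N ->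
  exists c : T -> R, \sum_(i in J) c i *: u i = 0 /\ exists2 i, i \in J & 0 < c i.
Proof.
move=> dJ; pose u' (o : option T) := if o is Some i then u i else 0.
have [|c [c0 cu [b oJ co]]] := @radon R d _ (None |: Some @: J) u'.
  rewrite cardsU1 card_imset; last exact: Some_inj.
  suff -> : None \notin Some @: J by [].
  by apply/imsetP => -[].
have sE (W : zmodType) (G : option T -> W) :
    \sum_(o in None |: Some @: J) G o = G None + \sum_(i in J) G (Some i).
  rewrite big_setU1 /=; last by apply/imsetP => -[].
  by rewrite big_imset //= => i j _ _ [].
move: c0 cu; rewrite !sE /= scaler0 add0r => c0 cu.
have [[i iJ ci]|H] := pselect (exists2 i, i \in J & 0 < c (Some i)).
  by exists (c \o Some); split => //; exists i.
exists (fun i => - c (Some i)); split.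
  by under eq_bigr do rewrite scaleNr; rewrite sumrN cu oppr0.
have le i : i \in J -> c (Some i) <= 0.
  by move=> iJ; rewrite leNgt; apply/negP => h; apply: H; exists i.
apply: contrapT => H'.
have z i : i \in J -> c (Some i) = 0.
  move=> iJ; apply/eqP; rewrite eq_le le//= -oppr_le0 leNgt; apply/negP => h.
  by apply: H'; exists i.
have cN : c None = 0 by move: c0; rewrite big1 ?addr0// => i iJ; exact: z.
move: oJ co; rewrite !inE => /orP[/eqP ->|/imsetP[i iJ ->]]; first by rewrite cN ltxx.
by rewrite z// ltxx.
Qed.

(** A shattered [J] has at most d members. Otherwise a dependence of the normals makes the weighted
    sum of the values a constant [kap]; a point positive exactly where the coefficients are positive
    gives [kap > 0], and one positive exactly where they are negative gives [kap <= 0]. *)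
Lemma card_patterns (H P : finType) (f : H -> aff d) (x : P -> 'rV[R]_d) :
  (#|[set [set h | (0 < ev (f h) (x p))%R] | p in P]| <= #|H|.+1 ^ d)%N.
Proof.
apply: leq_trans (pajor _) _; apply: leq_trans (card_small_sets H d).
apply: subset_leq_card; apply/subsetP => J; rewrite !inE => /shattersP sh.
rewrite leqNgt; apply/negP => dJ.
have [c [cu [i0 i0J ci0]]] := lin_dep (fun h => (f h).1) dJ.
pose kap := \sum_(j in J) c j * (f j).2.
have sum_ev y : \sum_(j in J) c j * ev (f j) y = kap.
  under eq_bigr do rewrite mulrDr -dotvZl; rewrite big_split /=.
  suff -> : \sum_(j in J) dotv (c j *: (f j).1) y = 0 by rewrite add0r.
  rewrite -[RHS](dotv0l y) -cu.
  by elim/big_rec2: _ => [|j a b _ ->]; rewrite ?dotv0l// dotvDl.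
have [B sB] := sh [set j in J | 0 < c j] ltac:(by apply/subsetP => j; rewrite inE => /andP[]).
case: (imsetP sB) => p _ -> {B sB} /setP e1.
have [B sB] := sh [set j in J | c j < 0] ltac:(by apply/subsetP => j; rewrite inE => /andP[]).
case: (imsetP sB) => q _ -> {B sB} /setP e2.
have k0 : 0 < kap.
  rewrite -(sum_ev (x p)) (bigD1 i0)//=; apply: ltr_pwDl.
    by rewrite mulr_gt0//; have := e1 i0; rewrite !inE i0J ci0 andbT.
  apply: sumr_ge0 => j /andP[jJ _]; have := e1 j; rewrite !inE jJ /= andbT.
  case: (ltP 0 (c j)) => cj.
    by move=> h; rewrite mulr_ge0 ?(ltW cj)// ltW.
  by move/negbT; rewrite -leNgt => h; rewrite mulr_le0.
move: k0; rewrite ltNge => /negP; apply.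
rewrite -(sum_ev (x q)); apply: sumr_le0 => j jJ; have := e2 j; rewrite !inE jJ /= andbT.
case: (ltP (c j) 0) => cj.
  by move=> h; rewrite mulr_le0_ge0 ?(ltW cj)// ltW.
by move/negbT; rewrite -leNgt => h; rewrite mulr_ge0_le0.
Qed.

End AffinePatterns.

(** * Flags of cells and cuttings *)

Section Flags.
Context {R : realType} {k : nat} {H : finType}.
Variables (f : H -> aff (R := R) k) (Mb : R).
Implicit Types (a x y : 'rV[R]_k) (J : {set H + 'I_k * bool}).

(** [t] lies in the closure of the sign class of [s]. *)
Definition compat (s t : R) := [/\ 0 < s -> 0 <= t, s < 0 -> t <= 0 & s = 0 -> t = 0].

Lemma compat_refl s : compat s s.
Proof. by split => // /ltW. Qed.

Lemma compat_trans s t r : compat s t -> compat t r -> compat s r.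
Proof.
move=> [s1 s2 s3] [t1 t2 t3]; split.
- by move=> /s1; rewrite le_eqVlt => /orP[/eqP/esym/t3->|/t1].
- by move=> /s2; rewrite le_eqVlt => /orP[/eqP/t3->|/t2].
- by move=> /s3/t3.
Qed.

Lemma ev_conv (h : aff (R := R) k) (t : R) x y :
  ev h (t *: x + (1 - t) *: y) = t * ev h x + (1 - t) * ev h y.
Proof. by rewrite /ev dotvDr !dotvZr; ring. Qed.

(* The members of [H], followed by the [2 k] facets of the cube of radius [Mb]. *)
Definition boxed : finType := (H + 'I_k * bool)%type.

Definition bev (i : boxed) : aff (R := R) k :=
  match i with
  | inl h => f h
  | inr (j, b) => ((if b then delta_mx 0 j else - delta_mx 0 j), Mb)
  end.

Definition in_box x := forall j, - Mb <= x 0 j <= Mb.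

Lemma ev_box j b x : ev (bev (inr (j, b))) x = (if b then x 0 j else - x 0 j) + Mb.
Proof.
rewrite /ev /=; congr (_ + _); rewrite /dotv (bigD1 j)//= big1 ?addr0.
  by case: b; rewrite !mxE !eqxx ?mulN1r ?mul1r.
by move=> l /negPf lj; case: b; rewrite !mxE lj andbF ?oppr0 mul0r.
Qed.

Definition side a (i : boxed) : set 'rV[R]_k := fun y => compat (ev (bev i) a) (ev (bev i) y).

(** The closed face, in the arrangement of [J], that has [a] in its relative interior. *)
Definition cell (J : {set boxed}) a := inter (side a) J.

Definition has_box (J : {set boxed}) := forall i, inr i \in J.

(* One step of the bottom-vertex triangulation: [v] is the point of the closed face
   of [a] nearest to the origin, and the ray from [v] through [a] leaves the face at [a']. *)
Definition step (J : {set boxed}) a v a' :=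
  [/\ is_min (cell J a) v, cell J a a',
      exists t : R, [/\ 0 <= t, t <= 1 & a = t *: v + (1 - t) *: a'] &
      (v = a /\ a' = a) \/ (v <> a /\ exists2 i, i \in J & ev (bev i) a <> 0 /\ ev (bev i) a' = 0)].

Definition flag J a (v al : nat -> 'rV[R]_k) :=
  al 0%N = a /\ forall j, (j <= k)%N -> step J (al j) (v j) (al j.+1).

Lemma cvx_side a i : cvx (side a i).
Proof.
move=> x y t t0 t1 [x1 x2 x3] [y1 y2 y3]; rewrite /side ev_conv.
have t1' : 0 <= 1 - t by rewrite subr_ge0.
split.
- by move=> s; rewrite addr_ge0// mulr_ge0 ?x1 ?y1.
- by move=> s; have := mulr_ge0_le0 t0 (x2 s); have := mulr_ge0_le0 t1' (y2 s); lra.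
- by move=> s; rewrite x3// y3// !mulr0 addr0.
Qed.

Lemma cell_self J a : cell J a a.
Proof. by move=> i _; exact: compat_refl. Qed.

Lemma cell_box J a y : has_box J -> in_box a -> cell J a y -> in_box y.
Proof.
move=> bJ ba cy j.
have := cy _ (bJ (j, true)); have := cy _ (bJ (j, false)); rewrite /side !ev_box => -[h1 _ h2] [h3 _ h4].
have /andP[b1 b2] := ba j.
apply/andP; split.
  move: b1; rewrite le_eqVlt => /orP[/eqP e|b1]; last by move: (h3 ltac:(lra)); lra.
  by move: (h4 ltac:(lra)); lra.
move: b2; rewrite le_eqVlt => /orP[/eqP e|b2]; last by move: (h1 ltac:(lra)); lra.
by move: (h2 ltac:(lra)); lra.
Qed.

Lemma continuous_ev (h : aff (R := R) k) : continuous (ev h).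
Proof.
by move=> x; exact: (cvgD (@continuous_dotvl R k h.1 x) (cvg_cst h.2)).
Qed.

Lemma closed_side a i : closed (side a i).
Proof.
have cl D : closed D -> closed (ev (bev i) @^-1` D)%classic.
  by move=> cD; apply: closed_comp => // x _; exact: continuous_ev.
case: (ltgtP (ev (bev i) a) 0) => s.
- rewrite (_ : side a i = (ev (bev i) @^-1` [set t | t <= 0])%classic).
    by apply: cl; exact: closed_le.
  apply/seteqP; split => y /=; first by case=> _ /(_ s).
  by move=> h; split => // s'; lra.
- rewrite (_ : side a i = (ev (bev i) @^-1` [set t | 0 <= t])%classic).
    by apply: cl; exact: closed_ge.
  apply/seteqP; split => y /=; first by case=> /(_ s).
  by move=> h; split => // s'; lra.
- rewrite (_ : side a i = (ev (bev i) @^-1` [set t | t = 0])%classic).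
    by apply: cl; exact: closed_eq.
  apply/seteqP; split => y /=; first by case=> _ _ /(_ s).
  by move=> h; split => // s'; lra.
Qed.

Lemma compact_cell J a : has_box J -> in_box a -> compact (cell J a).
Proof.
move=> bJ ba.
have cb : compact [set v : 'rV[R]_k | forall i, (`[- Mb, Mb]%classic : set R) (v ord0 i)]%classic.
  by apply: (@rV_compact R k (fun=> `[- Mb, Mb]%classic)) => i; exact: segment_compact.
apply: (subclosed_compact _ cb).
  have -> : cell J a = (\bigcap_(i in [set` J]) side a i)%classic by [].
  by apply: closed_bigI => i _; exact: closed_side.
by move=> y /(cell_box bJ ba) h i /=; rewrite in_itv /=; exact: h.
Qed.

Lemma step_exists J a : has_box J -> in_box a -> exists v a', step J a v a'.
Proof.
move=> bJ ba; have [|v mv] := is_min_exists _ (compact_cell bJ ba).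
  by exists a; exact: cell_self.
exists v; have [cv _] := mv.
have [va|nva] := eqVneq v a.
  exists a; split => //; first exact: cell_self.
  - by exists 0; rewrite scale0r add0r subr0 scale1r lexx ler01.
  - by left.
(* The i-th functional vanishes on the ray from [v] through [a] where [t * r i = 1], so the largest
   ratio belongs to the hyperplane reached first. *)
pose r i := ev (bev i) v / ev (bev i) a.
pose act i := (i \in J) && (ev (bev i) a != 0).
have r0 i : act i -> 0 <= r i.
  move=> /andP[iJ ai]; have [h1 h2 _] := cv i iJ.
  case: (ltgtP (ev (bev i) a) 0) ai => // s _; first by rewrite /r mulr_le0 ?invr_le0 ?h2// ltW.
  by rewrite /r divr_ge0 ?h1// ltW.
(* The facet of the cube towards which the ray moves has ratio above 1, so the ray leaves the cell
   strictly beyond [a] unless another functional stops it earlier. *)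
have [i1 ai1 r1] : exists2 i, act i & 1 < r i.
  have [l nl] : exists l, v 0 l != a 0 l.
    apply: contrapT => h; case/eqP: nva; apply/matrixP => i l; rewrite ord1.
    by apply/eqP; apply: contrapT => /negP n; apply: h; exists l.
  exists (inr (l, ~~ (v 0 l < a 0 l))).
    rewrite /act bJ ev_box /=; have := cv _ (bJ (l, ~~ (v 0 l < a 0 l))).
    rewrite /side !ev_box => -[_ _ z]; apply/eqP => /[dup]/z.
    by case: ltgtP nl => //= h _; lra.
  rewrite /r !ev_box; have /andP[b1 b2] := ba l.
  have := cv _ (bJ (l, ~~ (v 0 l < a 0 l))); rewrite /side !ev_box.
  case: ltgtP nl => //= h _ [z1 _ z].
    have p : 0 < - a 0 l + Mb by rewrite lt_def; apply/andP; split; [apply/eqP => /z; lra|lra].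
    by rewrite ltr_pdivlMr//; lra.
  have p : 0 < a 0 l + Mb by rewrite lt_def; apply/andP; split; [apply/eqP => /z; lra|lra].
  by rewrite ltr_pdivlMr//; lra.
case: (arg_maxP r ai1) => i ai rmax; pose ri := r i.
have ri1 : 1 < ri by apply: lt_le_trans r1 (rmax _ ai1).
pose t := ri^-1; have t0 : 0 < t by rewrite invr_gt0 (lt_trans ltr01).
have t1 : t < 1 by rewrite invf_lt1// (lt_trans ltr01).
pose a' := (1 - t)^-1 *: (a - t *: v).
have ea : a = t *: v + (1 - t) *: a'.
  by rewrite /a' scalerA divff ?scale1r ?subrKC// subr_eq0 eq_sym lt_eqF.
have eva' j : ev (bev j) a' = (ev (bev j) a - t * ev (bev j) v) / (1 - t).
  have : ev (bev j) a = t * ev (bev j) v + (1 - t) * ev (bev j) a' by rewrite ea ev_conv.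
  move=> ->; rewrite [X in X / _]addrAC subrr add0r mulrAC divff ?mul1r//.
  by rewrite subr_eq0 eq_sym lt_eqF.
have t1i : 0 < (1 - t)^-1 by rewrite invr_gt0 subr_gt0.
have cell_a' : cell J a a'.
  move=> j jJ; rewrite /side; have [z|nz] := eqVneq (ev (bev j) a) 0.
    have [_ _ /(_ z) zv] := cv j jJ.
    by rewrite eva' z zv mulr0 subr0 mul0r; exact: compat_refl.
  have aj : act j by rewrite /act jJ nz.
  have ej : ev (bev j) a' = ev (bev j) a * ((1 - t * r j) / (1 - t)).
    by rewrite eva' /r; field; rewrite nz /= subr_eq0 eq_sym lt_eqF.
  have pj : 0 <= (1 - t * r j) / (1 - t).
    rewrite mulr_ge0 ?(ltW t1i)// subr_ge0 /t mulrC ler_pdivrMr ?mul1r; first exact: rmax.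
    exact: lt_trans ltr01 ri1.
  by rewrite ej; split => s; [rewrite mulr_ge0// ltW|rewrite mulr_le0_ge0// ltW|rewrite s mul0r].
exists a'; split => //; first by exists t; rewrite !ltW.
right; split; first exact/eqP.
case/andP: ai => iJ ain; exists i => //; split; first exact/eqP.
rewrite eva' (_ : _ - _ = 0) ?mul0r// /t /ri /r; field; rewrite ain /=.
apply/eqP => e; move: ri1; rewrite /ri /r e mul0r; lra.
Qed.

(** Of two exit points on the same ray, the farther one would lie beyond the hyperplane that stops
    the nearer one, hence outside the cell. *)
Lemma step_unique J a v a1 w a2 : step J a v a1 -> step J a w a2 -> v = w /\ a1 = a2.
Proof.
move=> [mv c1 [t [t0 t1 e1]] o1] [mw c2 [s [s0 s1 e2]] o2].
have e := is_min_unique (cvx_inter (@cvx_side a)) mv mw; subst w; split => //.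
case: o1 o2 => [[va ->]|[nva [i iJ [ai z1]]]] [[va' ->]|[nva' [j jJ [aj z2]]]] //.
have tn1 : t < 1.
  rewrite lt_def t1 andbT eq_sym; apply/eqP => e; apply: nva.
  by rewrite e1 e subrr scale0r addr0 scale1r.
have sn1 : s < 1.
  rewrite lt_def s1 andbT eq_sym; apply/eqP => e; apply: nva.
  by rewrite e2 e subrr scale0r addr0 scale1r.
have ts : t = s.
  have key (t' s' : R) b1 b2 l : 0 <= t' -> t' < 1 -> 0 <= s' -> s' < 1 -> a = t' *: v + (1 - t') *: b1 ->
      a = s' *: v + (1 - s') *: b2 -> cell J a b2 -> l \in J -> ev (bev l) a <> 0 ->
      ev (bev l) b1 = 0 -> ~ (t' < s').
    move=> {}t0 {}t1 {}s0 {}s1 E1 E2 C2 lJ al zl ts.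
    have [p1 p2 _] := C2 l lJ.
    have E3 : ev (bev l) a = t' * ev (bev l) v by rewrite E1 ev_conv zl mulr0 addr0.
    have E4 : ev (bev l) a = s' * ev (bev l) v + (1 - s') * ev (bev l) b2 by rewrite E2 ev_conv.
    have tp : 0 < t'.
      by rewrite lt_def t0 andbT; apply/eqP => e; apply: al; rewrite E3 e mul0r.
    case: (ltgtP (ev (bev l) a) 0) => sg //.
      have := p2 sg; have : ev (bev l) v < 0 by move: sg; rewrite E3 pmulr_rlt0.
      by move: E4; rewrite E3; set vv := ev _ v; set bb := ev _ b2; nra.
    have := p1 sg; have : 0 < ev (bev l) v by move: sg; rewrite E3 pmulr_rgt0.
    by move: E4; rewrite E3; set vv := ev _ v; set bb := ev _ b2; nra.
  case: (ltgtP t s) => // h; exfalso.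
    exact: (key t s a1 a2 i).
  exact: (key s t a2 a1 j).
apply: (scalerI (a := 1 - t)); first by rewrite subr_eq0 eq_sym lt_eqF.
apply: (addrI (t *: v)); rewrite -e1 e2 ts.
by [].
Qed.

Lemma cell_antimono (J J' : {set boxed}) a y : J' \subset J -> cell J a y -> cell J' a y.
Proof. by move=> /subsetP s c i /s; exact: c. Qed.

(** At most k members fix [v], and one more fixes the exit point. Other members of [J] change
    nothing, since both points lie in the smaller cell as well. In [cutting], this bounds the part
    of a sample on which a flag depends. *)
Lemma step_local J a v a' : step J a v a' -> exists D : {set boxed},
  [/\ D \subset J, (#|D| <= k.+1)%N &
      forall J' : {set boxed}, D \subset J' -> J' \subset J -> step J' a v a'].
Proof.
move=> [mv ca' t o].
have [D [DJ cD mD]] := is_min_basis (@cvx_side a) mv.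
have mJ' (J' : {set boxed}) : D \subset J' -> J' \subset J -> is_min (cell J' a) v.
  move=> DJ' J'J; apply: is_minS mD => [y|]; first exact: cell_antimono.
  by apply: cell_antimono J'J _; case: mv.
case: o => [[va a'a]|[nva [i iJ z]]].
  exists D; split => //; first exact: leqW.
  move=> J' DJ' J'J; split => //; [exact: mJ'|exact: cell_antimono J'J _|by left].
exists (i |: D); split.
- by rewrite subUset sub1set iJ.
- by rewrite cardsU1; apply: leq_trans (leq_add (leq_b1 _) cD) _.
- move=> J'; rewrite subUset sub1set => /andP[iJ' DJ'] J'J.
  split => //; [exact: mJ'|exact: cell_antimono J'J _|].
  by right; split => //; exists i.
Qed.

Lemma flag_exists J a : has_box J -> in_box a -> exists v al, flag J a v al.
Proof.
move=> bJ ba.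
have ex y : exists va, in_box y -> step J y va.1 va.2.
  have [by_|nb] := pselect (in_box y); last by exists (0, 0).
  by have [v [a' h]] := step_exists bJ by_; exists (v, a').
have [S hS] := choice ex.
pose al j := iter j (fun y => (S y).2) a.
have bal j : in_box (al j).
  elim: j => [//|j IH]; apply: (cell_box bJ IH).
  by have [_] := hS _ IH.
by exists (fun j => (S (al j)).1), al; split => // j _; exact: hS.
Qed.

Lemma flag_unique J a v al w be : flag J a v al -> flag J a w be ->
  forall j, (j <= k)%N -> v j = w j.
Proof.
move=> [v0 hv] [w0 hw].
have E j : (j <= k.+1)%N -> al j = be j.
  elim: j => [_|j IH jk]; first by rewrite v0 w0.
  have := hw j jk; rewrite -IH; last exact: ltnW.
  by move=> h; have [] := step_unique (hv j jk) h.
move=> j jk; have := hw j jk; rewrite -E; last exact: leqW.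
by move=> h; have [] := step_unique (hv j jk) h.
Qed.

Lemma flag_local J a v al : flag J a v al -> exists D : {set boxed},
  [/\ D \subset J, (#|D| <= k.+1 * k.+1)%N &
      forall J' : {set boxed}, D \subset J' -> J' \subset J -> flag J' a v al].
Proof.
move=> [e0 h].
suff key n : (n <= k.+1)%N -> exists D : {set boxed}, [/\ D \subset J, (#|D| <= n * k.+1)%N &
    forall J' : {set boxed}, D \subset J' -> J' \subset J -> forall j, (j < n)%N -> step J' (al j) (v j) (al j.+1)].
  have [D [DJ cD hD]] := key _ (leqnn _); exists D; split => // J' DJ' J'J; split => // j jk.
  exact: hD.
elim: n => [_|n IH nk].
  by exists set0; rewrite cards0 sub0set; split.
have [D [DJ cD hD]] := IH (ltnW nk); have [E [EJ cE hE]] := step_local (h n nk).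
exists (E :|: D); split.
- by rewrite subUset EJ.
- by apply: leq_trans (leq_card_setU _ _) _; rewrite mulSn leq_add.
- move=> J'; rewrite subUset => /andP[EJ' DJ'] J'J j; rewrite ltnS leq_eqVlt => /orP[/eqP ->|].
    exact: hE.
  exact: hD.
Qed.

(** Members of [J] keep a weak sign along the flag, so none of them has points [v j] strictly on
    both sides. *)
Lemma flag_compat J a v al i : flag J a v al -> i \in J ->
  (forall j l, (j <= l <= k)%N -> compat (ev (bev i) (al j)) (ev (bev i) (al l))) /\
  forall j, (j <= k)%N -> compat (ev (bev i) a) (ev (bev i) (v j)).
Proof.
move=> [e0 h] iJ.
have c j l : (j <= l <= k)%N -> compat (ev (bev i) (al j)) (ev (bev i) (al l)).
  elim: l => [|l IH]; first by rewrite leqn0 => /andP[/eqP -> _]; exact: compat_refl.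
  case/andP; rewrite leq_eqVlt => /orP[/eqP -> _|jl lk]; first exact: compat_refl.
  apply: compat_trans (IH _) _; first by rewrite -ltnS jl ltnW.
  by have [_ cc _ _] := h l (ltnW lk); exact: cc.
split => // j jk; rewrite -e0; apply: compat_trans (c 0%N j _) _; first by [].
by have [[cc _] _ _ _] := h j jk; exact: cc.
Qed.

(** Its rank is the codimension of the face of [a]; members that do not vanish at [a] contribute
    zero rows. *)
Definition zeros (J : {set boxed}) a : 'M[R]_(#|boxed|, k) :=
  \matrix_i (if (enum_val i \in J) && (ev (bev (enum_val i)) a == 0) then (bev (enum_val i)).1 else 0).

Lemma zerosP J a i : i \in J -> ev (bev i) a = 0 -> ((bev i).1 <= zeros J a)%MS.
Proof.
move=> iJ z; have := row_sub (enum_rank i) (zeros J a).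
by rewrite rowK enum_rankK iJ z eqxx.
Qed.

Lemma dotv_mx x y : (x *m y^T) 0 0 = dotv x y.
Proof. by rewrite mxE; apply: eq_bigr => i _; rewrite mxE. Qed.

(** The functionals that vanish at [a] vanish at [v] and [a'] too. If the normal of the new zero at
    [a'] were in the span of theirs, that functional would also vanish at [v], and then at [a]. *)
Lemma rank_step J a v a' : v <> a -> step J a v a' -> (\rank (zeros J a) < \rank (zeros J a'))%N.
Proof.
move=> nva [[cv _] ca' [t [t0 t1 ea]] []]; first by case.
case=> _ [i iJ [ai zi]]; apply: rank_ltmx.
apply/andP; split.
  apply/row_subP => l; rewrite rowK; case: ifP => [/andP[lJ /eqP z]|_]; last exact: sub0mx.
  by apply: zerosP => //; have [_ _] := ca' _ lJ; apply.
apply/negP => s; have := submx_trans (zerosP iJ zi) s => /submxP[c ec].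
have zz : zeros J a *m (v - a')^T = 0.
  apply/row_matrixP => l; rewrite row_mul rowK row0; case: ifP => [/andP[lJ /eqP z]|_]; last exact: mul0mx.
  apply/matrixP => p q; rewrite !ord1 dotv_mx !mxE.
  have [_ _ /(_ z) zv] := cv _ lJ; have [_ _ /(_ z) za'] := ca' _ lJ.
  rewrite -[- a']scaleN1r dotvDr dotvZr; move: zv za'; rewrite /ev; lra.
have : dotv (bev i).1 (v - a') = 0 by rewrite -dotv_mx ec -mulmxA zz mulmx0 mxE.
rewrite -[- a']scaleN1r dotvDr dotvZr => e; apply: ai.
have ev0 : ev (bev i) v = 0 by move: zi; rewrite /ev; lra.
by rewrite ea ev_conv zi ev0 !mulr0 addr0.
Qed.

(** Either [al j] is [v j], or it lies between [v j] and [al j.+1] and the rank of [zeros] grows.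
    The rank is at most k, so the first case occurs within k + 1 levels. *)
Lemma flag_hull J a v al (A : set 'rV[R]_k) : cvx A -> flag J a v al ->
  (forall j, (j <= k)%N -> A (v j)) -> A a.
Proof.
move=> cA [<- h] Av.
suff key n j : (j + n = k.+1)%N -> (k < n + \rank (zeros J (al j)))%N -> A (al j).
  by apply: (key k.+1); [rewrite add0n|rewrite addSn ltnS leq_addr].
elim: n j => [|n IH] j; first by rewrite add0n ltnNge rank_leq_col.
rewrite addnS => -[e] kr; have jk : (j <= k)%N by rewrite -e leq_addr.
have st := h j jk; have [va|nva] := eqVneq (v j) (al j).
  by rewrite -va; exact: Av.
have := rank_step (elimN eqP nva) st => rk.
have [_ _ [t [t0 t1 ->]] _] := st; apply: cA => //; first exact: Av.
apply: IH; first by rewrite addSn e.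
by apply: leq_trans kr _; rewrite addSn -addnS leq_add2l.
Qed.

End Flags.

Lemma leq_expW a b e : (a <= b)%N -> (a ^ e <= b ^ e)%N.
Proof. by case: e => // e ab; rewrite leq_exp2r. Qed.

(** Supplies the scale for perturbations: smaller shifts change no strict sign among finitely many
    values. *)
Lemma pos_lower_bound (R : realType) (I : finType) (F : I -> R) :
  exists2 e : R, 0 < e & forall i, 0 < F i -> e <= F i.
Proof.
suff [e e0 h] : exists2 e : R, 0 < e & forall i, i \in enum I -> 0 < F i -> e <= F i.
  by exists e => // i; apply: h; rewrite mem_enum.
elim: (enum I) => [|i s [e e0 h]]; first by exists 1.
have [Fi|Fi] := ltP 0 (F i); last first.
  exists e => // j; rewrite inE => /orP[/eqP -> |/h //]; by rewrite ltNge Fi.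
exists (Num.min e (F i)); first by rewrite lt_min e0.
move=> j; rewrite inE => /orP[/eqP -> _|/h{}h /h{}h]; first by rewrite ge_min lexx orbT.
by rewrite ge_min h.
Qed.

(** * Counting flags by sign patterns *)

Section FlagCount.
Context {R : realType}.

Lemma compat_sign (s t r : R) : (s < 0) = (t < 0) -> (0 < s) = (0 < t) ->
  compat s r <-> compat t r.
Proof.
case: (ltgtP s 0) => hs; case: (ltgtP t 0) => ht // _ _;
  split => -[c1 c2 c3]; split => h; first [lra | by apply: c1 | by apply: c2 | by apply: c3].
Qed.

(* The weights [t ^ (k - l)] separate the scales of the levels [l]: the sign of the
   weighted sum against the threshold of level [j] reveals the sign of [g j]. *)
Lemma level_sign (k : nat) (g : nat -> R) (t mu Mx : R) (j : nat) :
  0 < mu -> 0 <= Mx -> 0 < t -> t <= 1 -> 2 * (k.+1)%:R * Mx * t <= mu ->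
  (forall i l, (i <= l <= k)%N -> compat (g i) (g l)) ->
  (forall l, (l <= k)%N -> `|g l| <= Mx) ->
  (forall l, (l <= k)%N -> g l != 0 -> mu <= `|g l|) -> (j <= k)%N ->
  (t ^+ (k - j) * mu / 2 < \sum_(l < k.+1) t ^+ (k - l) * g l) = (0 < g j).
Proof.
move=> mu0 M0 t0 t1 tM gc gM gmu jk.
have tp n : 0 < t ^+ n by rewrite exprn_gt0.
have [gj|gj] := ltP 0 (g j).
  have gl l : (l <= k)%N -> 0 <= g l.
    move=> lk; have [lj|jl] := leqP l j.
      have [_ c2 c3] := gc l j ltac:(by rewrite lj jk).
      by rewrite leNgt; apply/negP => /c2; lra.
    by have [c1 _ _] := gc j l ltac:(by rewrite lk ltnW); exact: c1.
  apply: lt_le_trans (_ : t ^+ (k - j) * mu <= _).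
    by rewrite ltr_pdivrMr// ltr_pMr ?ltr1n// mulr_gt0.
  apply: le_trans (_ : t ^+ (k - j) * g j <= _).
    by rewrite ler_pM2l// -(gtr0_norm gj); apply: gmu => //; rewrite gt_eqF.
  rewrite (bigD1 (Ordinal (jk : (j < k.+1)%N)))//= lerDl; apply: sumr_ge0 => l _.
  by rewrite mulr_ge0 ?(ltW (tp _))// gl// -ltnS.
apply/negbTE; rewrite -leNgt.
apply: le_trans (_ : \sum_(l < k.+1) t ^+ (k - j) * (t * Mx) <= _).
  apply: ler_sum => l _; have lk : (l <= k)%N by rewrite -ltnS.
  have [jl|lj] := leqP j l.
    have [_ c2 c3] := gc j l ltac:(by rewrite jl lk).
    have gl : g l <= 0 by move: gj; rewrite le_eqVlt => /orP[/eqP/c3 -> |/c2].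
    apply: le_trans (_ : 0 <= _); first by rewrite mulr_ge0_le0// ltW.
    by rewrite !mulr_ge0// ltW.
  have -> : (k - l = (k - j) + (j - l.+1).+1)%N by nlia.
  rewrite exprD -mulrA ler_pM2l// exprS -mulrA ler_pM2l//.
  apply: le_trans (_ : t ^+ (j - l.+1) * Mx <= _).
    by rewrite ler_pM2l//; apply: le_trans (ler_norm _) (gM _ lk).
  by rewrite ler_piMl// exprn_ile1// ltW.
rewrite sumr_const card_ord -mulrnAr -mulrA ler_pM2l// ler_pdivlMr//.
apply: le_trans tM; rewrite -mulr_natl; lra.
Qed.

Context {k : nat} {H : finType}.
Variables (f : H -> aff (R := R) k) (Mb : R).

(** The bound of [card_patterns] for m sampled members and 2k facets, each taken at k + 1 levels
    with both signs. *)
Definition flag_bound (m : nat) : nat := ((m + k * 2) * k.+1 * 2).+1 ^ k.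

(** A flag depends on the signs of [J] at all k + 1 points [al p l]. Bounding the patterns level by
    level would give an exponent of order k^2; folding the levels into the one point [y p] keeps the
    exponent k, on which the size of the weak nets depends. *)
Lemma flag_classes (P : finType) (x : P -> 'rV[R]_k) (J : {set boxed (k := k) (H := H)}) m :
  has_box J -> (#|J| <= m + k * 2)%N -> (forall p, in_box Mb (x p)) ->
  exists (cl : P -> 'I_(flag_bound m)) (v : 'I_(flag_bound m) -> nat -> 'rV[R]_k),
    forall p, exists al, flag f Mb J (x p) (v (cl p)) al.
Proof.
move=> bJ cJ bx.
have ex p : exists va : (nat -> 'rV[R]_k) * (nat -> 'rV[R]_k), flag f Mb J (x p) va.1 va.2.
  by have [v [al h]] := flag_exists f bJ (bx p); exists (v, al).
have [va hva] := choice ex.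
pose al p := (va p).2; pose vv p := (va p).1.
pose I := {i : boxed (k := k) (H := H) | i \in J}.
pose g p (i : I) (l : nat) := ev (bev f Mb (val i)) (al p l).
pose X : finType := (P * I * 'I_k.+1)%type.
pose gX (y : X) := `|g y.1.1 y.1.2 y.2|.
have gX0 y : 0 <= gX y by exact: normr_ge0.
have [mu mu0 hmu] := pos_lower_bound gX.
pose Mx := \sum_y gX y.
have gM p i (l : nat) : (l <= k)%N -> `|g p i l| <= Mx.
  move=> lk; rewrite /Mx (bigD1 ((p, i, Ordinal (lk : (l < k.+1)%N)) : X))//= lerDl.
  by apply: sumr_ge0 => y _; exact: gX0.
have Mx0 : 0 <= Mx by apply: sumr_ge0 => y _; exact: gX0.
have gmu p i (l : nat) : (l <= k)%N -> g p i l != 0 -> mu <= `|g p i l|.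
  move=> lk n0; apply: (hmu ((p, i, Ordinal (lk : (l < k.+1)%N)) : X)).
  by rewrite normr_gt0.
pose t := mu / (2 * (k.+1)%:R * (Mx + mu)).
have k1 : 1 <= (k.+1)%:R :> R by rewrite ler1n.
have den0 : 0 < 2 * (k.+1)%:R * (Mx + mu).
  by rewrite !mulr_gt0// ?ltr0n//; lra.
have t0 : 0 < t by rewrite divr_gt0.
have t1 : t <= 1 by rewrite ler_pdivrMr// mul1r; nra.
have tM : 2 * (k.+1)%:R * Mx * t <= mu.
  rewrite /t mulrA ler_pdivrMr// mulrC ler_pM2l// ler_pM2l ?mulr_gt0 ?ltr0n//; lra.
pose S := \sum_(l < k.+1) t ^+ (k - l).
have S0 : 0 < S.
  rewrite /S (bigD1 ord_max)//= ltr_pwDl ?exprn_gt0//; apply: sumr_ge0 => l _; exact/exprn_ge0/ltW.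
pose y p := S^-1 *: \sum_(l < k.+1) t ^+ (k - l) *: al p l.
have evy p i : S * ev (bev f Mb (val i)) (y p) = \sum_(l < k.+1) t ^+ (k - l) * g p i l.
  have ds u : dotv u (\sum_(l < k.+1) t ^+ (k - l) *: al p l) = \sum_(l < k.+1) t ^+ (k - l) * dotv u (al p l).
    elim/big_rec2: _ => [|l a b _ <-]; first by rewrite dotvC dotv0l.
    by rewrite dotvDr dotvZr.
  rewrite /ev mulrDr /y dotvZr mulrA divff ?mul1r ?gt_eqF// ds {1}/S mulr_suml -big_split /=.
  by apply: eq_bigr => l _; rewrite -mulrDr.
pose th (j : 'I_k.+1) := t ^+ (k - j) * mu / 2.
(* Shifting by the thresholds of [level_sign] turns its comparisons into strict positivity at [y p];
   the negated functionals detect negative values. *)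
pose ff (h : I * 'I_k.+1 * bool) : aff (R := R) k :=
  let b := bev f Mb (val h.1.1) in
  if h.2 then (b.1, b.2 - th h.1.2 / S) else (- b.1, - b.2 - th h.1.2 / S).
have fl p : flag f Mb J (x p) (vv p) (al p) by exact: hva.
have ffP p i j b : (0 < ev (ff (i, j, b)) (y p)) = (if b then 0 < g p i j else g p i j < 0).
  have jk : (j <= k)%N by rewrite -ltnS.
  have cg a l : (a <= l <= k)%N -> compat (g p i a) (g p i l).
    by case: (flag_compat (fl p) (valP i)) => h _; exact: h.
  case: b; rewrite /ff /=.
    rewrite -(level_sign mu0 Mx0 t0 t1 tM cg (gM p i) (gmu p i) jk) -evy.
    have -> : ev (let b := bev f Mb (val i) in (b.1, b.2 - th j / S)) (y p)
        = ev (bev f Mb (val i)) (y p) - th j / S by rewrite /ev /= addrA.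
    by rewrite subr_gt0 ltr_pdivrMr// mulrC.
  have cN a l : (a <= l <= k)%N -> compat (- g p i a) (- g p i l).
    move=> /cg[c1 c2 c3]; split; rewrite ?oppr_gt0 ?oppr_ge0 ?oppr_lt0 ?oppr_le0 //.
    by move=> /eqP; rewrite oppr_eq0 => /eqP/c3 ->; rewrite oppr0.
  rewrite -oppr_gt0 -(@level_sign k (fun l => - g p i l) t mu Mx j)//.
  - have -> : ev (let b := bev f Mb (val i) in (- b.1, - b.2 - th j / S)) (y p)
        = - ev (bev f Mb (val i)) (y p) - th j / S.
      by rewrite /ev /= -scaleN1r dotvZl; ring.
    rewrite subr_gt0 ltr_pdivrMr// mulNr mulrC evy -sumrN.
    by congr (_ < _); apply: eq_bigr => l _; rewrite mulrN.
  - by move=> l lk; rewrite normrN; exact: gM.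
  - by move=> l lk; rewrite normrN oppr_eq0; exact: gmu.
pose pat p := [set h | (0 < ev (ff h) (y p))%R].
have cpat : (#|[set pat p | p in P]| <= flag_bound m)%N.
  apply: leq_trans (card_patterns ff y) _; apply: (@leq_trans ((#|J| * k.+1 * 2).+1 ^ k)).
    by rewrite !card_prod card_bool card_ord card_sig.
  by apply: leq_expW; rewrite ltnS !leq_mul2r cJ !orbT.
(* Equal patterns mean equal signs at every level, hence equal cells and equal least-norm points. *)
have vpat p q : pat p = pat q -> forall j, (j <= k)%N -> vv p j = vv q j.
  move=> e j jk; have [_ /(_ j jk)[mp _ _ _]] := fl p; have [_ /(_ j jk)[mq _ _ _]] := fl q.
  apply: (is_min_unique (cvx_inter (@cvx_side _ _ _ f Mb (al p j))) mp).
  suff ss i : i \in J -> side f Mb (al p j) i = side f Mb (al q j) i.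
    case: mq => cq mq; split; first by move=> i iJ; rewrite ss//; exact: cq.
    by move=> z cz; apply: mq => i iJ; rewrite -ss//; exact: cz.
  move=> iJ; pose i' : I := exist _ i iJ; pose j' := Ordinal (jk : (j < k.+1)%N).
  move/setP: (e) => es; have := es (i', j', true); have := es (i', j', false).
  rewrite !inE !ffP /g /= /side => en ep; apply/funext => z; apply/propext.
  exact: compat_sign.
have [p0 _|P0] := pickP (@predT P); last first.
  have F (p : P) : False by have := P0 p.
  by exists (fun p => False_rect _ (F p)), (fun _ _ => 0) => p; case: (F p).
have p0i : pat p0 \in [set pat p | p in P] by apply/imsetP; exists p0.
pose cl p := widen_ord cpat (enum_rank_in p0i (pat p)).
exists cl, (fun i => if [pick p | cl p == i] is Some p then vv p else fun=> 0) => p.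
exists (al p); case: pickP => [q|/(_ p)]; last by rewrite eqxx.
move/eqP => e; have {}e : pat q = pat p.
  move/(congr1 val): e => /= e.
  have ip r : pat r \in [set pat p | p in P] by apply/imsetP; exists r.
  by rewrite -(enum_rankK_in p0i (ip q)) -(enum_rankK_in p0i (ip p)); congr enum_val; exact: val_inj.
have [h0 h] := fl p; split => // j jk; rewrite (vpat _ _ e)//; exact: h.
Qed.

End FlagCount.

(** * Cuttings from samples of hyperplanes *)

Section Cutting.
Context {R : realType} {k : nat}.

Definition crosses (h : aff (R := R) k) (v : nat -> 'rV[R]_k) :=
  [exists i : 'I_k.+1, 0 < ev h (v i)] && [exists i : 'I_k.+1, ev h (v i) < 0].

(** If every sample of g members fails, each has a flag crossed by more than a fraction 1 / u of all
    members but by none of the sample. By [flag_local] it is already a flag of some D members of the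
    sample, and the other g - D avoid its crossing set. There are too few samples of this form. *)
Theorem cutting (H P : finType) (f : H -> aff (R := R) k) (w : H -> nat)
    (x : P -> 'rV[R]_k) (g u : nat) (D := (k.+1 * k.+1)%N) :
  (0 < u)%N -> (D <= g)%N ->
  ('C(g, D) * flag_bound (k := k) D * (2 * u - 1) ^ (g - D) < (2 * u) ^ (g - D))%N ->
  exists (cl : P -> 'I_(flag_bound (k := k) g)) (v : 'I_(flag_bound (k := k) g) -> nat -> 'rV[R]_k),
    (forall p (A : set 'rV[R]_k), cvx A -> (forall j, (j <= k)%N -> A (v (cl p) j)) -> A (x p)) /\
    forall p, (u * \sum_(h | crosses (f h) (v (cl p))) w h <= \sum_h w h)%N.
Proof.
move=> u0 Dg hnum.
(* Enough copies to draw g of them and to have more than 2uD in all; discarding D of them then only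
   turns 1 - 1/u into 1 - 1/(2u). *)
pose Mc := (g + 2 * u * D + 1)%N; pose W := (\sum_h w h)%N.
pose H' := blowup (fun h => (Mc * w h)%N) [set: H].
pose f' (z : H') := f (tag z).
pose Mb := \sum_p \sum_j `|x p 0 j|.
have bx p : in_box Mb (x p).
  move=> j; rewrite -ler_norml; apply: le_trans (_ : \sum_l `|x p 0 l| <= _).
    by rewrite (bigD1 j)//= lerDl; exact: sumr_ge0.
  by rewrite /Mb (bigD1 p)//= lerDl; apply: sumr_ge0 => q _; exact: sumr_ge0.
pose JJ (S : {set H'}) : {set boxed (k := k) (H := H')} :=
  [set i | if i is inl z then z \in S else true].
have bJJ S : has_box (JJ S) by move=> i; rewrite inE.
have cJJ S : (#|JJ S| <= #|S| + k * 2)%N.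
  have -> : JJ S = (inl @: S) :|: (inr @: [set: 'I_k * bool]).
    apply/setP => -[z|b]; rewrite !inE.
      rewrite mem_imset; last by move=> ? ? [].
      by case: (z \in S) => //=; apply/esym/imsetP => -[].
    by apply/esym/orP; right; apply/imsetP; exists b.
  apply: leq_trans (leq_card_setU _ _) _; apply: leq_add; first exact: leq_imset_card.
  by apply: leq_trans (leq_imset_card _ _) _; rewrite cardsT card_prod card_ord card_bool.
have JJS (S S' : {set H'}) : S \subset S' -> JJ S \subset JJ S'.
  by move=> /subsetP sS; apply/subsetP => -[z|b]; rewrite !inE//; exact: sS.
have cls (m : nat) (S : {set H'}) : exists clv : (P -> 'I_(flag_bound (k := k) m)) * ('I_(flag_bound (k := k) m) -> nat -> 'rV[R]_k),
    (#|S| <= m)%N -> forall p, exists al, flag f' Mb (JJ S) (x p) (clv.2 (clv.1 p)) al.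
  have [Sm|nS] := leqP #|S| m.
    have [|cl [v h]] := @flag_classes R k H' f' Mb P x (JJ S) m (bJJ S) _ bx; last by exists (cl, v).
    by apply: leq_trans (cJJ S) _; rewrite leq_add2r.
  have B0 : (0 < flag_bound (k := k) m)%N by rewrite expn_gt0.
  by exists (fun=> Ordinal B0, fun _ _ => 0).
pose crset v := [set z : H' | crosses (f' z) v].
have card_cr v : #|crset v| = (Mc * \sum_(h | crosses (f h) v) w h)%N.
  rewrite /crset (card_blowup (fun h => (Mc * w h)%N) [set: H] (fun h => crosses (f h) v)).
  by rewrite big_distrr /=; apply: eq_bigl => h; rewrite inE.
have cH' : #|H'| = (Mc * W)%N.
  by rewrite /H' card_blowupT /W big_distrr /=; apply: eq_bigl => h; rewrite inE.
have good_concl (S : {set H'}) m : (#|S| <= m)%N -> (m <= g)%N ->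
    (forall p v al, flag f' Mb (JJ S) (x p) v al -> (u * #|crset v| <= #|H'|)%N) ->
    exists (cl : P -> 'I_(flag_bound (k := k) g)) (v : 'I_(flag_bound (k := k) g) -> nat -> 'rV[R]_k),
    (forall p (A : set 'rV[R]_k), cvx A -> (forall j, (j <= k)%N -> A (v (cl p) j)) -> A (x p)) /\
    forall p, (u * \sum_(h | crosses (f h) (v (cl p))) w h <= \sum_h w h)%N.
  move=> Sm mg hS; have [[cl v] /= h] := cls g S; exists cl, v; split.
    move=> p A cA hA; have [al fl] := h (leq_trans Sm mg) p.
    exact: flag_hull cA fl hA.
  move=> p; have [al fl] := h (leq_trans Sm mg) p; have := hS _ _ _ fl.
  by rewrite card_cr cH' mulnCA leq_pmul2l// /Mc addn1.
have [W0|W0] := posnP W.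
  apply: (good_concl set0 0%N); rewrite ?cards0// => p v al _.
  by have := max_card (mem (crset v)); rewrite cH' W0 muln0 leqn0 => /eqP ->; rewrite muln0.
have nbig : (g + 2 * u * D + 1 <= #|H'|)%N by rewrite cH' -/Mc leq_pmulr.
apply: contrapT => nogood.
have bad (S : {set H'}) : #|S| = g -> exists p v al,
    flag f' Mb (JJ S) (x p) v al /\ (#|H'| < u * #|crset v|)%N.
  move=> cS; apply: contrapT => h; apply: nogood; apply: (good_concl S g) => //.
    by rewrite cS.
  move=> p v al fl; rewrite leqNgt; apply/negP => lt; apply: h; by exists p, v, al.
have [cl hcl] := choice (cls D).
(* Upper bound for the number of members that do not cross a bad simplex. *)
pose c := ((u - 1) * #|H'| %/ u)%N.
pose im (S : {set H'}) (e : 'I_(flag_bound (k := k) D)) :=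
  if (#|~: crset ((cl S).2 e)| <= c)%N then
    [set S :|: E | E in [set E : {set H'} | E \subset ~: crset ((cl S).2 e) & #|E| == (g - D)%N] ]
  else set0.
pose dr m := [set S : {set H'} | #|S| == m].
have cover : dr g \subset \bigcup_(S in dr D) \bigcup_e im S e.
  apply/subsetP => S; rewrite inE => /eqP cS; have [p [v [al [fl bd]]]] := bad S cS.
  have [Dl [DlS cDl hDl]] := flag_local fl.
  pose S1 := [set z | inl z \in Dl].
  have S1S : S1 \subset S by apply/subsetP => z; rewrite inE => /(subsetP DlS); rewrite inE.
  have cS1 : (#|S1| <= D)%N.
    apply: leq_trans cDl; rewrite -(card_imset (mem S1) (@inl_inj _ ('I_k * bool)%type)).
    by apply: subset_leq_card; apply/subsetP => _ /imsetP[z + ->]; rewrite inE.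
  have [|S0 [S10 S0S cS0]] := @subset_card_between _ S1 S D S1S; first by rewrite cS1 cS.
  have flS0 : flag f' Mb (JJ S0) (x p) v al.
    apply: hDl; last exact: JJS.
    by apply/subsetP => -[z|b] h; rewrite inE//; apply: (subsetP S10); rewrite inE.
  have [al' fl'] := hcl S0 (eq_leq cS0) p.
  have ev' := flag_unique flS0 fl'; set e := (cl S0).1 p in fl' ev' *.
  have ecr : crset ((cl S0).2 e) = crset v.
    apply/setP => z; rewrite !inE /crosses; congr (_ && _); apply: eq_existsb => i;
      (have ik : (i <= k)%N by rewrite -ltnS); by rewrite ev'.
  apply/bigcupP; exists S0; first by rewrite inE cS0.
  apply/bigcupP; exists e => //; rewrite /im ecr.
  have -> : (#|~: crset v| <= c)%N.
    rewrite leq_divRL// mulnC; have := cardsC (crset v); move: bd u0; rewrite -/H'.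
    move: #|H'| #|crset v| #|~: crset v| => a b b'; clear; nia.
  apply/imsetP; exists (S :\: S0); last by rewrite -{1}(setID S S0) (setIidPr S0S).
  rewrite inE cardsD (setIidPr S0S) cS cS0 eqxx andbT.
  apply/subsetP => z; rewrite !inE => /andP[_ zS]; apply/negP => /andP[/existsP[i pi] /existsP[j nj]].
  have [_ cc] := flag_compat fl (i := inl z) ltac:(by rewrite inE).
  have [] := cc i ltac:(by rewrite -ltnS); have [] := cc j ltac:(by rewrite -ltnS).
  move=> /= a1 a2 a3 b1 b2 b3; case: (ltgtP (ev (f' z) (x p)) 0) => s.
  - by have := b2 s; rewrite leNgt pi.
  - by have := a1 s; rewrite leNgt nj.
  - by have := a3 s => e3; rewrite e3 ltxx in nj.
have := subset_leq_card cover; rewrite /dr card_draws => h1.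
have {h1} hit : ('C(#|H'|, g) <= flag_bound (k := k) D * ('C(#|H'|, D) * 'C(c, g - D)))%N.
  apply: leq_trans h1 _.
  apply: leq_trans (_ : \sum_(S in dr D) \sum_(e < flag_bound (k := k) D) 'C(c, g - D) <= _)%N; last first.
    rewrite sum_nat_const /dr card_draws sum_nat_const card_ord; apply/eq_leq; ring.
  have bc (I : finType) (B : {pred I}) (F : I -> {set {set H'}}) :
      (#|\bigcup_(i in B) F i| <= \sum_(i in B) #|F i|)%N.
    elim/big_rec2: _ => [|i m' U _ h']; first by rewrite cards0.
    by apply: leq_trans (leq_card_setU _ _) _; rewrite leq_add2l.
  apply: leq_trans (bc _ _ _) _; apply: leq_sum => S _.
  apply: leq_trans (bc _ predT _) _; apply: leq_sum => e _.
  rewrite /im; case: ifP => [le|_]; last by rewrite cards0.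
  apply: leq_trans (leq_imset_card _ _) _; rewrite cards_draws; exact: leq_bin2l.
have gn : (g <= #|H'|)%N by nlia.
have := bin_ratio Dg gn hit; set B := 'C(#|H'| - D, g - D) => hB.
have B0 : (0 < B)%N by rewrite bin_gt0; apply: leq_sub2r.
have cn : (u * c <= (u - 1) * #|H'|)%N by rewrite mulnC leq_trunc_div.
set n := #|H'| in nbig cn B B0 hB *.
have ucn : (2 * u * c <= (2 * u - 1) * (n - D))%N by move: nbig cn u0; clear; nia.
have cnD : (c <= n - D)%N by move: ucn u0; clear; nia.
have := bin_exp_ratio (g - D) cnD; rewrite -/B => hr.
have nD0 : (0 < (n - D) ^ (g - D))%N by rewrite expn_gt0; apply/orP; left; move: nbig u0; clear; nia.
have h2 : ((2 * u) ^ (g - D) * 'C(c, g - D) <= (2 * u - 1) ^ (g - D) * B)%N.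
  rewrite -(leq_pmul2l nD0) mulnCA.
  apply: leq_trans (_ : (2 * u) ^ (g - D) * (c ^ (g - D) * B) <= _)%N.
    by rewrite leq_mul2l hr orbT.
  rewrite mulnA -expnMn [leqRHS]mulnA -expnMn [((n - D) * _)%N]mulnC leq_mul2r; apply/orP; right.
  exact: leq_expW.
move: hnum; rewrite ltnNge => /negP; apply; rewrite -(leq_pmul2r B0).
apply: leq_trans (_ : (2 * u) ^ (g - D) * ('C(g, D) * flag_bound (k := k) D * 'C(c, g - D)) <= _)%N.
  by rewrite leq_mul2l hB orbT.
by rewrite mulnCA -[leqRHS]mulnA leq_mul2l h2 orbT.
Qed.

End Cutting.

(** * Simplicial partitions *)

Section Splitting.
Context {R : realType} {d : nat} {P : finType}.
Variable x : P -> 'rV[R]_d.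
Implicit Types (h : aff (R := R) d) (A B C : {set P}).

Definition splits h A := [exists p in A, 0 < ev h (x p)] && [exists p in A, ev h (x p) < 0].

Definition avoids h := forall p, ev h (x p) != 0.

Lemma cvx_ev_le n (h : aff (R := R) n) : cvx (fun y => ev h y <= 0).
Proof.
move=> y z t t0 t1 hy hz; rewrite ev_conv.
have t1' : 0 <= 1 - t by rewrite subr_ge0.
by have := mulr_ge0_le0 t0 hy; have := mulr_ge0_le0 t1' hz; lra.
Qed.

Lemma cvx_ev_ge n (h : aff (R := R) n) : cvx (fun y => 0 <= ev h y).
Proof.
by move=> y z t t0 t1 hy hz; rewrite ev_conv addr_ge0// mulr_ge0// subr_ge0.
Qed.

Lemma dotv_row_mx m n (a c : 'rV[R]_m) (b e : 'rV[R]_n) :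
  dotv (row_mx a b) (row_mx c e) = dotv a c + dotv b e.
Proof.
rewrite /dotv big_split_ord /=.
by congr (_ + _); apply: eq_bigr => i _; rewrite ?row_mxEl ?row_mxEr.
Qed.

(** Homogeneous duality: a functional becomes a point of dimension d + 1 on which [x p] acts
    linearly, with no exception for vertical hyperplanes. The additional dimension only raises the
    size of the test set, which enters later through its logarithm. *)
Definition dual_pt h : 'rV[R]_(d + 1) := row_mx h.1 (const_mx h.2).
Definition primal_aff (y : 'rV[R]_(d + 1)) : aff (R := R) d := (lsubmx y, rsubmx y 0 0).
Definition dual_aff p : aff (R := R) (d + 1) := (row_mx (x p) (const_mx 1), 0).

Lemma dual_affE y p : ev (dual_aff p) y = ev (primal_aff y) (x p).
Proof.
rewrite /ev /= addr0 -{1}(hsubmxK y) dotv_row_mx dotvC; congr (_ + _).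
by rewrite /dotv big_ord1 !mxE mul1r.
Qed.

Lemma primal_dual h p : ev (primal_aff (dual_pt h)) (x p) = ev h (x p).
Proof. by rewrite /ev /primal_aff /dual_pt /= row_mxKl row_mxKr !mxE. Qed.

(* The vertices of a cutting in the dual space, shifted up and down a little, form a
   test set: if [h] splits a large class that no vertex of its dual simplex splits,
   then all points of the class, read as dual hyperplanes, cross that simplex. *)
Lemma test_set (g u : nat) (D := ((d + 1).+1 * (d + 1).+1)%N) :
  (0 < u)%N -> (D <= g)%N ->
  ('C(g, D) * flag_bound (k := d + 1) D * (2 * u - 1) ^ (g - D) < (2 * u) ^ (g - D))%N ->
  exists (Q : finType) (q : Q -> aff (R := R) d),
    [/\ (#|Q| <= flag_bound (k := d + 1) g * (d + 1).+1 * 2)%N, (forall j, avoids (q j)) &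
     forall h, avoids h -> exists2 L : {set Q}, (#|L| <= (d + 1).+1 * 2)%N &
       forall A, (#|P| < u * #|A|)%N -> splits h A -> exists2 j, j \in L & splits (q j) A].
Proof.
move=> u0 Dg hnum.
(* [cutting] locates finitely many points, so one functional is chosen for each sign pattern on
   [P]. *)
have exr (B : {set P}) : exists h, (exists h', avoids h' /\ B = [set p | 0 < ev h' (x p)]) ->
    avoids h /\ B = [set p | 0 < ev h (x p)].
  by have [[h' hh]|n] := pselect (exists h', avoids h' /\ B = [set p | 0 < ev h' (x p)]);
    [exists h'|exists (0, 0)].
have [r hr] := choice exr.
have [cl [v [hull cross]]] := cutting dual_aff (fun=> 1%N) (fun B => dual_pt (r B)) u0 Dg hnum.
set N := flag_bound _ in cl v hull cross *.
pose X : finType := ('I_N * 'I_(d + 1).+1 * P)%type.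
pose va e j p := ev (primal_aff (v e j)) (x p).
have [mu mu0 hmu] := pos_lower_bound (fun y : X => `|va y.1.1 y.1.2 y.2|).
(* A shift by [mu / 2] preserves every nonzero sign and moves the points on the hyperplane to either
   side. *)
pose q (j : 'I_N * 'I_(d + 1).+1 * bool) : aff (R := R) d :=
  ((primal_aff (v j.1.1 j.1.2)).1, (primal_aff (v j.1.1 j.1.2)).2 + (if j.2 then mu / 2 else - (mu / 2))).
have qE e j b p : ev (q (e, j, b)) (x p) = va e j p + (if b then mu / 2 else - (mu / 2)).
  by rewrite /q /va /ev /= addrA.
have small e (j : 'I_(d + 1).+1) p : va e j p != 0 -> mu <= `|va e j p|.
  by move=> n0; apply: (hmu ((e, j, p) : X)); rewrite normr_gt0.
exists ('I_N * 'I_(d + 1).+1 * bool)%type, q; split.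
- by rewrite !card_prod !card_ord card_bool.
- move=> [[e j] b] p; rewrite qE; have [->|n0] := eqVneq (va e j p) 0.
    by rewrite add0r; case: b; rewrite ?oppr_eq0 gt_eqF// divr_gt0.
  have := small _ _ _ n0; move: (va e j p) n0 => a n0.
  by case: b; case: (ltrgt0P a) n0 => // a0 _ ha; apply/eqP => e0; lra.
move=> h ah; pose B := [set p | 0 < ev h (x p)].
have [arB eB] : avoids (r B) /\ B = [set p | 0 < ev (r B) (x p)] by apply: hr; exists h.
have sgn p : (0 < ev h (x p)) = (0 < ev (r B) (x p)).
  by move/setP/(_ p): eB; rewrite !inE.
have sgn' p : (ev h (x p) < 0) = (ev (r B) (x p) < 0).
  by have := sgn p; have := ah p; have := arB p; case: (ltgtP (ev h (x p)) 0); case: (ltgtP (ev (r B) (x p)) 0).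
pose e := cl B; exists [set j | j.1.1 == e].
  have -> : [set j | j.1.1 == e] = [set (e, j.1, j.2) | j : 'I_(d + 1).+1 * bool].
    apply/setP => -[[e' j] b]; rewrite inE /=; apply/eqP/imsetP => [->|[[j' b'] _ [-> _ _]]//].
    by exists (j, b).
  by apply: leq_trans (leq_imset_card _ _) _; rewrite card_prod card_ord card_bool.
move=> A big /andP[/exists_inP[p1 p1A hp1] /exists_inP[p2 p2A hp2]].
apply: contrapT => nosplit.
have ns (j : 'I_(d + 1).+1) b : ~~ splits (q (e, j, b)) A.
  by apply/negP => s; apply: nosplit; exists (e, j, b); rewrite ?inE.
have allpos (j : 'I_(d + 1).+1) p : p \in A -> 0 < va e j p -> forall p', p' \in A -> 0 < va e j p'.
  move=> pA vp p' p'A; rewrite ltNge; apply/negP => vp'; case/negP: (ns j false).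
  have := small e j p; rewrite gt_eqF// gtr0_norm// => /(_ isT) hm.
  apply/andP; split; apply/exists_inP; [exists p|exists p'] => //; rewrite qE; lra.
have allneg (j : 'I_(d + 1).+1) p : p \in A -> va e j p < 0 -> forall p', p' \in A -> va e j p' < 0.
  move=> pA vp p' p'A; rewrite ltNge; apply/negP => vp'; case/negP: (ns j true).
  have := small e j p; rewrite lt_eqF// ltr0_norm// => /(_ isT) hm.
  apply/andP; split; apply/exists_inP; [exists p'|exists p] => //; rewrite qE; lra.
have [j1 hj1] : exists j : 'I_(d + 1).+1, 0 < va e j p1.
  apply: contrapT => H; move: hp1; rewrite sgn -primal_dual -dual_affE ltNge => /negP; apply.
  apply: (hull B (fun y => ev (dual_aff p1) y <= 0)); first exact: cvx_ev_le.
  move=> j jd; rewrite dual_affE leNgt; apply/negP => h1; apply: H.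
  by exists (Ordinal (jd : (j < (d + 1).+1)%N)).
have [j2 hj2] : exists j : 'I_(d + 1).+1, va e j p2 < 0.
  apply: contrapT => H; move: hp2; rewrite sgn' -primal_dual -dual_affE ltNge => /negP; apply.
  apply: (hull B (fun y => 0 <= ev (dual_aff p2) y)); first exact: cvx_ev_ge.
  move=> j jd; rewrite dual_affE leNgt; apply/negP => h1; apply: H.
  by exists (Ordinal (jd : (j < (d + 1).+1)%N)).
move: big; rewrite ltnNge => /negP; apply; have := cross B.
rewrite [X in (_ <= X)%N]sum1_card; apply: leq_trans; rewrite leq_mul2l sum1_card; apply/orP; right.
apply: subset_leq_card; apply/subsetP => p pA; rewrite unfold_in /=; apply/andP; split.
  by apply/existsP; exists j1; rewrite dual_affE; exact: allpos hj1 _ pA.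
by apply/existsP; exists j2; rewrite dual_affE; exact: allneg hj2 _ pA.
Qed.

Definition ceil_div n t := ((n + t.-1) %/ t)%N.

Lemma ceil_divP n t : (0 < t)%N -> (t <= n)%N ->
  [/\ n <= t * ceil_div n t, (ceil_div n t).-1 * t < n, t * ceil_div n t <= 2 * n &
      0 < ceil_div n t]%N.
Proof.
move=> t0 tn; rewrite /ceil_div; have := divn_eq (n + t.-1) t; have := ltn_pmod (n + t.-1) t0.
by move: ((n + t.-1) %/ t)%N ((n + t.-1) %% t)%N => a b; move: t0 tn; clear; split; nia.
Qed.

(** Classes are taken greedily from the cells of a cutting of the weighted test set, and a test
    functional doubles its weight when it splits the new class. At most a fraction 1 / u1 of the
    weight doubles each time, so after at most t classes no weight reaches 2 ^ kap.+1. While more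
    than an eighth of the points remain, some cell contains a full class. *)
Theorem partition_theorem (g1 u1 g2 t kap : nat) (D1 := (d.+1 * d.+1)%N)
    (D2 := ((d + 1).+1 * (d + 1).+1)%N) (k0 := ceil_div #|P| t) :
  (0 < u1)%N -> (0 < t <= #|P|)%N -> (D1 <= g1)%N -> (D2 <= g2)%N ->
  ('C(g1, D1) * flag_bound (k := d) D1 * (2 * u1 - 1) ^ (g1 - D1) < (2 * u1) ^ (g1 - D1))%N ->
  ('C(g2, D2) * flag_bound (k := d + 1) D2 * (2 * t.+1 - 1) ^ (g2 - D2) < (2 * t.+1) ^ (g2 - D2))%N ->
  (8 * flag_bound (k := d) g1 <= t)%N ->
  (flag_bound (k := d + 1) g2 * (d + 1).+1 * 2 * u1.+1 ^ t < 2 ^ kap.+1 * u1 ^ t)%N ->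
  exists cs : seq {set P}, [/\ (size cs <= t)%N, (forall C, C \in cs -> #|C| = k0),
    (8 * #|~: \bigcup_(C <- cs) C| <= #|P|)%N &
    forall h, avoids h -> (count (splits h) cs <= (d + 1).+1 * 2 * kap)%N].
Proof.
move=> u10 /andP[t0 tP] D1g D2g hn1 hn2 tN hkap.
have [n_tk k_n tk_n k00] := ceil_divP t0 tP.
have [Q [q [cQ aq hQ]]] := test_set (ltn0Sn t) D2g hn2.
pose good cs := [/\ (forall C, C \in cs -> #|C| = k0), #|\bigcup_(C <- cs) C| = (size cs * k0)%N &
  ((\sum_j 2 ^ count (splits (q j)) cs) * u1 ^ size cs <= #|Q| * u1.+1 ^ size cs)%N].
have size_good cs : good cs -> (size cs <= t)%N.
  move=> [_ e _]; rewrite -(leq_pmul2r k00) -/k0 -e; apply: leq_trans n_tk.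
  exact: max_card.
suff [cs gcs done] : exists2 cs, good cs & (8 * #|~: \bigcup_(C <- cs) C| <= #|P|)%N.
  exists cs; split => //; [exact: size_good|by case: gcs|].
  have qc j : (count (splits (q j)) cs <= kap)%N.
    have [_ _ hw] := gcs; have sz := size_good _ gcs.
    rewrite -ltnS -(ltn_exp2l _ _ (isT : (1 < 2)%N)).
    have u1t : (0 < u1 ^ t)%N by rewrite expn_gt0 u10.
    rewrite -(ltn_pmul2r u1t); apply: leq_ltn_trans hkap.
    apply: (@leq_trans (#|Q| * u1.+1 ^ t)); last by rewrite leq_mul2r cQ orbT.
    rewrite -(subnKC sz) !expnD !mulnA; apply: leq_mul; last by apply: leq_expW.
    apply: leq_trans hw; rewrite leq_mul2r; apply/orP; right.
    by rewrite (bigD1 j)//= leq_addr.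
  (* [test_set] was applied with [t.+1], because [k0 * t.+1] exceeds [#|P|] strictly; each class
     that [h] splits is thus split by a member of [L]. *)
  move=> h ah; have [L cL hL] := hQ h ah.
  apply: (@leq_trans (\sum_(j in L) count (splits (q j)) cs)); last first.
    apply: (@leq_trans (\sum_(j in L) kap)); first exact: leq_sum.
    by rewrite sum_nat_const leq_mul2r cL orbT.
  have [hk _ _] := gcs.
  elim: cs hk {gcs done qc} => [|C cs IH] hk /=; first by [].
  rewrite big_split /=; apply: leq_add; last by apply: IH => E Ecs; apply: hk; rewrite inE Ecs orbT.
  case: (boolP (splits h C)) => // sC.
  have [|j jL sj] := hL C _ sC.
    rewrite (hk C) ?inE ?eqxx// mulSn; apply: leq_ltn_trans n_tk _.
    by rewrite -[X in (X < _)%N]add0n ltn_add2r.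
  by rewrite (bigD1 j)//= sj.
have ext cs : good cs -> (#|P| < 8 * #|~: \bigcup_(C <- cs) C|)%N -> exists C, good (C :: cs).
  move=> [hk hU hw] big; set S := ~: _ in big.
  have [cl [v [hull cross]]] := cutting q (fun j => 2 ^ count (splits (q j)) cs)%N x u10 D1g hn1.
  have [e he] : exists e, (k0 <= #|[set p in S | cl p == e]|)%N.
    apply: contrapT => H.
    have : (#|S| <= \sum_(e < flag_bound (k := d) g1) k0.-1)%N.
      rewrite -sum1_card (partition_big cl predT)//=; apply: leq_sum => e _.
      rewrite -ltnS prednK// ltnNge; apply/negP => le; apply: H; exists e.
      by apply: leq_trans le _; rewrite -sum1_card; apply/eq_leq; apply: eq_bigl => p; rewrite inE.
    rewrite sum_nat_const card_ord => hS.
    have ar (a b c n l : nat) : (n < 8 * c -> b.-1 * l < n -> 8 * a <= l -> c <= a * b.-1 -> False)%N.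
      by clear; nia.
    exact: ar big k_n tN hS.
  have [|C [_ Ce cC]] := @subset_card_between _ set0 _ k0 (sub0set [set p in S | cl p == e]).
    by rewrite cards0.
  have clC p : p \in C -> p \in S /\ cl p = e.
    by move=> /(subsetP Ce); rewrite inE => /andP[? /eqP].
  exists C; split => /=.
  - by move=> E; rewrite inE => /orP[/eqP -> //|]; exact: hk.
  - rewrite big_cons cardsU hU cC (_ : C :&: _ = set0) ?cards0 ?subn0//.
    apply/setP => p; rewrite !inE; apply/negP => /andP[/clC[+ _]].
    by rewrite inE => /negP.
  set W := (\sum_j _)%N in hw; rewrite !expnS.
  have crossC j : splits (q j) C -> crosses (q j) (v e).
    move=> /andP[/exists_inP[p pC hp] /exists_inP[p' pC' hp']].
    have [_ ep] := clC p pC; have [_ ep'] := clC p' pC'.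
    apply/andP; split; apply: contraT; rewrite negb_exists => /forallP ha.
      move: hp; rewrite ltNge => /negP[]; apply: (hull p (fun y => ev (q j) y <= 0)).
        exact: cvx_ev_le.
      by move=> i id; rewrite ep leNgt; exact: (ha (Ordinal (id : (i < d.+1)%N))).
    move: hp'; rewrite ltNge => /negP[]; apply: (hull p' (fun y => 0 <= ev (q j) y)).
      exact: cvx_ev_ge.
    by move=> i id; rewrite ep' leNgt; exact: (ha (Ordinal (id : (i < d.+1)%N))).
  have hW : (\sum_j 2 ^ (splits (q j) C + count (splits (q j)) cs) =
      W + \sum_(j | splits (q j) C) 2 ^ count (splits (q j)) cs)%N.
    rewrite [in RHS]big_mkcond -big_split /=; apply: eq_bigr => j _.
    by case: (splits (q j) C); rewrite ?add1n ?add0n ?addn0// expnS mul2n addnn.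
  have hle : (u1 * \sum_(j | splits (q j) C) 2 ^ count (splits (q j)) cs <= W)%N.
    have [p pC] : exists p, p \in C by apply/set0Pn; rewrite -card_gt0 cC.
    have [_ ep] := clC p pC.
    apply: leq_trans (_ : u1 * \sum_(j | crosses (q j) (v e)) 2 ^ count (splits (q j)) cs <= _)%N.
      rewrite leq_mul2l; apply/orP; right; rewrite big_mkcond [leqRHS]big_mkcond /=.
      by apply: leq_sum => j _; case: (boolP (splits _ _)) => // /crossC ->.
    by have := cross p; rewrite ep.
  rewrite hW; move: hle hw; set Z := (\sum_(j | _) _)%N; move: (u1 ^ size cs)%N (u1.+1 ^ size cs)%N => a b.
  move: #|Q| => m; clear; nia.
have [n] := ubnP #|~: \bigcup_(C <- [::] : seq {set P}) C|.
have : good [::].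
  by split => //=; rewrite ?big_nil ?cards0// !expn0 !muln1 (eq_bigr (fun=> 1%N)) ?sum1_card.
move: ([::] : seq {set P}); elim: n => [//|n IH] cs gcs /ltnSE hn.
have [done|more] := leqP (8 * #|~: \bigcup_(C <- cs) C|) #|P|; first by exists cs.
have [C gC] := ext cs gcs more; apply: (IH _ gC); apply: leq_trans hn.
apply: proper_card; apply/properP; split.
  by rewrite big_cons setCU subsetIr.
have [hk hU _] := gC; have [_ hU' _] := gcs.
have [p pC] : exists p, p \in C by apply/set0Pn; rewrite -card_gt0 hk ?inE ?eqxx.
have pn : p \notin \bigcup_(E <- cs) E.
  apply/negP => pU; move: hU; rewrite big_cons cardsU hU' (hk C) ?inE ?eqxx//= mulSn.
  have : (0 < #|C :&: \bigcup_(E <- cs) E|)%N by apply/card_gt0P; exists p; rewrite inE pC.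
  have : (#|C :&: \bigcup_(E <- cs) E| <= k0)%N.
    by rewrite -(hk C) ?inE ?eqxx// subset_leq_card ?subsetIl.
  by move: #|_ :&: _| => a; nlia.
by exists p; rewrite ?inE ?big_cons ?inE ?pC.
Qed.

End Splitting.

(** * Weak epsilon-nets *)

Lemma separation_arith (R : realType) (s X a b c : R) : 0 < s -> s * (X + (c - b)) = c - b ->
  0 < c - b -> X = a - 2 * b + c -> c <= s * a + (1 - s) * c - s * (1 - s) * X -> False.
Proof.
move=> s0 se cb Xe hs; have : 0 <= s * (a - c - (1 - s) * X) by lra.
by rewrite pmulr_rge0// => h2; have := mulr_gt0 s0 cb; lra.
Qed.

Section WeakNets.
Context {R : realType} {d : nat}.
Implicit Types (z y : 'rV[R]_d) (A : set 'rV[R]_d) (h : aff (R := R) d).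

Lemma dotvNl y z : dotv (- y) z = - dotv y z.
Proof. by rewrite -scaleN1r dotvZl mulN1r. Qed.

Lemma dotvNr y z : dotv y (- z) = - dotv y z.
Proof. by rewrite dotvC dotvNl dotvC. Qed.

(** The hyperplane is orthogonal to the least-norm vector w of A - z and lies halfway along it. *)
Lemma separation A z : cvx A -> compact A -> (A !=set0)%classic -> ~ A z ->
  exists h (e : R), [/\ 0 < e, forall y, A y -> ev h y <= - e & e <= ev h z].
Proof.
move=> cA kA [y0 Ay0] nAz; pose A' := ((fun y => y - z) @` A)%classic.
have [||w [[y1 Ay1 ew] mw]] := @is_min_exists R d A'.
- by exists (y0 - z); exists y0.
- apply: continuous_compact => //; apply: continuous_subspaceT => y.
  exact: (cvgB cvg_id (cvg_cst z)).
have cA' : cvx A'.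
  move=> _ _ t t0 t1 [a Aa <-] [b Ab <-]; exists (t *: a + (1 - t) *: b); first exact: cA.
  by rewrite !scalerBr addrACA -opprD -scalerDl subrKC scale1r.
have w0 : 0 < dotv w w.
  rewrite lt_def dotv_ge0 andbT; apply/eqP => /dotv_eq0 w0; apply: nAz.
  by move/eqP: ew; rewrite w0 subr_eq0 => /eqP <-.
have hw' a : A' a -> dotv w w <= dotv w a.
  move=> Aa; rewrite leNgt; apply/negP => lt.
  pose dl := dotv w w - dotv w a; have dl0 : 0 < dl by rewrite subr_gt0.
  have n0 := dotv_ge0 (a - w).
  pose t := dl / (dotv (a - w) (a - w) + dl).
  have den : 0 < dotv (a - w) (a - w) + dl by lra.
  have t0 : 0 < t by rewrite divr_gt0.
  have t1 : t <= 1 by rewrite ler_pdivrMr// mul1r; lra.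
  have te : t * (dotv (a - w) (a - w) + dl) = dl by rewrite divfK// gt_eqF.
  have := mw _ (cA' a w t (ltW t0) t1 Aa (ex_intro2 _ _ y1 Ay1 ew)); rewrite dotv_conv.
  have e1 : dotv (a - w) (a - w) = dotv a a - 2 * dotv w a + dotv w w.
    by rewrite -[- w]scaleN1r dotvDl !dotvDr !dotvZl !dotvZr [dotv a w]dotvC; ring.
  move=> h; exact: separation_arith t0 te dl0 e1 h.
have hw y : A y -> dotv w w <= dotv w (y - z) by move=> Ay; apply: hw'; exists y.
exists (- w, dotv w z + dotv w w / 2), (dotv w w / 2); split.
- by rewrite divr_gt0.
- move=> y /hw; rewrite dotvDr dotvNr /ev /= dotvNl; lra.
- rewrite /ev /= dotvNl; lra.
Qed.

Lemma separation_avoiding (P : finType) (x : P -> 'rV[R]_d) A z : cvx A -> compact A ->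
  (A !=set0)%classic -> ~ A z ->
  exists h, [/\ avoids x h, forall y, A y -> ev h y < 0 & 0 < ev h z].
Proof.
move=> cA kA A0 nAz; have [h [e [e0 hA hz]]] := separation cA kA A0 nAz.
have [mu mu0 hmu] := pos_lower_bound (fun p => `|ev h (x p)|).
pose s := Num.min mu e / 2.
have s0 : 0 < s by rewrite divr_gt0// lt_min mu0.
have smu : s < mu.
  by rewrite /s ltr_pdivrMr//; apply: le_lt_trans (_ : mu < _); [rewrite ge_min lexx|lra].
have se : s < e.
  by rewrite /s ltr_pdivrMr//; apply: le_lt_trans (_ : e < _); [rewrite ge_min lexx orbT|lra].
have evs y : ev (h.1, h.2 + s) y = ev h y + s by rewrite /ev addrA.
exists (h.1, h.2 + s); split.
- move=> p; rewrite evs; have := hmu p; case: (ltrgt0P (ev h (x p))) => [v|v|->].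
  + by move=> _; rewrite gt_eqF//; lra.
  + by move=> /(_ ltac:(lra)) ?; rewrite lt_eqF//; lra.
  + by move=> _; rewrite add0r gt_eqF.
- by move=> y /hA; rewrite evs; lra.
- by rewrite evs; lra.
Qed.

(** Convex hull as the intersection of all convex supersets, which avoids handling coefficients. *)
Definition hull (J : finType) (y : J -> 'rV[R]_d) (B : {set J}) : set 'rV[R]_d :=
  fun z => forall A, cvx A -> (forall j, j \in B -> A (y j)) -> A z.

(** Each [B] omits fewer than 1 / d.+1 of [I], so any d + 1 of them share an index, and Helly's
    theorem applies to their hulls. *)
Lemma centerpoint (J : finType) (y : J -> 'rV[R]_d) (I : {set J}) :
  exists z, forall B : {set J}, B \subset I -> (d.+1 * #|I :\: B| < #|I|)%N -> hull y B z.
Proof.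
have [||z hz] := @helly R d {set J} (hull y)
    [set B : {set J} | (B \subset I) && (d.+1 * #|I :\: B| < #|I|)%N].
- move=> B a b t t0 t1 ha hb A cA AB; apply: (cA _ _ t) => //; [exact: ha|exact: hb].
- move=> Q QF cQ; have [->|/set0Pn[B0 B0Q]] := eqVneq Q set0.
    by exists 0 => B; rewrite inE.
  have QP B : B \in Q -> (d.+1 * #|I :\: B| < #|I|)%N.
    by move=> /(subsetP QF); rewrite inE => /andP[].
  have [j jQ] : exists j, forall B, B \in Q -> j \in B.
    apply: contrapT => H.
    have IU : I \subset \bigcup_(B in Q) (I :\: B).
      apply/subsetP => j jI; apply: contrapT => /negP nj; apply: H; exists j => B BQ.
      apply: contraT => jB; case/negP: nj; apply/bigcupP; exists B => //.
      by rewrite inE jB.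
    have le : (#|I| <= \sum_(B in Q) #|I :\: B|)%N.
      apply: leq_trans (subset_leq_card IU) _.
      elim/big_rec2: _ => [|B m' U _ h']; first by rewrite cards0.
      by apply: leq_trans (leq_card_setU _ _) _; rewrite leq_add2l.
    have : (d.+1 * #|I| <= #|Q| * #|I|.-1)%N.
      apply: (@leq_trans (\sum_(B in Q) #|I|.-1)); last by rewrite sum_nat_const.
      apply: (@leq_trans (\sum_(B in Q) d.+1 * #|I :\: B|)); first by rewrite -big_distrr leq_mul2l le.
      by apply: leq_sum => B /QP; case: #|I|.
    have := QP _ B0Q; move: cQ; move: #|Q| #|I| #|I :\: B0| => a b c; clear; nia.
  by exists (y j) => B BQ A cA AB; apply: AB; exact: jQ.
by exists z => B BI hB; apply: hz; rewrite inE BI.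
Qed.

Definition partitionable (t kap : nat) := forall (P : finType) (x : P -> 'rV[R]_d),
  (t <= #|P|)%N -> exists cs : seq {set P},
  [/\ (size cs <= t)%N, (forall C, C \in cs -> #|C| = ceil_div #|P| t),
      (8 * #|~: \bigcup_(C <- cs) C| <= #|P|)%N &
      forall h, avoids x h -> (count (splits x h) cs <= kap)%N].

Context {T : finType}.
Variable K : T -> set 'rV[R]_d.
Hypotheses (Kcvx : forall i, cvx (K i)) (Kcpt : forall i, compact (K i)).

Section Step.
Context {P : finType}.
Variable x : P -> 'rV[R]_d.

Definition hits i (A : {set P}) : nat := #|[set p in A | `[< K i (x p) >] ]|.

Lemma hitsU i (A B : {set P}) : (hits i (A :|: B) <= hits i A + hits i B)%N.
Proof.
apply: leq_trans (leq_card_setU _ _); apply: subset_leq_card; apply/subsetP => p.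
by rewrite !inE; case: (p \in A); case: (p \in B); case: `[< _ >].
Qed.

Lemma hits_gt0 i (A : {set P}) : (0 < hits i A)%N -> exists2 p, p \in A & K i (x p).
Proof. by move=> /card_gt0P[p]; rewrite inE => /andP[pA /asboolP]; exists p. Qed.

Lemma hits_le i (A : {set P}) : (hits i A <= #|A|)%N.
Proof. by apply: subset_leq_card; apply/subsetP => p; rewrite inE => /andP[]. Qed.

(* A set rich in [A] is rich in the small leftover, or denser in one of the classes, or
   meets so many classes that it contains the centerpoint of their representatives. *)
Lemma net_step_full (t kap : nat) (r : R) : (0 < t)%N -> (0 < kap)%N -> partitionable t kap ->
  1 <= r -> (t <= #|P|)%N ->
  exists (cs : seq {set P}) (A0 : {set P}) (zs : seq 'rV[R]_d),
   [/\ (size cs <= t)%N, (size zs <= 2 ^ t)%N &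
     forall i, #|P|%:R <= r * (hits i setT)%:R ->
       [\/ (0 < #|A0|)%N /\ #|A0|%:R <= r / 4 * (hits i A0)%:R,
           exists C, [/\ C \in cs, (0 < #|C|)%N &
              #|C|%:R <= r * (4 * (d.+2 * kap)%:R / t%:R) * (hits i C)%:R] |
           exists2 z, z \in zs & K i z] ].
Proof.
move=> t0 kap0 part r1 tP; have [cs [szcs csk csu csh]] := part P x tP.
have [n_tk k_n tk_n k00] := ceil_divP t0 tP; set k0 := ceil_div _ _ in csk n_tk k_n tk_n k00.
pose m := size cs; pose nc (l : 'I_m) := nth set0 cs l.
have ncin l : nc l \in cs by exact: mem_nth.
have exrep l : exists p, p \in nc l by apply/set0Pn; rewrite -card_gt0 csk.
have [rep hrep] := choice exrep.
(* One centerpoint for each set of classes, whence the bound [2 ^ t]. *)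
have [zz hzz] := choice (fun I : {set 'I_m} => centerpoint (x \o rep) I).
pose A0 := ~: \bigcup_(C <- cs) C.
exists cs, A0, [seq zz Z | Z <- enum {set 'I_m}]; split => //.
  rewrite size_map -cardE -cardsT -powersetT card_powerset cardsT card_ord.
  by rewrite leq_exp2l.
move=> i hi.
have P0 : 0 < #|P|%:R :> R by rewrite ltr0n (leq_trans t0).
have r0 : 0 < r by lra.
have hP : 0 < (hits i setT)%:R :> R by have := lt_le_trans P0 hi; rewrite pmulr_rgt0.
(* Half of the hits lie in the leftover, which has at most an eighth of the points: the density
   there is at least four times as large. *)
have [h0|h0] := leP ((hits i setT)%:R : R) (2 * (hits i A0)%:R).
  apply: Or31; have hA0 : 0 < (hits i A0)%:R :> R by lra.
  split; first by move: hA0; rewrite ltr0n => /leq_trans; apply; exact: hits_le.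
  have : 8 * #|A0|%:R <= #|P|%:R :> R by rewrite -natrM ler_nat.
  have : r * (hits i setT)%:R <= r * (2 * (hits i A0)%:R) by rewrite ler_pM2l.
  lra.
apply: contrapT => H.
have nz I : ~ K i (zz I).
  by move=> Kz; apply: H; apply: Or33; exists (zz I) => //; apply: map_f; rewrite mem_enum.
set r' := r * (4 * (d.+2 * kap)%:R / t%:R) in H.
have t0' : 0 < t%:R :> R by rewrite ltr0n.
have r'0 : 0 < r' by rewrite mulr_gt0// divr_gt0// mulr_gt0// ltr0n muln_gt0 kap0.
have thin l : r' * (hits i (nc l))%:R <= k0%:R.
  rewrite leNgt; apply/negP => lt; apply: H; apply: Or32; exists (nc l).
  by rewrite csk//; split => //; exact: ltW.
pose I := [set l | (0 < hits i (nc l))%N].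
have sum_hits : (hits i setT <= hits i A0 + \sum_l hits i (nc l))%N.
  have -> : setT = A0 :|: \bigcup_(C <- cs) C by rewrite setUC setUCr.
  apply: leq_trans (hitsU _ _ _) _; rewrite leq_add2l (big_nth set0) big_mkord.
  elim/big_rec2: _ => [|l a U _ h]; first by rewrite leqn0 cards_eq0; apply/eqP/setP => p; rewrite !inE.
  by apply: leq_trans (hitsU _ _ _) _; rewrite leq_add2l.
have sumI : r' * (\sum_l hits i (nc l))%:R <= #|I|%:R * k0%:R.
  rewrite natr_sum mulr_sumr (bigID (mem I)) /= [X in _ + X]big1 ?addr0; last first.
    by move=> l; rewrite inE -leqNgt leqn0 => /eqP ->; rewrite mulr0.
  by apply: le_trans (ler_sum _ (fun l _ => thin l)) _; rewrite sumr_const mulr_natl.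
(* At least half of the hits lie in classes, each of them sparsely hit, so many classes must be
   hit. *)
have bigI : (d.+2 * kap <= #|I|)%N.
  have s1 : (hits i setT)%:R <= (hits i A0)%:R + (\sum_l hits i (nc l))%:R :> R.
    by rewrite -natrD ler_nat.
  have s2 : (hits i setT)%:R <= 2 * (\sum_l hits i (nc l))%:R :> R by lra.
  have s3 : r' * (hits i setT)%:R <= 2 * (#|I|%:R * k0%:R).
    by apply: le_trans (_ : r' * (2 * (\sum_l hits i (nc l))%:R) <= _); [rewrite ler_pM2l|lra].
  have s4 : (4 * (d.+2 * kap)%:R / t%:R) * #|P|%:R <= 2 * (#|I|%:R * k0%:R) :> R.
    apply: le_trans s3.
    have -> : r' * (hits i setT)%:R = (4 * (d.+2 * kap)%:R / t%:R) * (r * (hits i setT)%:R).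
      by rewrite /r'; ring.
    rewrite ler_pM2l//.
    by rewrite divr_gt0// mulr_gt0// ltr0n muln_gt0 kap0.
  have s5 : t%:R * k0%:R <= 2 * #|P|%:R :> R by rewrite -!natrM ler_nat.
  have s6 : 4 * (d.+2 * kap)%:R * #|P|%:R <= 2 * (#|I|%:R * (t%:R * k0%:R)) :> R.
    by move: s4; rewrite mulrAC ler_pdivrMr//; lra.
  have s7 : #|I|%:R * (t%:R * k0%:R) <= #|I|%:R * (2 * #|P|%:R) :> R by rewrite ler_wpM2l.
  have s8 : 4 * (d.+2 * kap)%:R * #|P|%:R <= 4 * #|I|%:R * #|P|%:R :> R by lra.
  by move: s8; rewrite ler_pM2r// ler_pM2l// ler_nat.
have K0 : (K i !=set0)%classic.
  have : (0 < hits i setT)%N by move: hP; rewrite ltr0n.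
  by move=> /hits_gt0[p _ Kp]; exists (x p).
(* If the centerpoint of the representatives of [I] is outside [K i], a hyperplane separates them.
   More than [kap] classes have their representative on the far side and a point of [K i] on the
   near side, so it splits too many classes. *)
have [h [ah hK hz]] := separation_avoiding x (@Kcvx i) (@Kcpt i) K0 (nz I).
pose B := [set l in I | ev h (x (rep l)) < 0].
have BI : B \subset I by apply/subsetP => l; rewrite inE => /andP[].
have big : (#|I| <= d.+1 * #|I :\: B|)%N.
  rewrite leqNgt; apply/negP => lt; have := hzz I B BI lt (fun y => ev h y <= 0) (cvx_ev_le (h := h)).
  have hB j : j \in B -> ev h ((x \o rep) j) <= 0 by rewrite inE => /andP[_ /ltW].
  by move=> /(_ hB); lra.
have lt : (kap < #|I :\: B|)%N by move: bigI big kap0; clear; nia.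
have := leq_ltn_trans (csh h ah) lt; rewrite ltnNge => /negP; apply.
rewrite -sum1_count (big_nth set0) big_mkord -sum1_card big_mkcond [leqRHS]big_mkcond /=.
apply: leq_sum => l _; case: ifPn => //; rewrite !inE negb_and => /andP[nB lI].
have -> // : splits x h (nth set0 cs l).
rewrite lI /= -leNgt in nB; apply/andP; split; apply/exists_inP.
  by exists (rep l); rewrite ?hrep// lt_def nB ah.
by have [p pC Kp] := hits_gt0 lI; exists p => //; exact: hK.
Qed.
End Step.
End WeakNets.

Section NetRecursion.
Context {R : realType} {d : nat} {T : finType}.
Variable K : T -> set 'rV[R]_d.
Hypotheses (Kcvx : forall i, cvx (K i)) (Kcpt : forall i, compact (K i)).
Context {P : finType}.
Variable x : P -> 'rV[R]_d.
Implicit Types A C : {set P}.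

Lemma hits_sub A (i : T) (C : {set {p | p \in A}}) :
  hits K (x \o val) i C = hits K x i (val @: C).
Proof.
rewrite /hits -(card_imset _ val_inj); apply: eq_card => p; apply/imsetP/idP.
  by move=> [q + ->]; rewrite !inE /= => /andP[qC ->]; rewrite imset_f.
by rewrite inE => /andP[/imsetP[q qC ->] Kq]; exists q; rewrite // inE qC.
Qed.

Lemma net_step (t kap : nat) (r : R) A : (0 < t)%N -> (0 < kap)%N ->
  partitionable (R := R) (d := d) t kap -> 1 <= r -> (t <= #|A|)%N ->
  exists (cs : seq {set P}) A0 (zs : seq 'rV[R]_d),
   [/\ (size cs <= t)%N, (size zs <= 2 ^ t)%N &
     forall i, #|A|%:R <= r * (hits K x i A)%:R ->
       [\/ (0 < #|A0|)%N /\ #|A0|%:R <= r / 4 * (hits K x i A0)%:R,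
           exists C, [/\ C \in cs, (0 < #|C|)%N &
              #|C|%:R <= r * (4 * (d.+2 * kap)%:R / t%:R) * (hits K x i C)%:R] |
           exists2 z, z \in zs & K i z] ].
Proof.
move=> t0 k0 part r1 tA.
have [|cs [A0 [zs [scs szs h]]]] :=
    net_step_full Kcvx Kcpt (x \o val : {p | p \in A} -> 'rV[R]_d) t0 k0 part r1 _.
  by rewrite card_sig.
pose im (B : {set {p | p \in A}}) : {set P} := val @: B.
exists (map im cs), (im A0), zs; split => //.
  by rewrite size_map.
have cv B : #|im B| = #|B| by rewrite card_imset//; exact: val_inj.
move=> i hi; have [||[C [Ccs C0 hC]]|z] := h i.
- rewrite hits_sub card_sig; have -> // : val @: [set: {p | p \in A}] = A.
  apply/setP => p; apply/imsetP/idP => [[q _ ->]|pA]; first exact: valP.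
  by exists (Sub p pA); rewrite ?inE.
- by move=> [A00 hA]; apply: Or31; rewrite cv -hits_sub.
- by apply: Or32; exists (im C); rewrite cv -hits_sub; split => //; exact: map_f.
- exact: Or33.
Qed.

(** Of the budget c r^gam, the leftover takes a quarter, the classes together another quarter, and
    the centerpoints a half. Both recursive parameters r / 4 and r th are at most r / 2, hence the
    induction on j. For r < 1 no set can be rich and the empty net serves. *)
Theorem weak_net_rec (t kap : nat) (gam c : R) (th := (4 * (d.+2 * kap)%:R / t%:R : R)) :
  (0 < t)%N -> (0 < kap)%N -> partitionable (R := R) (d := d) t kap -> 1 <= gam ->
  th <= 2^-1 -> t%:R * th `^ gam <= 4^-1 -> (2 ^ t.+1)%:R <= c ->
  forall (j : nat) (r : R) A, 0 < r -> r < 2 ^+ j -> exists2 N : seq 'rV[R]_d,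
    (size N)%:R <= c * r `^ gam &
    forall i, (0 < #|A|)%N -> #|A|%:R <= r * (hits K x i A)%:R -> exists2 z, z \in N & K i z.
Proof.
move=> t0 k0 part g1 th2 tth ct; have t0' : 0 < t%:R :> R by rewrite ltr0n.
have th0 : 0 < th by rewrite divr_gt0// mulr_gt0// ltr0n muln_gt0 k0.
have c0 : 0 < c by apply: lt_le_trans ct; rewrite ltr0n expn_gt0.
have small r A : 0 < r -> r < 1 -> exists2 N : seq 'rV[R]_d, (size N)%:R <= c * r `^ gam &
    forall i, (0 < #|A|)%N -> #|A|%:R <= r * (hits K x i A)%:R -> exists2 z, z \in N & K i z.
  move=> r0 r1; exists [::]; first by rewrite mulr_ge0 ?powR_ge0// ltW.
  move=> i A0 hA; have : (hits K x i A)%:R <= #|A|%:R :> R by rewrite ler_nat hits_le.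
  have : 0 < #|A|%:R :> R by rewrite ltr0n.
  by move: hA; move: (_%:R : R) #|A|%:R => u v; nra.
elim=> [|j IH] r A r0 rj; first by apply: small => //; rewrite expr0 in rj.
have [r1|r1] := ltP r 1; first exact: small.
have rg1 : 1 <= r `^ gam by rewrite -(powRr0 r); apply: ler_powR => //; exact: le_trans ler01 g1.
have [tA|At] := leqP t #|A|; last first.
  exists [seq x p | p <- enum A].
    rewrite size_map -cardE; apply: le_trans (_ : c <= _); last by rewrite ler_peMr// ltW.
    apply: le_trans ct; rewrite ler_nat; apply: leq_trans (ltnW At) _.
    by apply: ltnW; apply: leq_trans (ltn_expl t (isT : (1 < 2)%N)) _; rewrite leq_exp2l.
  move=> i A0 hA; have : (0 < hits K x i A)%N.
    rewrite lt0n; apply/eqP => e; move: hA; rewrite e mulr0 lern0.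
    by move/eqP => e0; rewrite e0 in A0.
  by move=> /hits_gt0[p pA Kp]; exists (x p) => //; apply: map_f; rewrite mem_enum.
have [cs [A0 [zs [scs szs h]]]] := net_step t0 k0 part r1 tA.
have r40 : 0 < r / 4 by rewrite divr_gt0.
have r4j : r / 4 < 2 ^+ j by move: rj; rewrite exprS; have : 0 < (2 : R) ^+ j by []; lra.
have rth0 : 0 < r * th by rewrite mulr_gt0.
have rthj : r * th < 2 ^+ j.
  apply: le_lt_trans (_ : r * 2^-1 < _); first by rewrite ler_pM2l.
  by move: rj; rewrite exprS; lra.
have [N0 sN0 hN0] := IH (r / 4) A0 r40 r4j.
have exN C : exists N : seq 'rV[R]_d, (size N)%:R <= c * (r * th) `^ gam /\
    forall i, (0 < #|C|)%N -> #|C|%:R <= r * th * (hits K x i C)%:R -> exists2 z, z \in N & K i z.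
  by have [N ? ?] := IH (r * th) C rth0 rthj; exists N.
have [NC hNC] := choice exN.
exists (N0 ++ flatten [seq NC C | C <- cs] ++ zs); last first.
  move=> i _ /h[[A00 hA]|[C [Ccs C0 hC]]|[z zzs Kz]].
  - by have [z zN Kz] := hN0 i A00 hA; exists z => //; rewrite mem_cat zN.
  - have [_ hC'] := hNC C; have [z zN Kz] := hC' i C0 hC.
    exists z => //; rewrite !mem_cat; apply/orP; right; apply/orP; left.
    by apply/flattenP; exists (NC C) => //; exact: map_f.
  - by exists z => //; rewrite !mem_cat zzs !orbT.
have sfl : (size (flatten [seq NC C | C <- cs]))%:R <= t%:R * (c * (r * th) `^ gam).
  apply: le_trans (_ : (size cs)%:R * (c * (r * th) `^ gam) <= _); last first.
    by rewrite ler_wpM2r ?ler_nat// mulr_ge0 ?powR_ge0// ltW.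
  elim: cs {scs h} => [|C cs IHc]; first by rewrite mul0r.
  rewrite /= size_cat natrD -natr1 mulrDl mul1r addrC lerD//.
  by have [] := hNC C.
rewrite !size_cat !natrD.
have e1 : (r / 4) `^ gam <= 4^-1 * r `^ gam.
  rewrite mulrC powRM ?(ltW r0)// ?invr_ge0// ler_wpM2r ?powR_ge0//.
  by apply: ge1r_powR => //; rewrite invr_gt0 ltr0n /= invf_le1 ?ler1n// ltr0n.
have e2 : t%:R * (c * (r * th) `^ gam) <= 4^-1 * (c * r `^ gam).
  rewrite powRM ?(ltW r0) ?(ltW th0)//.
  have -> : t%:R * (c * (r `^ gam * th `^ gam)) = (t%:R * th `^ gam) * (c * r `^ gam) by ring.
  by rewrite ler_wpM2r// mulr_ge0 ?powR_ge0// ltW.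
have e3 : (size zs)%:R <= 2^-1 * (c * r `^ gam).
  apply: le_trans (_ : 2^-1 * c <= _); last by rewrite ler_pM2l ?invr_gt0// ler_peMr// ltW.
  have : (size zs)%:R <= (2 ^ t)%:R :> R by rewrite ler_nat.
  by move: ct; rewrite expnS natrM; lra.
have e4 : (size N0)%:R <= 4^-1 * (c * r `^ gam).
  apply: le_trans sN0 _; have := ler_wpM2l (ltW c0) e1; lra.
by lra.
Qed.

End NetRecursion.

(** * Choice of the numerical parameters *)

Section NetParameters.

Lemma poly_lt_exp2 c k : exists j0, forall j, (j0 <= j)%N -> (c * j ^ k < 2 ^ j)%N.
Proof.
exists (c * k.+1 ^ k.+1).+1 => j hj.
have j0 : (0 < j)%N by apply: leq_trans hj.
have lo : (j ^ k.+1 <= k.+1 ^ k.+1 * 2 ^ j)%N.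
  apply: (@leq_trans ((k.+1 * 2 ^ (j %/ k.+1)) ^ k.+1)).
    apply: leq_expW; have := divn_eq j k.+1; have := ltn_pmod j (ltn0Sn k).
    have := ltn_expl (j %/ k.+1) (isT : (1 < 2)%N); move: (2 ^ (j %/ k.+1))%N (j %/ k.+1)%N (j %% k.+1)%N => a b e.
    by clear; nia.
  by rewrite expnMn leq_mul2l -expnM leq_exp2l// leq_trunc_div orbT.
have K0 : (0 < k.+1 ^ k.+1)%N by rewrite expn_gt0.
rewrite -(ltn_pmul2l K0); apply: leq_trans lo; rewrite [(j ^ _.+1)%N]expnS mulnA ltn_pmul2r.
  by rewrite mulnC.
by rewrite expn_gt0 j0.
Qed.

(** By Bernoulli's inequality 2u factors 2u / (2u - 1) multiply to at least 2, and g - D consists of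
    l such blocks. *)
Lemma cut_condition u l g D N : (0 < u)%N -> (g = 2 * u * l + D)%N -> (g ^ D * N < 2 ^ l)%N ->
  ('C(g, D) * N * (2 * u - 1) ^ (g - D) < (2 * u) ^ (g - D))%N.
Proof.
move=> u0 eg hg; have -> : (g - D = 2 * u * l)%N by rewrite eg addnK.
have : (0 < 2 * u)%N by nlia.
move: (2 * u)%N => [//|w] _; rewrite subSS subn0.
have bern n : (w ^ n.+1 + n.+1 * w ^ n <= w.+1 ^ n.+1)%N.
  elim: n => [|n IH]; first by rewrite !expn1 expn0; nlia.
  rewrite [leqRHS]expnS; apply: leq_trans (leq_mul (leqnn w.+1) IH); rewrite [(w ^ n.+2)%N]expnS [(w ^ n.+1)%N]expnS.
  by move: (w ^ n)%N => a; clear; nia.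
have two : (2 * w ^ w.+1 <= w.+1 ^ w.+1)%N.
  by apply: leq_trans (bern w); rewrite expnS; move: (w ^ w)%N => a; clear; nia.
have X2 : ('C(g, D) * N < 2 ^ l)%N.
  by apply: leq_ltn_trans hg; rewrite leq_mul2r leq_bin_expn orbT.
have le : (2 ^ l * w ^ (w.+1 * l) <= w.+1 ^ (w.+1 * l))%N.
  by rewrite !expnM -expnMn; exact: leq_expW.
have [z|p] := posnP (w ^ (w.+1 * l))%N; first by rewrite z muln0 expn_gt0.
by apply: leq_trans le; rewrite ltn_pmul2r.
Qed.

(** From (1 + 1/u)^n <= u / (u - n). *)
Lemma succ_expn_double u e : (2 * e <= u)%N -> (u.+1 ^ e <= 2 * u ^ e)%N.
Proof.
move=> eu; have key n : (n <= u)%N -> (u.+1 ^ n * (u - n) <= u ^ n * u)%N.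
  elim: n => [|n IH] nu; first by rewrite !expn0 subn0.
  rewrite !expnS; have := IH (ltnW nu); move: nu; clear.
  move: (u.+1 ^ n)%N (u ^ n)%N => a b nu h.
  have h2 : (u.+1 * (u - n.+1) <= u * (u - n))%N by nia.
  apply: (@leq_trans (a * (u * (u - n)))); first by rewrite mulnAC mulnC leq_mul2l h2 orbT.
  by rewrite mulnCA -mulnA leq_mul2l h orbT.
have [u0|u0] := posnP u.
  have -> : e = 0%N by nlia.
  by rewrite !expn0.
have eu' : (e <= u)%N by nlia.
have := key e eu'; move: eu u0; move: (u.+1 ^ e)%N (u ^ e)%N => a b; clear; nia.
Qed.

Context {R : realType} {d : nat}.

(** With u = 2^j, a cutting from order j u samples has order (j u)^d cells, which determines t. The
    crossing number has order t / u: up to powers of j this is t^(1 - 1/d), the source of the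
    exponent d of the nets. The summand [c4 * j] is the logarithm of the size of the test set. *)
Lemma partitionable_params : (0 < d)%N -> exists c5 c6 j0 : nat, forall j, (j0 <= j)%N ->
  exists t kap, [/\ (0 < t)%N, (0 < kap)%N, partitionable (R := R) (d := d) t kap,
     (4 * (d.+2 * kap) * 2 ^ j <= c5 * t)%N & (t <= c6 * (j * 2 ^ j) ^ d)%N].
Proof.
move=> d0.
pose D1 := (d.+1 * d.+1)%N; pose N1 := flag_bound (k := d) D1.
pose c := (2 * (2 * D1) + D1)%N; pose c1 := ((c + d * 2) * d.+1 * 2).+1.
pose D2 := ((d + 1).+1 * (d + 1).+1)%N; pose N2 := flag_bound (k := d + 1) D2.
pose b := (d.+2 * D2)%N; pose c2 := (2 * b + D2)%N.
pose c3 := ((c2 + (d + 1) * 2) * (d + 1).+1 * 2).+1.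
pose c4 := (d.+1 * (d + 1)).+1.
(* The four thresholds serve, in this order, the condition of the primal cutting,
   [t.+1 <= u ^ d.+1], the condition of the dual cutting, and the size of the test set. *)
have [j1 E1] := poly_lt_exp2 (c ^ D1 * N1) D1.
have [j2 E2] := poly_lt_exp2 (8 * c1 ^ d) d.
have [j3 E3] := poly_lt_exp2 (c2 ^ D2 * N2) D2.
have [j4 E4] := poly_lt_exp2 (c3 ^ (d + 1) * (d + 1).+1 * 2) (d + 1).
exists (4 * (d.+2 * ((d + 1).+1 * 2 * (c4 + 2))))%N, (8 * c1 ^ d)%N, (j1 + j2 + j3 + j4 + 1)%N => j hj.
have {}E1 := E1 j ltac:(by nlia); have {}E2 := E2 j ltac:(by nlia).
have {}E3 := E3 j ltac:(by nlia); have {}E4 := E4 j ltac:(by nlia).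
have j0 : (0 < j)%N by nlia.
pose u := (2 ^ j)%N; have u0 : (0 < u)%N by rewrite expn_gt0.
pose t := (8 * (c1 * (j * u)) ^ d)%N.
pose s := (16 * (c1 * j) ^ d * u ^ d.-1)%N.
have ts : (t = 2 ^ j.-1 * s)%N.
  have eu : u = (2 * 2 ^ j.-1)%N by rewrite /u -expnS prednK.
  have ed : (u ^ d = u * u ^ d.-1)%N by rewrite -expnS prednK.
  by rewrite /t /s mulnA expnMn ed {1}eu; ring.
have t0 : (0 < t)%N by rewrite /t muln_gt0 expn_gt0 !muln_gt0 j0 u0.
pose g1 := (2 * u * (2 * D1 * j) + D1)%N.
have ar (n y g e : nat) : (g <= e * y)%N -> (0 < y)%N ->
    (((g + n * 2) * n.+1 * 2).+1 <= ((e + n * 2) * n.+1 * 2).+1 * y)%N.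
  by clear; nia.
have ju1 : (0 < j * u)%N by rewrite muln_gt0 j0.
have g1c : (g1 <= c * (j * u))%N by rewrite /g1 /c; move: ju1; clear; nia.
have N1t : (8 * flag_bound (k := d) g1 <= t)%N.
  by rewrite leq_mul2l /=; apply: leq_expW; exact: ar g1c ju1.
have hn1 : (g1 ^ D1 * N1 < 2 ^ (2 * D1 * j))%N.
  apply: (@leq_ltn_trans (c ^ D1 * N1 * j ^ D1 * u ^ D1)).
    apply: (@leq_trans ((c * (j * u)) ^ D1 * N1)); first by rewrite leq_mul2r leq_expW ?orbT.
    by rewrite !expnMn; apply/eq_leq; ring.
  have -> : (2 ^ (2 * D1 * j) = u ^ D1 * u ^ D1)%N by rewrite /u -!expnM -expnD; congr expn; ring.
  rewrite ltn_pmul2r ?expn_gt0 ?u0//; apply: leq_trans E1 _.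
  by rewrite -/u -[X in (X <= _)%N]expn1 leq_pexp2l.
have tu : (t.+1 <= u ^ d.+1)%N.
  rewrite /t; apply: (@leq_trans (2 ^ j * u ^ d)); last by rewrite expnS.
  by rewrite !expnMn mulnA mulnA ltn_pmul2r ?expn_gt0 ?u0// -mulnA.
pose g2 := (2 * t.+1 * (b * j) + D2)%N.
have jud : (0 < j * u ^ d.+1)%N by rewrite muln_gt0 j0 expn_gt0 u0.
have g2c : (g2 <= c2 * (j * u ^ d.+1))%N.
  rewrite /g2 /c2 mulnDl; apply: leq_add; last by rewrite leq_pmulr.
  have -> : (2 * b * (j * u ^ d.+1) = 2 * u ^ d.+1 * (b * j))%N by ring.
  by rewrite leq_mul2r leq_mul2l tu !orbT.
have hn2 : (g2 ^ D2 * N2 < 2 ^ (b * j))%N.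
  apply: (@leq_ltn_trans (c2 ^ D2 * N2 * j ^ D2 * (u ^ d.+1) ^ D2)).
    apply: (@leq_trans ((c2 * (j * u ^ d.+1)) ^ D2 * N2)); first by rewrite leq_mul2r leq_expW ?orbT.
    by rewrite !expnMn; apply/eq_leq; ring.
  have -> : (2 ^ (b * j) = u ^ D2 * (u ^ d.+1) ^ D2)%N.
    by rewrite /u -!expnM -expnD /b; congr expn; ring.
  rewrite ltn_pmul2r ?expn_gt0 ?u0//; apply: leq_trans E3 _.
  by rewrite -/u -[X in (X <= _)%N]expn1 leq_pexp2l.
pose m := (flag_bound (k := d + 1) g2 * (d + 1).+1 * 2)%N.
have hm : (m < 2 ^ (c4 * j))%N.
  apply: (@leq_ltn_trans ((c3 * (j * u ^ d.+1)) ^ (d + 1) * (d + 1).+1 * 2)).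
    rewrite /m !leq_mul2r /=; apply: leq_expW.
    exact: ar g2c jud.
  have -> : ((c3 * (j * u ^ d.+1)) ^ (d + 1) * (d + 1).+1 * 2 =
      c3 ^ (d + 1) * (d + 1).+1 * 2 * j ^ (d + 1) * (u ^ d.+1) ^ (d + 1))%N.
    by rewrite !expnMn; ring.
  have -> : (2 ^ (c4 * j) = 2 ^ j * (u ^ d.+1) ^ (d + 1))%N.
    by rewrite /u -!expnM -expnD /c4; congr expn; ring.
  have ue : (0 < (u ^ d.+1) ^ (d + 1))%N by rewrite expn_gt0 expn_gt0 u0.
  by rewrite ltn_pmul2r.
pose kap' := (c4 * j + s)%N.
have hk : (m * u.+1 ^ t < 2 ^ kap'.+1 * u ^ t)%N.
  apply: (@leq_trans (2 ^ (c4 * j) * u.+1 ^ t)); first by rewrite ltn_pmul2r ?expn_gt0.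
  have -> : (2 ^ kap'.+1 * u ^ t = 2 * (2 ^ (c4 * j) * (2 ^ s * u ^ t)))%N.
    by rewrite [in LHS]expnS /kap' expnD; ring.
  apply: (@leq_trans (2 ^ (c4 * j) * (2 ^ s * u ^ t))); last by rewrite leq_pmull.
  rewrite leq_mul2l; apply/orP; right; rewrite ts (expnM u.+1 _ s) (expnM u _ s) -expnMn; apply: leq_expW.
  by apply: succ_expn_double; rewrite -expnS prednK.
exists t, ((d + 1).+1 * 2 * kap')%N; split => //.
- by rewrite !muln_gt0 addn_gt0 muln_gt0 j0.
- move=> P x tP; apply: (@partition_theorem R d P x g1 u g2 t kap') => //.
  + by rewrite t0.
  + exact: leq_addl.
  + exact: leq_addl.
  + exact: cut_condition hn1.
  + by apply: cut_condition hn2.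
- have e1 : (j * 2 ^ j <= t)%N.
    rewrite /t -/u; apply: (@leq_trans ((j * u) ^ d)).
      by rewrite -[X in (X <= _)%N]expn1 leq_pexp2l.
    by rewrite [((c1 * _) ^ d)%N]expnMn mulnA leq_pmull// muln_gt0 expn_gt0.
  have e2 : (s * 2 ^ j = 2 * t)%N by rewrite ts -{1}(prednK j0) expnS; ring.
  have e3 : (kap' * 2 ^ j <= (c4 + 2) * t)%N.
    by rewrite /kap' mulnDl e2 mulnDl leq_add2r -mulnA leq_mul2l e1 orbT.
  have -> : (4 * (d.+2 * ((d + 1).+1 * 2 * kap')) * 2 ^ j = 4 * (d.+2 * ((d + 1).+1 * 2)) * (kap' * 2 ^ j))%N by ring.
  by apply: leq_trans (leq_mul (leqnn _) e3) _; apply/eq_leq; ring.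
- by rewrite /t expnMn mulnA -/u.
Qed.

End NetParameters.

(** * Piercing numbers from weak epsilon-nets *)

Section AlonKleitman.
Context {R : realType} {d : nat}.

Lemma nat_above (a : R) : exists n : nat, a <= n%:R.
Proof. by exists (Num.truncn `|a|).+1; rewrite (le_trans (ler_norm a))// ltW// truncnS_gt. Qed.

(** Up to constants t th^gam is at most j^d 2^(-j (gam - d)), so one large j, fixed once for all,
    meets the hypotheses of [weak_net_rec]. *)
Theorem weak_net (gam : R) : (0 < d)%N -> d%:R < gam -> exists2 c : R, 0 < c &
  forall (T : finType) (K : T -> set 'rV[R]_d) (P : finType) (x : P -> 'rV[R]_d) (r : R),
    (forall i, cvx (K i)) -> (forall i, compact (K i)) -> 0 < r -> (0 < #|P|)%N ->
    exists2 N : seq 'rV[R]_d, (size N)%:R <= c * r `^ gam &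
      forall i, #|P|%:R <= r * (hits K x i setT)%:R -> exists2 z, z \in N & K i z.
Proof.
move=> d0 dgam; have [c5 [c6 [j0 hpar]]] := @partitionable_params R d d0.
pose dl := gam - d%:R; have dl0 : 0 < dl by rewrite subr_gt0.
have gam0 : 0 < gam by apply: le_lt_trans dgam.
have gam1 : 1 <= gam by apply: le_trans (ltW dgam); rewrite ler1n.
have [q0 hq0] := nat_above dl^-1; pose q := q0.+1.
have hq : 1 <= q%:R * dl.
  rewrite -ler_pdivrMr// div1r; apply: le_trans hq0 _; by rewrite ler_nat.
have [nb hnb] := nat_above (4 * c6%:R * q%:R ^+ d * c5%:R `^ gam).
have [i0 hi0] := poly_lt_exp2 nb d; have [i1 hi1] := poly_lt_exp2 (2 * c5) 0.
(* As q (gam - d) >= 1, the decay 2^(-j (gam - d)) is at most 2^(-i), which beats a polynomial in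
   i. *)
pose i := (i0 + i1 + j0)%N; pose j := (q * i)%N.
have ij : (i <= j)%N by rewrite leq_pmull.
have [|t [kap [t0 k0 part hth ht]]] := hpar j; first by apply: leq_trans ij; rewrite leq_addl.
pose U : R := 2 ^+ j; have U0 : 0 < U by rewrite exprn_gt0.
have t0' : 0 < t%:R :> R by rewrite ltr0n.
pose th : R := 4 * (d.+2 * kap)%:R / t%:R.
have thU : th <= c5%:R * U^-1.
  rewrite ler_pdivrMr// mulrAC ler_pdivlMr//.
  by rewrite /U -(natrX _ 2 j) -!natrM ler_nat.
have th0 : 0 <= th by rewrite divr_ge0// mulr_ge0.
have th2 : th <= 2^-1.
  apply: le_trans thU _; rewrite ler_pdivrMr// mulrC ler_pdivlMr// mulrC.
  have := hi1 j; rewrite expn0 muln1 => /(_ (leq_trans (leq_trans (leq_addl _ _) (leq_addr _ _)) ij)).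
  by move=> /ltnW; rewrite -(ler_nat R) natrM natrX.
have tth : t%:R * th `^ gam <= 4^-1.
  have h1 : th `^ gam <= c5%:R `^ gam * (U^-1) `^ gam.
    rewrite -powRM ?invr_ge0 ?(ltW U0)//; apply: ge0_ler_powR => //; rewrite ?nnegrE ?(ltW gam0)//.
    by rewrite mulr_ge0// invr_ge0 ltW.
  have h2 : (U^-1) `^ gam = (U^-1) ^+ d * (U^-1) `^ dl.
    rewrite -powR_mulrn ?invr_ge0 ?(ltW U0)// -powRD; last first.
      by apply/implyP => _; rewrite invr_eq0 gt_eqF.
    by congr powR; rewrite /dl; lra.
  have h3 : (U^-1) `^ dl <= (2^-1) ^+ i.
    rewrite /U -exprVn -powR_mulrn ?invr_ge0// -powRrM -[leRHS]powR_mulrn ?invr_ge0//.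
    apply: ger_powR; first by rewrite invr_gt0 ltr0n /= invf_le1 ?ler1n// ltr0n.
    rewrite /j natrM mulrAC -[leLHS]mul1r; apply: ler_wpM2r => //.
  have h4 : t%:R <= c6%:R * (j%:R ^+ d * U ^+ d).
    by rewrite /U -(natrX _ 2 j) -!natrX -natrM -expnMn -natrM ler_nat.
  have c5p := powR_ge0 (c5%:R : R) gam.
  apply: le_trans (_ : c6%:R * (j%:R ^+ d * U ^+ d) * (c5%:R `^ gam * ((U^-1) ^+ d * (2^-1) ^+ i)) <= _).
    apply: ler_pM => //; first exact: powR_ge0.
    apply: le_trans h1 _; rewrite ler_wpM2l// h2 ler_wpM2l// exprn_ge0// invr_ge0 ltW//.
  have -> : c6%:R * (j%:R ^+ d * U ^+ d) * (c5%:R `^ gam * ((U^-1) ^+ d * (2^-1) ^+ i)) =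
      (c6%:R * q%:R ^+ d * c5%:R `^ gam) * i%:R ^+ d * (2^-1) ^+ i :> R.
    have -> : (U^-1) ^+ d = (U ^+ d)^-1 by rewrite exprVn.
    rewrite /j natrM exprMn; field; by rewrite expf_neq0// gt_eqF.
  have -> : (2^-1 : R) ^+ i = (2 ^+ i)^-1 by rewrite exprVn.
  rewrite ler_pdivrMr ?exprn_gt0//.
  have : (nb * i ^ d)%:R <= (2 ^ i)%:R :> R.
    by rewrite ler_nat ltnW// hi0// /i -addnA leq_addr.
  rewrite natrM natrX natrX => h5.
  have : 4 * c6%:R * q%:R ^+ d * c5%:R `^ gam * i%:R ^+ d <= nb%:R * i%:R ^+ d :> R.
    by rewrite ler_wpM2r// exprn_ge0.
  lra.
exists (2 ^ t.+1)%:R; first by rewrite ltr0n expn_gt0.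
move=> T K P x r Kcvx Kcpt r0 P0; have [n hn] := nat_above r.
have rn : r < 2 ^+ n.
  by apply: le_lt_trans hn _; rewrite -natrX ltr_nat ltn_expl.
have [N sN hN] := @weak_net_rec R d T K Kcvx Kcpt P x t kap gam _ t0 k0 part gam1 th2 tth (lexx _) n r setT r0 rn.
by exists N => // l hl; apply: hN; rewrite cardsT.
Qed.

Lemma hits_miss (T : finType) (K : T -> set 'rV[R]_d) (i : T) (s : seq 'rV[R]_d) :
  (hits K (fun l : 'I_(size s) => nth 0%R s l) i setT + miss K i s = size s)%N.
Proof.
rewrite -[RHS](count_predC (fun y => `[< K i y >]) s); congr (_ + _)%N.
rewrite -sum1_count (big_nth 0) big_mkord /hits -sum1_card; apply: eq_bigl => l.
by rewrite !inE.
Qed.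

Lemma expr_half (x : R) u : 0 <= x -> x <= 1 -> 1 <= u%:R * x -> (1 - x) ^+ u <= 2^-1.
Proof.
move=> x0 x1 ux; have key n : (1 - x) ^+ n * (1 + n%:R * x) <= 1.
  elim: n => [|n IH]; first by rewrite expr0 mul0r addr0 mulr1.
  rewrite exprS; apply: le_trans IH; rewrite -mulrA mulrCA ler_wpM2l ?exprn_ge0 ?subr_ge0//.
  by rewrite -natr1; have : 0 <= n%:R :> R by []; nra.
have p : 0 <= (1 - x) ^+ u by rewrite exprn_ge0// subr_ge0.
have := key u; nra.
Qed.

(** For all large weights [pq_deep] gives a point of relative depth 1 / b0, with b0 of order
    p^(m/(m-d)). Multiplicative weights turn such points into a list of which every member of [A]
    contains a fraction 1 / (2u), u of order b0, and a weak net for the list pierces [A]. *)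
Theorem alon_kleitman (m : nat) (gam : R) : (0 < d)%N -> (d < m)%N -> d%:R < gam ->
  exists2 c : R, 0 < c & forall (T : finType) (K : T -> set 'rV[R]_d) (A : {set T}) p,
    (forall i, (K i !=set0)%classic) -> (forall i, cvx (K i)) -> (forall i, compact (K i)) ->
    (0 < p)%N -> (p <= #|A|)%N -> pq K p m A ->
    exists2 n : nat, n%:R <= c * p%:R `^ (m%:R / (m - d)%:R * gam) & pierced K n A.
Proof.
move=> d0 dm dgam; have [c c0 hnet] := weak_net d0 dgam.
have gam0 : 0 < gam by apply: le_lt_trans dgam.
pose j := (m - d)%N; have j0 : (0 < j)%N by rewrite subn_gt0.
have j0' : 0 < j%:R :> R by rewrite ltr0n.
pose B0 : R := (2 ^ (j + m) * m ^ m)%:R `^ (j%:R^-1).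
have B00 : 0 < B0.
  by rewrite powR_gt0// ltr0n muln_gt0 !expn_gt0 /=; apply/orP; left; apply: leq_ltn_trans dm.
exists (c * (6 * B0) `^ gam); first by rewrite mulr_gt0// powR_gt0// mulr_gt0.
move=> T K A p K0 Kcvx Kcpt p0 pA hpq.
have p0' : 0 < p%:R :> R by rewrite ltr0n.
pose b0 := B0 * p%:R `^ (m%:R / j%:R).
have b00 : 0 < b0 by rewrite mulr_gt0// powR_gt0.
pose BB := (2 ^ (j + m) * (m * p) ^ m)%N.
have b0E : b0 ^+ j = BB%:R.
  rewrite /b0 exprMn -!powR_mulrn ?powR_ge0// -!powRrM mulVf ?gt_eqF// divfK ?gt_eqF//.
  by rewrite powRr1// powR_mulrn// -natrX -natrM /BB expnMn mulnA.
have BB1 : (1 <= BB)%N.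
  by rewrite muln_gt0 !expn_gt0 /= muln_gt0 p0 andbT; apply/orP; left; apply: leq_ltn_trans dm.
have b01 : 1 <= b0.
  by rewrite -(ler_pXn2r j0) ?nnegrE ?(ltW b00)// expr1n b0E ler1n.
pose b := b0^-1; have bp : 0 < b by rewrite invr_gt0.
have b1 : b <= 1 by rewrite invf_le1.
have e2b : 2 - b = 2 * (1 - b / 2) by move: (b) => y; clear; field.
have b20 : 0 <= 2 - b by move: b1; clear; move: (b) => y; lra.
have bh0 : 0 <= b / 2 by rewrite divr_ge0// ltW.
have bh1 : b / 2 <= 1 by move: b1; clear; move: (b) => y; lra.
have bh2 : 0 <= 1 - b / 2 by rewrite subr_ge0.
have deep w : (forall i, i \in A -> (2 * m <= w i)%N) ->
    exists2 x, True & b * (\sum_(i in A) w i)%:R <= (depth K w A x)%:R.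
  move=> hw; have [x hx] := pq_deep K0 Kcvx Kcpt d0 dm p0 pA hpq hw.
  exists x => //; rewrite mulrC ler_pdivrMr// mulrC.
  have r0 : 0 <= b0 * (depth K w A x)%:R by rewrite mulr_ge0// ltW.
  rewrite -(ler_pXn2r j0) ?nnegrE//= exprMn b0E -!natrX -natrM ler_nat.
  exact: hx.
have [u0 hu0] := nat_above (2 * b0); pose u := Num.truncn (3 * b0).
have u3 : u%:R <= 3 * b0 by rewrite truncn_le// mulr_ge0// ltW.
have ub : 2 * b0 <= u%:R.
  have : 3 * b0 < u.+1%:R by rewrite truncnS_gt.
  by rewrite -natr1; lra.
pose n := (u * (2 * #|A|))%N.
have [||s [sn _ hs]] := @multiplicative_weights R d T K A (fun=> True) (2 * m) b _ _ deep n.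
- by rewrite muln_gt0 /=; apply: leq_ltn_trans dm.
- by rewrite -subr_ge0.
have A0 : (0 < #|A|)%N by apply: leq_trans pA.
have hit i : i \in A -> (#|A| <= hits K (fun l : 'I_(size s) => nth 0%R s l) i setT)%N.
  move=> iA; have e := hits_miss K i s; move: e; set h := hits _ _ _ _ => e.
  have hm := hs i iA.
  have e2 : (2 - b) ^+ n <= 2 ^+ n * (2^-1) ^+ (2 * #|A|).
    rewrite e2b exprMn ler_pM2l ?exprn_gt0// /n exprM; apply: lerXn2r.
    - by rewrite nnegrE exprn_ge0.
    - by rewrite nnegrE.
    - apply: expr_half => //.
      by rewrite mulrCA mulrA ler_pdivlMr// mul1r /b mulrC ler_pdivlMr.
  have e3 : #|A|%:R <= 2 ^+ #|A| :> R.
    by rewrite -natrX ler_nat ltnW// ltn_expl.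
  have e4 : (2 ^ miss K i s)%:R * 2 ^+ #|A| <= 2 ^+ n :> R.
    apply: le_trans (_ : 2 ^+ #|A| * (2 ^+ n * (2^-1) ^+ (2 * #|A|)) * 2 ^+ #|A| <= _).
      rewrite ler_pM2r ?exprn_gt0//; apply: le_trans hm _.
      by apply: ler_pM => //; rewrite exprn_ge0.
    rewrite mul2n -addnn exprD exprVn le_eqVlt; apply/orP; left; apply/eqP.
    have : (2 : R) ^+ #|A| != 0 by rewrite expf_neq0.
    by move: (2 ^+ n) (2 ^+ #|A|) => X Y; clear => Y0; field.
  move: e4; rewrite -!natrX -natrM ler_nat -expnD leq_exp2l// => e4.
  by move: e; rewrite sn => e; nlia.
have n0 : (0 < size s)%N.
  rewrite sn /n muln_gt0 muln_gt0 A0 /= andbT lt0n; apply/eqP => z; move: ub; rewrite z; lra.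
have u0' : 0 < u%:R :> R by lra.
have [||N sN hN] := hnet T K 'I_(size s) (fun l => nth 0%R s l) (2 * u%:R) Kcvx Kcpt _ _.
- by rewrite mulr_gt0.
- by rewrite card_ord.
exists (size N).
  apply: le_trans sN _; rewrite -mulrA ler_pM2l//.
  have -> : p%:R `^ (m%:R / (m - d)%:R * gam) = (p%:R `^ (m%:R / j%:R)) `^ gam by rewrite powRrM.
  rewrite -powRM ?powR_ge0//; last by rewrite mulr_ge0// ltW.
  apply: ge0_ler_powR; rewrite ?nnegrE ?(ltW gam0) ?mulr_ge0 ?powR_ge0 ?(ltW u0') ?(ltW B00)//.
  by move: u3; rewrite /b0; lra.
exists N => // i iA; apply: hN; rewrite card_ord.
have := hit i iA; rewrite -(ler_nat R) => hi.
have hh := ler_wpM2l (ltW u0') hi.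
apply: le_trans (_ : u%:R * (2 * #|A|%:R) <= _); first by rewrite sn /n !natrM.
by rewrite mulrCA -mulrA ler_pM2l.
Qed.

End AlonKleitman.

(** * Tight piercing numbers *)

Section Core.
Context {R : realType} {d : nat} {T : finType}.
Variable K : T -> set 'rV[R]_d.
Implicit Types (A G Q S W : {set T}) (p q m n : nat).
Hypotheses (K0 : forall i, (K i !=set0)%classic) (Kcvx : forall i, cvx (K i))
  (Kcpt : forall i, compact (K i)).

(** An intersecting q-tuple of [G :|: S] has at most m members in [S]. *)
Lemma pq_setD p q A S m : S \subset A -> (#|S| <= p)%N -> pq K p q A ->
  (forall Q : {set T}, Q \subset S -> meets K Q -> (#|Q| <= m)%N) ->
  pq K (p - #|S|) (q - m) (A :\: S).
Proof.
move=> SA Sp hpq hS G GAS cG.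
have GS : G :&: S = set0.
  apply/setP => i; rewrite !inE; apply/negP => /andP[/(subsetP GAS)]; rewrite inE.
  by move=> /andP[/negP].
have [||Q [QGS cQ mQ]] := hpq (G :|: S).
- by rewrite subUset SA (subset_trans GAS (subsetDl _ _)).
- by rewrite cardsU GS cards0 subn0 cG subnK.
have cQG : (q - m <= #|Q :&: G|)%N.
  have : (#|Q| <= #|Q :&: G| + #|Q :&: S|)%N.
    by apply: leq_trans (leq_card_setU _ _); rewrite -setIUr (setIidPl QGS).
  have := hS (Q :&: S) (subsetIr _ _) (meetsS (subsetIl _ _) mQ).
  by rewrite cQ; nlia.
have [|Q' [_ Q'Q cQ']] := @subset_card_between _ set0 (Q :&: G) (q - m) (sub0set _).
  by rewrite cards0.
exists Q'; split => //; first exact: subset_trans Q'Q (subsetIr _ _).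
by apply: meetsS mQ; exact: subset_trans Q'Q (subsetIl _ _).
Qed.

Definition disjoint_family S := forall i j, i \in S -> j \in S -> i != j -> ~ meets K [set i; j].

Lemma disjoint_meets S Q : disjoint_family S -> Q \subset S -> meets K Q -> (#|Q| <= 1)%N.
Proof.
move=> dS QS mQ; rewrite leqNgt; apply/negP => /card_gt1P[i [j [iQ jQ ij]]].
apply: (dS i j) => //; try exact: (subsetP QS).
by apply: meetsS mQ; rewrite subUset !sub1set iQ.
Qed.

Lemma pierced_not_disjoint S : ~ disjoint_family S -> pierced K #|S|.-1 S.
Proof.
move=> nd; have [i [j [iS jS ij mij]]] : exists i j, [/\ i \in S, j \in S, i != j & meets K [set i; j]].
  apply: contrapT => H; apply: nd => i j iS jS ij mij; apply: H; by exists i, j.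
have ijS : [set i; j] \subset S by rewrite subUset !sub1set iS.
have := pierced_sub_meets K0 ijS mij; have := subset_leq_card ijS; rewrite cards2 ij => le.
by apply: piercedS => //; nlia.
Qed.

Lemma max_disjoint_exists A : exists S : {set T}, [/\ S \subset A, disjoint_family S &
  forall S' : {set T}, S' \subset A -> disjoint_family S' -> (#|S'| <= #|S|)%N].
Proof.
pose ok S := (S \subset A) && `[< disjoint_family S >].
have ok0 : ok set0 by rewrite /ok sub0set; apply/asboolP => i j; rewrite inE.
have [S /andP[SA /asboolP dS] mS] := arg_maxnP (fun S => #|S|) ok0.
by exists S; split => // S' SA' dS'; apply: mS; rewrite /ok SA' asboolT.
Qed.

Lemma max_meets_exists S : exists (Q : {set T}) x, [/\ Q \subset S, inter K Q x &
  forall Q' : {set T}, Q' \subset S -> meets K Q' -> (#|Q'| <= #|Q|)%N].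
Proof.
pose ok Q := (Q \subset S) && `[< meets K Q >].
have ok0 : ok set0 by rewrite /ok sub0set; apply/asboolP; exists 0 => i; rewrite inE.
have [Q /andP[QS /asboolP[x hx]] mQ] := arg_maxnP (fun Q => #|Q|) ok0.
by exists Q, x; split => // Q' QS' mQ'; apply: mQ; rewrite /ok QS' asboolT.
Qed.

(* In the second case, piercing [S] costs no more than what the removal of [S] takes off
   [p - q]. *)
Lemma sparse_subfamily S m : (forall Q : {set T}, Q \subset S -> meets K Q -> (#|Q| < m)%N) ->
  (exists2 Q : {set T}, Q \subset S & disjoint_family Q /\ (#|S| < #|Q| + m)%N) \/
  exists e, [/\ (e < m)%N, (e <= #|S|)%N, (forall Q : {set T}, Q \subset S -> meets K Q -> (#|Q| <= e)%N) &
     pierced K (#|S| - e) S].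
Proof.
move=> hS; have [Q [x [QS hx mQ]]] := max_meets_exists S.
have Qm : (#|Q| < m)%N by apply: hS => //; exists x.
have cD : #|S :\: Q| = (#|S| - #|Q|)%N by rewrite cardsD (setIidPr QS).
have cQS := subset_leq_card QS.
have [dD|nd] := pselect (disjoint_family (S :\: Q)).
  by left; exists (S :\: Q); rewrite ?subsetDl//; split => //; nlia.
right; exists #|Q|; split => //.
have D1 : (0 < #|S :\: Q|)%N.
  rewrite lt0n; apply/eqP => e; apply: nd => i j.
  by move/eqP: e; rewrite cards_eq0 => /eqP ->; rewrite inE.
(* One point for [Q], and one saved by the intersecting pair outside it. *)
have := piercedU (@pierced_meets _ _ _ K Q (ex_intro _ x hx)) (pierced_not_disjoint nd).
apply: piercedS; first by nlia.
by apply/subsetP => i iS; rewrite !inE iS andbT orbN.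
Qed.

(* Helly within each [s], with the sampled points in the role of a centerpoint. *)
Lemma pierced_transversal k S A : (0 < d)%N -> (d < k)%N ->
  (k ^ d * #|S|)%:R < (1 + (8 * d.+1)%:R^-1 : R) ^+ (k - d) ->
  (forall W : {set T}, W \subset A -> (#|W| <= k)%N -> exists2 s, s \in S & meets K (s |: W)) ->
  pierced K #|S| (S :|: A).
Proof.
move=> d0 dk hnum hW.
have [->|A0] := eqVneq A set0; first by rewrite setU0; exact: pierced_card.
have A1 : (0 < #|A|)%N by rewrite card_gt0.
(* (1 + eta)^e <= 2, so after e L rounds at most #|A| + L of the points miss a given set. With L =
   #|A| + 1 this is less than a fraction 1 / d.+1. *)
pose e := (2 * d.+1)%N; pose eta : R := (2 * e)%:R^-1.
have e0 : 0 < (2 * e)%:R :> R by rewrite ltr0n.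
have eta0 : 0 < eta by rewrite invr_gt0.
have eta1 : eta <= 2^-1 by rewrite lef_pV2 ?posrE// ler_nat /e; nlia.
have eta2 : (8 * d.+1)%:R^-1 = eta / 2.
  by rewrite /eta /e -invfM -natrM; congr (_%:R^-1); ring.
(* Weights this large make n - d at least (1 - eta/2) n. *)
pose M := (k + 4 * d * e)%N.
have deep w : (forall i, i \in A -> (M <= w i)%N) -> exists2 x, (exists2 s, s \in S & K s x) &
    (1 - eta) * (\sum_(i in A) w i)%:R <= (depth K w A x)%:R.
  move=> hw; set n := (\sum_(i in A) w i)%N.
  have Mn : (M <= n)%N.
    by case/card_gt0P: A1 => i iA; rewrite /n (bigD1 i)//= (leq_trans (hw i iA))// leq_addr.
  have [|s [x [sS Ksx]]] := transversal_deep Kcvx Kcpt d0 dk hW (w := w).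
    by apply: leq_trans Mn; rewrite leq_addr.
  rewrite -/n -(ler_nat R) natrX natrM natrX => hdeep.
  exists x; first by exists s.
  rewrite leNgt; apply/negP => lt.
  have n0 : 0 < n%:R :> R.
    by rewrite ltr0n; apply: leq_trans Mn; rewrite /M; nlia.
  have dn : (1 - eta / 2) * n%:R <= (n - d)%:R.
    rewrite natrB; last by apply: leq_trans (leq_trans (ltnW dk) (leq_addr _ _)) Mn.
    rewrite mulrBl mul1r lerD2l lerN2.
    have -> : d%:R = eta / 2 * (4 * d * e)%:R :> R.
      have gen (E D : R) : E != 0 -> D = (2 * E)^-1 / 2 * (4 * D * E) by move=> ?; field.
      have e1 : e%:R != 0 :> R by rewrite pnatr_eq0.
      by rewrite /eta (natrM _ (4 * d)%N e) (natrM _ 4 d) (natrM _ 2 e); exact: gen.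
    by rewrite ler_pM2l ?divr_gt0// ler_nat; apply: leq_trans Mn; rewrite leq_addl.
  have c1 : 0 <= 1 - eta / 2 by lra.
  have c2 : 0 <= 1 - eta by lra.
  have h1 : ((1 - eta / 2) * n%:R) ^+ (k - d) <= (k ^ d * #|S|)%:R * ((1 - eta) * n%:R) ^+ (k - d).
    apply: le_trans (_ : (n - d)%:R ^+ (k - d) <= _).
      by apply: lerXn2r; rewrite ?nnegrE// mulr_ge0.
    apply: le_trans hdeep _; rewrite ler_wpM2l//.
    by apply: lerXn2r; rewrite ?nnegrE ?mulr_ge0// ltW.
  have c3 : 0 < (1 - eta / 2) ^+ (k - d) by rewrite exprn_gt0//; lra.
  have h2 : (1 - eta) * (1 + eta / 2) <= 1 - eta / 2 by nra.
  have h3 : (1 + eta / 2) ^+ (k - d) <= (k ^ d * #|S|)%:R.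
    rewrite -(ler_pM2r c3) -(ler_pM2r (exprn_gt0 (k - d) n0)).
    apply: le_trans (_ : (1 + eta / 2) ^+ (k - d) * ((k ^ d * #|S|)%:R * ((1 - eta) * n%:R) ^+ (k - d)) <= _).
      by rewrite -mulrA -exprMn ler_wpM2l// exprn_ge0//; lra.
    rewrite mulrCA -mulrA ler_wpM2l// -!exprMn.
    apply: lerXn2r; rewrite ?nnegrE.
    - by rewrite !mulr_ge0//; lra.
    - by rewrite mulr_ge0.
    - by rewrite mulrA ler_pM2r// mulrC.
  by move: hnum; rewrite eta2 ltNge h3.
pose L := #|A|.+1; pose n := (e * L)%N.
have [||s [sn sX hs]] := @multiplicative_weights R d T K A (fun x => exists2 s, s \in S & K s x) M (1 - eta) _ _ deep n.
- by rewrite /M addn_gt0; apply/orP; left; nlia.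
- by lra.
have missle i : i \in A -> (d.+1 * miss K i s < n)%N.
  move=> iA; have hi := hs i iA.
  have p2 : (2 - (1 - eta)) ^+ e <= 2.
    have -> : 2 - (1 - eta) = (2 * e).+1%:R / (2 * e)%:R :> R.
      by rewrite -natr1 mulrDl divff ?gt_eqF// mul1r /eta; lra.
    rewrite expr_div_n ler_pdivrMr ?exprn_gt0// -!natrX -natrM ler_nat.
    exact: succ_expn_double.
  have : (2 ^ miss K i s)%:R <= (2 ^ #|A| * 2 ^ L)%:R :> R.
    apply: le_trans hi _; rewrite natrM; apply: ler_pM => //.
    - by apply: exprn_ge0; lra.
    - by rewrite ler_nat ltnW// ltn_expl.
    - rewrite natrX /n exprM; apply: lerXn2r; [|by rewrite nnegrE|exact: p2].
      by rewrite nnegrE; apply: exprn_ge0; lra.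
  rewrite ler_nat -expnD leq_exp2l// => h.
  apply: leq_ltn_trans (leq_mul (leqnn d.+1) h) _; rewrite /n /e /L.
  by move: #|A| => b; clear; nia.
have [sg hsg] : exists sg : 'I_(size s) -> T, forall l, sg l \in S /\ K (sg l) (nth 0%R s l).
  have ex (l : 'I_(size s)) : exists t, t \in S /\ K t (nth 0%R s l).
    by have [t tS Kt] := sX _ (mem_nth 0%R (ltn_ord l)); exists t.
  by have [sg ?] := choice ex; exists sg.
(* [sg] assigns each sampled point to a member of [S] containing it. The sets in [fam t] other than
   [t] miss fewer than 1 / d.+1 of the points assigned to [t], so any d + 1 of them share such a
   point, which lies in [K t]. *)
pose bad i t := [set l | (sg l == t) && ~~ `[< K i (nth 0%R s l) >] ].
pose Ts t := [set l | sg l == t].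
pose fam t := t |: [set i in A | (d.+1 * #|bad i t| < #|Ts t|)%N].
have mfam t : t \in S -> meets K (fam t).
  move=> tS; apply: helly => // Q QF cQ.
  pose Q1 := Q :\ t.
  have Q1P i : i \in Q1 -> (d.+1 * #|bad i t| < #|Ts t|)%N.
    rewrite !inE => /andP[it iQ]; move: (subsetP QF i iQ).
    by rewrite !inE (negPf it) => /andP[].
  have [Q10|/set0Pn[i0 i0Q]] := eqVneq Q1 set0.
    have [y Ky] := K0 t; exists y => i iQ; have [->//|it] := eqVneq i t.
    by have : i \in Q1; [rewrite !inE it|rewrite Q10 inE].
  have [l lT hl] : exists2 l, l \in Ts t & forall i, i \in Q1 -> l \notin bad i t.
    apply: contrapT => H.
    have TU : Ts t \subset \bigcup_(i in Q1) bad i t.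
      apply/subsetP => l lT; apply: contrapT => /negP nl; apply: H; exists l => // i iQ.
      by apply/negP => lb; case/negP: nl; apply/bigcupP; exists i.
    have le : (#|Ts t| <= \sum_(i in Q1) #|bad i t|)%N.
      apply: leq_trans (subset_leq_card TU) _.
      elim/big_rec2: _ => [|i m' U _ h']; first by rewrite cards0.
      by apply: leq_trans (leq_card_setU _ _) _; rewrite leq_add2l.
    have : (d.+1 * #|Ts t| <= #|Q1| * #|Ts t|.-1)%N.
      apply: (@leq_trans (\sum_(i in Q1) #|Ts t|.-1)); last by rewrite sum_nat_const.
      apply: (@leq_trans (\sum_(i in Q1) d.+1 * #|bad i t|)); first by rewrite -big_distrr leq_mul2l le.
      by apply: leq_sum => i /Q1P; case: #|Ts t|.
    have := Q1P _ i0Q; have : (#|Q1| <= d.+1)%N by apply: leq_trans cQ; rewrite subset_leq_card// subD1set.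
    by move: #|Q1| #|Ts t| #|bad i0 t| => a b c; clear; nia.
  move: lT; rewrite inE => /eqP st; have [_ Kst] := hsg l; rewrite st in Kst.
  exists (nth 0%R s l) => i iQ; have [->//|it] := eqVneq i t.
  have := hl i; rewrite !inE it iQ st eqxx /= negbK => /(_ isT) h; exact/asboolP.
have exz t : exists z, t \in S -> inter K (fam t) z.
  by have [tS|n_] := boolP (t \in S); [have [z hz] := mfam t tS; exists z|exists 0].
have [z hz] := choice exz.
exists [seq z t | t <- enum S]; first by rewrite size_map -cardE.
have mz t : t \in S -> z t \in [seq z t | t <- enum S] by move=> tS; apply: map_f; rewrite mem_enum.
move=> i; rewrite inE => /orP[iS|iA]; first by exists (z i); [exact: mz|apply: (hz i iS); rewrite setU11].
apply: contrapT => H.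
(* A set in no [fam t] misses at least 1 / d.+1 of every group of points, hence of all of them,
   contrary to [missle]. *)
have ge t : t \in S -> (#|Ts t| <= d.+1 * #|bad i t|)%N.
  move=> tS; rewrite leqNgt; apply/negP => lt; apply: H; exists (z t); first exact: mz.
  by apply: (hz t tS); rewrite setU1r// inE iA.
have := missle i iA; rewrite ltnNge => /negP; apply.
have -> : n = (\sum_(t in S) #|Ts t|)%N.
  rewrite -sn -[LHS]card_ord -sum1_card (partition_big sg (mem S)) /=; last by move=> l _; case: (hsg l).
  by apply: eq_bigr => t _; rewrite -sum1_card; apply: eq_bigl => l; rewrite inE.
have -> : miss K i s = (\sum_(t in S) #|bad i t|)%N.
  rewrite /miss -sum1_count (big_nth 0%R) big_mkord (partition_big sg (mem S)) /=; last by move=> l _; case: (hsg l).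
  by apply: eq_bigr => t _; rewrite -sum1_card; apply: eq_bigl => l; rewrite inE andbC.
by rewrite big_distrr /=; apply: leq_sum => t; exact: ge.
Qed.

(** Take a non-intersecting [Z0] of at most d + 1 sets. If removing any z in [Z0] still leaves a
    non-intersecting family, it contains a witness [V z] without z. Each point then misses some z in
    [Z0] and another set in [V z], two members of a family of at most (d + 1)(d + 2) sets. *)
Lemma almost_meets A : (forall W : {set T}, W \subset A -> (#|W| <= d.+1 * d.+2)%N ->
    exists x, (#|[set i in W | ~~ `[< K i x >] ]| <= 1)%N) ->
  exists Z : {set T}, [/\ Z \subset A, (#|Z| <= 1)%N & meets K (A :\: Z)].
Proof.
move=> hW.
have hel B : ~ meets K B -> exists V : {set T}, [/\ V \subset B, (#|V| <= d.+1)%N & ~ meets K V].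
  move=> nB; apply: contrapT => H; apply: nB; apply: helly => // Q QB cQ.
  by apply: contrapT => nQ; apply: H; exists Q.
have [mA|/hel[Z0 [Z0A cZ0 nZ0]]] := pselect (meets K A).
  by exists set0; rewrite sub0set cards0 setD0.
have [[z zZ mz]|H] := pselect (exists2 z, z \in Z0 & meets K (A :\ z)).
  by exists [set z]; rewrite sub1set (subsetP Z0A)// cards1.
have exV z : exists V : {set T}, z \in Z0 -> [/\ V \subset A :\ z, (#|V| <= d.+1)%N & ~ meets K V].
  have [zZ|] := boolP (z \in Z0); last by exists set0.
  by have [|V hV] := hel (A :\ z); [move=> m; apply: H; exists z|exists V].
have [V hV] := choice exV.
pose W := Z0 :|: \bigcup_(z in Z0) V z.
have [||x hx] := hW W.
- rewrite subUset Z0A; apply/bigcupsP => z zZ; have [VA _ _] := hV z zZ.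
  exact: subset_trans VA (subD1set _ _).
- apply: leq_trans (leq_card_setU _ _) _.
  have : (#|\bigcup_(z in Z0) V z| <= \sum_(z in Z0) d.+1)%N.
    elim/big_rec2: _ => [|z m' U zZ h']; first by rewrite cards0.
    apply: leq_trans (leq_card_setU _ _) _; apply: leq_add => //.
    by have [_ ? _] := hV z zZ.
  by rewrite sum_nat_const; move: #|Z0| cZ0 #|\bigcup_(_ in _) _| => a ha b; clear -ha; nia.
have out B : ~ meets K B -> exists2 i, i \in B & ~ K i x.
  move=> nB; apply: contrapT => h; apply: nB; exists x => i iB.
  by apply: contrapT => nK; apply: h; exists i.
have [z zZ nz] := out Z0 nZ0; have [VA _ nV] := hV z zZ; have [y yV ny] := out _ nV.
move: hx; rewrite leqNgt => /negP[]; apply/card_gt1P; exists z, y; split.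
- by rewrite !inE zZ; apply/asboolP.
- rewrite !inE; apply/andP; split; last exact/asboolP.
  by apply/orP; right; apply/bigcupP; exists z.
- by move: (subsetP VA y yV); rewrite !inE eq_sym => /andP[].
Qed.

(* Removing [S] together with a few sets [W] usually costs nothing; if it always costs
   something, then all but at most one of the remaining sets have a common point. *)
Theorem pierced_max_disjoint p q A S (w0 := (d.+1 * d.+2)%N) : (0 < d)%N ->
  (w0.+2 <= q)%N -> (p <= #|A|)%N -> pq K p q A ->
  S \subset A -> disjoint_family S ->
  (forall S' : {set T}, S' \subset A -> disjoint_family S' -> (#|S'| <= #|S|)%N) ->
  (forall (W : {set T}) (e : nat), W \subset A :\: S -> (#|W| <= w0)%N -> (e <= w0.+1)%N ->
     pq K (p - #|S :|: W|) (q - e) (A :\: (S :|: W)) ->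
     pierced K ((p - #|S :|: W|).+1 - (q - e)) (A :\: (S :|: W))) ->
  (q.-1 ^ d * p)%:R < (1 + (8 * d.+1)%:R^-1 : R) ^+ (q.-1 - d) ->
  pierced K (p.+1 - q) A.
Proof.
move=> d0 q0 pA hpq SA dS maxS IH hnum.
have qp0 := pq_le pA hpq.
have Sp : (#|S| < p)%N.
  rewrite ltnNge; apply/negP => pS.
  have [|G [_ GS cG]] := @subset_card_between _ set0 S p (sub0set _); first by rewrite cards0.
  have [Q [QG cQ mQ]] := hpq G (subset_trans GS SA) cG.
  by have := disjoint_meets dS (subset_trans QG GS) mQ; rewrite cQ /w0 in q0 *; nlia.
have cAS : #|A :\: S| = (#|A| - #|S|)%N by rewrite cardsD (setIidPr SA).
have ext W : W \subset A :\: S -> (#|W| <= p - #|S|)%N ->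
    exists (W1 Q : {set T}), [/\ W \subset W1, #|W1| = (p - #|S|)%N,
      Q \subset S :|: W1, #|Q| = q & meets K Q].
  move=> WA cW; have [|W1 [WW1 W1A cW1]] := @subset_card_between _ W _ (p - #|S|) WA.
    by rewrite cW cAS leq_sub2r.
  have SW1 : S :&: W1 = set0.
    apply/setP => i; rewrite !inE; apply/negP => /andP[iS /(subsetP W1A)].
    by rewrite inE iS.
  have [||Q [QS cQ mQ]] := hpq (S :|: W1).
  - by rewrite subUset SA (subset_trans W1A (subsetDl _ _)).
  - by rewrite cardsU SW1 cards0 cW1; nlia.
  by exists W1, Q.
have QS1 Q : meets K Q -> (#|Q :&: S| <= 1)%N.
  by move=> mQ; apply: (disjoint_meets dS (subsetIr _ _)); apply: meetsS mQ; exact: subsetIl.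
have splitQ Q W1 : Q \subset S :|: W1 -> (#|Q| <= #|Q :&: S| + #|Q :&: W1|)%N.
  by move=> QU; apply: leq_trans (leq_card_setU _ _); rewrite -setIUr (setIidPl QU).
have lam : (#|S| <= p.+1 - q)%N.
  have [|W1 [Q [_ cW1 QU cQ mQ]]] := ext set0 (sub0set _); first by rewrite cards0.
  have := splitQ Q W1 QU; have := QS1 Q mQ; have := subset_leq_card (subsetIr Q W1).
  by rewrite cQ cW1; nlia.
have SWd W : W \subset A :\: S -> S :&: W = set0.
  move=> WA; apply/setP => i; rewrite !inE; apply/negP => /andP[iS /(subsetP WA)].
  by rewrite inE iS.
apply: contrapT => npierced.
(* If a deepest point of [S :|: W] missed two sets of [W], it would miss more than [#|S|] sets
   altogether, and by maximality of [S] two of these intersect. Then #|S :|: W| - #|Q| points pierce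
   [S :|: W], as many as its removal takes off p - q. *)
have small W : W \subset A :\: S -> (#|W| <= w0)%N ->
    exists x, (#|[set i in W | ~~ `[< K i x >] ]| <= 1)%N.
  move=> WA cW; have [Q [x [QU hx mQ]]] := max_meets_exists (S :|: W).
  exists x; rewrite leqNgt; apply/negP => W2; apply: npierced.
  have cSW : #|S :|: W| = (#|S| + #|W|)%N by rewrite cardsU (SWd W WA) cards0 subn0.
  have Qe : (#|Q| <= w0.+1)%N.
    have := splitQ Q W QU; have := QS1 Q (ex_intro _ x hx); have := subset_leq_card (subsetIr Q W).
    by nlia.
  have SWp : (#|S :|: W| <= p)%N by rewrite cSW; nlia.
  have hpq' : pq K (p - #|S :|: W|) (q - #|Q|) (A :\: (S :|: W)).
    apply: (pq_setD _ SWp hpq mQ).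
    by rewrite subUset SA (subset_trans WA (subsetDl _ _)).
  have IH' := IH W _ WA cW Qe hpq'.
  pose U := [set i in S :|: W | ~~ `[< K i x >] ].
  have UQ : U = (S :|: W) :\: Q.
    have sQ : Q \subset [set i in S :|: W | `[< K i x >] ].
      by apply/subsetP => i iQ; rewrite inE (subsetP QU)//=; apply/asboolP; exact: hx.
    have eQ : Q = [set i in S :|: W | `[< K i x >] ].
      apply/eqP; rewrite eqEcard sQ /=; apply: mQ; first by apply/subsetP => i; rewrite inE => /andP[].
      by exists x => i; rewrite inE => /andP[_ /asboolP].
    rewrite eQ; apply/setP => i; rewrite /U !inE; case: ((i \in S) || _) => //=; first by rewrite andbT.
  have cU : #|U| = (#|S :|: W| - #|Q|)%N by rewrite UQ cardsD (setIidPr QU).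
  have cQU := subset_leq_card QU.
  have bigU : (#|S| < #|U|)%N.
    have : (#|S :\: Q| + #|[set i in W | ~~ `[< K i x >] ]| <= #|U|)%N.
      apply: (@leq_trans #|(S :\: Q) :|: [set i in W | ~~ `[< K i x >] ]|).
        rewrite cardsU; suff -> : (S :\: Q) :&: [set i in W | ~~ `[< K i x >] ] = set0 by rewrite cards0 subn0.
        apply/setP => i; rewrite !inE; have := SWd W WA => /setP/(_ i); rewrite !inE.
        by case: (i \in S); case: (i \in W) => //=; rewrite ?andbF.
      apply: subset_leq_card; apply/subsetP => i; rewrite inE => /orP[].
        by rewrite UQ !inE => /andP[-> ->].
      by rewrite /U !inE => /andP[-> ->]; rewrite orbT.
    have := QS1 Q (ex_intro _ x hx); rewrite cardsD setIC; have := subset_leq_card (subsetIl Q S).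
    have : (#|Q :&: S| <= #|S|)%N by apply: subset_leq_card; exact: subsetIr.
    by move: W2; nlia.
  have USW : U \subset S :|: W by apply/subsetP => i; rewrite inE => /andP[].
  have ndU : ~ disjoint_family U.
    move=> dU; have UA : U \subset A.
      by apply: subset_trans USW _; rewrite subUset SA (subset_trans WA (subsetDl _ _)).
    by have := maxS U UA dU; rewrite leqNgt bigU.
  have pSW : pierced K #|U| (S :|: W).
    have := piercedU (@pierced_meets _ _ _ K Q (ex_intro _ x hx)) (pierced_not_disjoint ndU).
    rewrite add1n prednK; last by apply: leq_ltn_trans bigU.
    by apply: piercedS => //; rewrite UQ; apply/subsetP => i iS; rewrite in_setU in_setD iS andbT orbN.
  have qp := pq_le _ hpq'.
  have cAD : (p - #|S :|: W| <= #|A :\: (S :|: W)|)%N.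
    rewrite cardsD (setIidPr _); first by apply: leq_sub2r.
    by rewrite subUset SA (subset_trans WA (subsetDl _ _)).
  have := piercedU pSW IH'; have {}qp := qp cAD.
  apply: piercedS; first by rewrite cU; move: qp SWp cQU q0 Qe; rewrite /w0; nlia.
  by apply/subsetP => i iA; rewrite in_setU in_setD iA andbT orbN.
have [Z [ZA Z1 mZ]] := almost_meets small.
have pSZ : pierced K #|S| (S :|: Z).
  have [Z0|Zn] := eqVneq Z set0; first by rewrite Z0 setU0; exact: pierced_card.
  have cZ : #|Z| = 1%N by apply/eqP; rewrite eqn_leq Z1 card_gt0.
  have cSZ : #|S :|: Z| = #|S|.+1 by rewrite cardsU (SWd Z ZA) cards0 cZ subn0 addn1.
  have -> : #|S| = #|S :|: Z|.-1 by rewrite cSZ.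
  apply: pierced_not_disjoint => dZ; have SZA : S :|: Z \subset A.
    by rewrite subUset SA (subset_trans ZA (subsetDl _ _)).
  by have := maxS (S :|: Z) SZA dZ; rewrite cSZ ltnn.
have [lt|ge] := ltnP #|S| (p.+1 - q).
  apply: npierced; have := piercedU pSZ (pierced_meets mZ); rewrite addn1.
  apply: piercedS => //; apply/subsetP => i iA; rewrite !inE iA andbT.
  by case: (i \in S); case: (i \in Z).
have eS : #|S| = (p.+1 - q)%N by apply/eqP; rewrite eqn_leq lam.
apply: npierced; rewrite -eS.
have -> : A = S :|: (A :\: S).
  by apply/setP => i; rewrite !inE; case: (boolP (i \in S)) => //= /(subsetP SA).
apply: (@pierced_transversal q.-1) => //; first by rewrite /w0 in q0; nlia.
  by apply: le_lt_trans hnum; rewrite ler_nat leq_mul2l (ltnW Sp) orbT.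
(* Now p - #|S| = q - 1, so an intersecting q-tuple of [S :|: W1] can only consist of all of [W1]
   and one member of [S]. *)
move=> W WA cW; have [|W1 [Q [WW1 cW1 QU cQ mQ]]] := ext W WA; first by nlia.
have QS := QS1 Q mQ; have := splitQ Q W1 QU; have := subset_leq_card (subsetIr Q W1) => h1 h2.
have cQW : #|Q :&: W1| = #|W1| by move: h1 h2 QS; rewrite cQ cW1 eS; nlia.
have W1Q : W1 \subset Q.
  have /eqP <- : Q :&: W1 == W1 by rewrite eqEcard subsetIr cQW leqnn.
  exact: subsetIl.
have /card_gt0P[s] : (0 < #|Q :&: S|)%N by move: h2; rewrite cQ cQW cW1 eS; nlia.
rewrite inE => /andP[sQ sS]; exists s => //; apply: meetsS mQ.
by rewrite subUset sub1set sQ (subset_trans WW1 W1Q).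
Qed.

End Core.

(** The factor [q ^ 2] stands for p, which is at most q^2 because q >= p^al with al >= 1/2. *)
Lemma poly_lt_expr (R : realType) (d f : nat) : (0 < f)%N ->
  exists n0, forall q, (n0 <= q)%N -> (q.-1 ^ d * q ^ 2)%:R < (1 + f%:R^-1 : R) ^+ (q.-1 - d).
Proof.
move=> f0; pose g := (2 * f + d + 1)%N.
have [l0 hl0] := poly_lt_exp2 (g ^ (d + 2)) (d + 2).
exists (f * l0.+1 + d + 1)%N => q hq.
pose l := ((q.-1 - d) %/ f)%N.
have lq : (l * f <= q.-1 - d)%N by exact: leq_trunc_div.
have ql : (q.-1 - d < l.+1 * f)%N by exact: ltn_ceil.
have l01 : (l0.+1 <= l)%N.
  rewrite leq_divRL// mulnC; move: hq; move: (f * l0.+1)%N => a; clear; lia.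
have f0' : 0 < f%:R :> R by rewrite ltr0n.
have two : 2 <= (1 + f%:R^-1 : R) ^+ f.
  have key n : 1 + n%:R * f%:R^-1 <= (1 + f%:R^-1 : R) ^+ n.
    elim: n => [|n IH]; first by rewrite mul0r addr0 expr0.
    rewrite exprS; apply: le_trans (_ : (1 + f%:R^-1) * (1 + n%:R * f%:R^-1) <= _); last first.
      by rewrite ler_wpM2l// addr_ge0// invr_ge0.
    have : 0 <= f%:R^-1 :> R by rewrite invr_ge0.
    have : 0 <= n%:R :> R by [].
    by rewrite -natr1; move: (n%:R : R) (f%:R^-1 : R) => a b; clear; nra.
  by have := key f; rewrite divff ?gt_eqF.
have lo : (2 ^ l)%:R <= (1 + f%:R^-1 : R) ^+ (q.-1 - d).
  rewrite natrX; apply: le_trans (_ : ((1 + f%:R^-1) ^+ f) ^+ l <= _).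
    by apply: lerXn2r; rewrite ?nnegrE//; exact: le_trans two.
  rewrite -exprM; apply: ler_weXn2l; first by rewrite lerDl invr_ge0.
  by rewrite mulnC.
apply: lt_le_trans lo; rewrite ltr_nat; apply: leq_ltn_trans (hl0 l (ltnW l01)).
rewrite -expnMn expnD; apply: leq_mul; apply: leq_expW.
  by move: ql l01; rewrite /g; clear; nia.
by move: ql l01; rewrite /g; clear; nia.
Qed.

Lemma powR_mul_sum1 (R : realType) (x a b : R) : 0 < x -> a + b = 1 -> x `^ a * x `^ b = x.
Proof.
move=> x0 ab; rewrite -powRD ?ab ?powRr1 ?(ltW x0)//.
by apply/implyP; rewrite gt_eqF.
Qed.

(** * The induction on p *)

Section TightRange.
Context {R : realType} {d : nat}.

(** 1 - x <= (1 - x/2)^2, and 2 al >= 1. *)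
Lemma powR_sub_half (al x : R) : 2^-1 <= al -> 0 <= x -> x <= 1 -> (1 - x) `^ al <= 1 - x / 2.
Proof.
move=> al2 x0 x1; have al0 : 0 < al by lra.
apply: le_trans (_ : ((1 - x / 2) ^+ 2) `^ al <= _).
  apply: ge0_ler_powR; rewrite ?nnegrE ?(ltW al0)//; first by lra.
  - by rewrite sqr_ge0.
  - by nra.
rewrite -powR_mulrn; last by lra.
rewrite -powRrM; apply: ge1r_powR; lra.
Qed.

(* Dropping [a] of the [p] sets lowers [B * p ^ al] by at least [B * p ^ al * a / (2 * p)],
   by concavity, which leaves room for lowering [q] by [e]. *)
Lemma removal_slack (al sg B A0 : R) (p q a e : nat) : 2^-1 <= al -> sg = 1 - al -> 1 <= B ->
  4 * e%:R <= A0 -> (0 < p)%N -> B * p%:R `^ al <= q%:R -> A0 * p%:R `^ sg <= 2 * a%:R ->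
  (a <= p)%N -> B * (p - a)%:R `^ al <= (q - e)%:R.
Proof.
move=> al2 sgE B1 eA p0 hq ha ap.
have p0' : 0 < p%:R :> R by rewrite ltr0n.
have pal : 0 < p%:R `^ al by exact: powR_gt0.
have psg : 0 < p%:R `^ sg by exact: powR_gt0.
have pE : p%:R `^ sg * p%:R `^ al = p%:R by apply: powR_mul_sum1 => //; lra.
pose x : R := a%:R / p%:R.
have x0 : 0 <= x by rewrite divr_ge0// ltW.
have x1 : x <= 1 by rewrite ler_pdivrMr// mul1r ler_nat.
have e1 : (p - a)%:R = p%:R * (1 - x).
  by rewrite natrB// /x mulrBr mulr1 mulrCA divff ?mulr1// gt_eqF.
have h1 : (p - a)%:R `^ al <= p%:R `^ al * (1 - x / 2).
  rewrite e1 powRM ?(ltW p0') ?subr_ge0// ler_wpM2l ?(ltW pal)//; exact: powR_sub_half.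
have h2 : 2 * e%:R <= p%:R `^ al * x.
  have : A0 * (p%:R `^ sg * p%:R `^ al) <= 2 * a%:R * p%:R `^ al.
    by rewrite mulrA ler_wpM2r// ltW.
  rewrite pE => h; have : A0 <= 2 * (p%:R `^ al * x).
    rewrite /x mulrA mulrA ler_pdivlMr//; lra.
  lra.
have h3 : e%:R <= B * (p%:R `^ al * (x / 2)).
  have : 0 <= p%:R `^ al * (x / 2) by rewrite mulr_ge0 ?(ltW pal)// divr_ge0.
  by move: h2; set y := p%:R `^ al; rewrite mulrA; nra.
apply: le_trans (_ : q%:R - e%:R <= _); last first.
  have [eq_|qe] := leqP e q; first by rewrite natrB.
  rewrite (_ : (q - e = 0)%N) ?subr_le0 ?ler_nat ?(ltnW qe)//.
  by apply/eqP; rewrite subn_eq0 ltnW.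
have : B * (p - a)%:R `^ al <= B * (p%:R `^ al * (1 - x / 2)) by rewrite ler_wpM2l//; lra.
move: hq h3; set y := p%:R `^ al; set z := _ `^ al.
by rewrite mulrBr mulr1 mulrBr; lra.
Qed.

Theorem pq_tight (eps : R) (al := (d%:R - 1) / d%:R + eps) : (1 < d)%N -> 0 < eps -> eps < d%:R^-1 ->
  exists2 B : R, 1 <= B & forall (T : finType) (K : T -> set 'rV[R]_d),
    (forall i, (K i !=set0)%classic) -> (forall i, cvx (K i)) -> (forall i, compact (K i)) ->
    forall (p q : nat) (A : {set T}), (0 < p)%N -> B * p%:R `^ al <= q%:R ->
    (p <= #|A|)%N -> pq K p q A -> pierced K (p.+1 - q) A.
Proof.
move=> d1 e0 ed; have d0 : (0 < d)%N by exact: ltnW.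
have d0' : 0 < d%:R :> R by rewrite ltr0n.
have d2' : 2 <= d%:R :> R by rewrite ler_nat.
pose sg := d%:R^-1 - eps; have sg0 : 0 < sg by rewrite subr_gt0.
have alE : al = 1 - sg.
  by rewrite /al /sg mulrBl divff ?gt_eqF// mul1r; lra.
have dinv : d%:R^-1 <= 2^-1 :> R by rewrite lef_pV2 ?posrE.
have al2 : 2^-1 <= al by rewrite alE /sg; lra.
have al0 : 0 < al by lra.
have sgE : sg = 1 - al by lra.
pose y := d%:R * eps; have y0 : 0 < y by rewrite mulr_gt0.
have y1 : y < 1 by rewrite /y mulrC -ltr_pdivlMr// div1r.
(* The net exponent and the factor m / (m - d) each cost at most 1 + y/3. As (1 + y/3)^2 (1 - y) <
   1, the Alon-Kleitman bound for p^sg sets is a power of p with exponent below 1. *)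
pose gam := d%:R * (1 + y / 3).
have dgam : d%:R < gam by rewrite /gam mulrDr mulr1 ltrDl mulr_gt0// divr_gt0.
have [h0 hh0] := nat_above (3 * d%:R / y); pose h := h0.+1; pose m := (d + h)%N.
have dm : (d < m)%N by rewrite /m /h -addSnnS leq_addr.
have mh : (m - d = h)%N by rewrite /m addKn.
have [c c0 hAK] := alon_kleitman d0 dm dgam.
pose e := m%:R / (m - d)%:R * gam.
have h0' : 0 < h%:R :> R by rewrite ltr0n.
have meq : m%:R / (m - d)%:R <= 1 + y / 3.
  rewrite mh ler_pdivrMr// /m natrD mulrDl mul1r [leRHS]addrC lerD2r.
  have : 3 * d%:R / y <= h%:R by apply: le_trans hh0 _; rewrite ler_nat.
  by rewrite ler_pdivrMr//; lra.
have om1 : e * sg < 1.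
  have e2 : e * sg <= (1 + y / 3) ^+ 2 * (1 - y).
    have -> : e * sg = m%:R / (m - d)%:R * ((1 + y / 3) * (1 - y)).
      rewrite /e /gam -!mulrA; congr (_ * (_ * _)); rewrite mulrCA; congr (_ * _).
      by rewrite /sg mulrBr divff ?gt_eqF.
    rewrite expr2 -[leRHS]mulrA ler_wpM2r// mulr_ge0//; lra.
  apply: le_lt_trans e2 _; rewrite expr2; nra.
have e0' : 0 < e.
  by rewrite mulr_gt0 ?divr_gt0 ?mh// ?ltr0n ?(leq_ltn_trans _ dm)// (lt_trans d0' dgam).
(* [Dm] bounds every loss in q during the induction, and [A0] is the matching constant of
   [removal_slack]. *)
pose w0 := (d.+1 * d.+2)%N; pose Dm := (m + w0 + 1)%N; pose A0 : R := 4 * Dm%:R.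
have A01 : 1 <= A0 by have : 1 <= Dm%:R :> R; [rewrite ler1n /Dm addn1|rewrite /A0; lra].
pose C1 := c * (2 * A0) `^ e * d%:R.
have C10 : 0 < C1 by rewrite !mulr_gt0// powR_gt0//; lra.
have [n0 hn0] := @poly_lt_expr R d (8 * d.+1) isT.
(* Since B <= q <= p, the summands force in turn: the Alon-Kleitman bound below p / d, [ps <= p], q
   larger than any loss, and the numerical condition of [pierced_max_disjoint]. *)
pose B := 1 + C1 `^ (1 - e * sg)^-1 + (2 * A0) `^ al^-1 + Dm%:R + n0%:R.
have pc1 := powR_ge0 C1 (1 - e * sg)^-1; have pc2 := powR_ge0 (2 * A0) al^-1.
have Dm0 : 0 <= Dm%:R :> R by []; have n00 : 0 <= n0%:R :> R by [].
have B1 : 1 <= B by rewrite /B; lra.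
exists B => // T K K0 Kcvx Kcpt p q A p0; have [n] := ubnP p.
elim: n p q A p0 => // n IH p q A p0 /ltnSE pn hq pA hpq.
have p0' : 0 < p%:R :> R by rewrite ltr0n.
have p1' : 1 <= p%:R :> R by rewrite ler1n.
have qp := pq_le pA hpq.
have pal1 : 1 <= p%:R `^ al by rewrite -[leLHS](powRr0 p%:R); apply: ler_powR => //; exact: ltW.
have Bq : B <= q%:R by apply: le_trans hq; rewrite ler_peMr//; lra.
have Bp : B <= p%:R by apply: le_trans Bq _; rewrite ler_nat.
have qDm : (Dm < q)%N by rewrite -(ltr_nat R); move: Bq; rewrite /B; lra.
have qn0 : (n0 <= q)%N by rewrite -(ler_nat R); move: Bq; rewrite /B; lra.
have [hd|hd] := ltnP (d.-1 * p + d) (d * q); first exact: hadwiger_debrunner.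
have psg : 1 <= p%:R `^ sg by rewrite -[leLHS](powRr0 p%:R); apply: ler_powR => //; exact: ltW.
have pE : p%:R `^ sg * p%:R `^ al = p%:R by apply: powR_mul_sum1 => //; lra.
(* The factor 2 is for the largest disjoint family, known only to have more than ps - m >= ps / 2
   members. *)
have IHa (A' : {set T}) (a f : nat) : A0 * p%:R `^ sg <= 2 * a%:R -> (f <= Dm)%N -> (p - a <= #|A'|)%N ->
    pq K (p - a) (q - f) A' ->
    [/\ pierced K ((p - a).+1 - (q - f)) A', (q - f <= p - a)%N & (a <= p)%N].
  move=> ha fD pA' hpq'; have qp' := pq_le pA' hpq'.
  have ap : (a <= p)%N by nlia.
  have a0 : (0 < a)%N.
    rewrite -(ltr0n R); have : 1 <= A0 * p%:R `^ sg by rewrite -[leLHS]mulr1; apply: ler_pM.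
    by lra.
  split => //; apply: IH => //; [nlia|nlia|].
  apply: (removal_slack al2 sgE B1 _ p0 hq ha ap).
  by rewrite /A0 ler_pM2l// ler_nat.
pose ps := (Num.truncn (A0 * p%:R `^ sg)).+1.
have Ap1 : 1 <= A0 * p%:R `^ sg by rewrite -[leLHS]mulr1; apply: ler_pM.
have ps_lo : A0 * p%:R `^ sg <= ps%:R by rewrite ltW// truncnS_gt.
have ps_hi : ps%:R <= 2 * A0 * p%:R `^ sg.
  rewrite /ps -natr1; have : (Num.truncn (A0 * p%:R `^ sg))%:R <= A0 * p%:R `^ sg.
    by rewrite truncn_le//; lra.
  lra.
have psp : (ps <= p)%N.
  rewrite -(ler_nat R); apply: le_trans ps_hi _; rewrite -[leRHS]pE [leRHS]mulrC ler_wpM2r ?powR_ge0//.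
  have : ((2 * A0) `^ al^-1) `^ al <= p%:R `^ al.
    apply: ge0_ler_powR; rewrite ?nnegrE ?(ltW al0) ?(ltW p0')//.
    by move: Bp; rewrite /B; lra.
  by rewrite -powRrM mulVf ?gt_eqF// powRr1//; lra.
have [hps|nps] := pselect (pq K ps m A).
  have [n1 hn1 pn1] := hAK T K A ps K0 Kcvx Kcpt (ltn0Sn _) (leq_trans psp pA) hps.
  apply: piercedS pn1 => //.
  have : n1%:R * d%:R <= p%:R :> R.
    apply: le_trans (_ : C1 * p%:R `^ (e * sg) <= _).
      rewrite /C1 mulrAC ler_pM2r//; apply: le_trans hn1 _; rewrite -/e -[leRHS]mulrA ler_pM2l//.
      rewrite (mulrC e sg) (powRrM p%:R) -powRM ?powR_ge0//; last by lra.
      apply: ge0_ler_powR; rewrite ?nnegrE ?(ltW e0')//.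
      by rewrite mulr_ge0 ?powR_ge0//; lra.
    rewrite -[leRHS](@powR_mul_sum1 _ _ (1 - e * sg) (e * sg)) ?subrK// ler_wpM2r ?powR_ge0//.
    have : (C1 `^ (1 - e * sg)^-1) `^ (1 - e * sg) <= p%:R `^ (1 - e * sg).
      apply: ge0_ler_powR; rewrite ?nnegrE ?powR_ge0 ?(ltW p0')//; first by lra.
      by move: Bp; rewrite /B; lra.
    by rewrite -powRrM mulVf ?gt_eqF ?subr_gt0// powRr1 ?(ltW C10).
  rewrite -natrM ler_nat; move: hd qp d0; clear; case: d => // d' hd qp _ h.
  by rewrite /= in hd; nia.
have [S [SA cS nS]] : exists S : {set T}, [/\ S \subset A, #|S| = ps &
    forall Q : {set T}, Q \subset S -> meets K Q -> (#|Q| < m)%N].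
  apply: contrapT => H; apply: nps => G GA cG; apply: contrapT => nQ; apply: H.
  exists G; split => // Q QG mQ; rewrite ltnNge; apply/negP => mq.
  have [|Q' [_ Q'Q cQ']] := @subset_card_between _ set0 Q m (sub0set _); first by rewrite cards0.
  by apply: nQ; exists Q'; split => //; [exact: subset_trans QG|exact: meetsS mQ].
have cAD (S' : {set T}) : S' \subset A -> (p - #|S'| <= #|A :\: S'|)%N.
  by move=> S'A; rewrite cardsD (setIidPr S'A) leq_sub2r.
have [[Q QS [dQ cQ]]|[f [fm fS hf pf]]] := sparse_subfamily K0 nS; last first.
  have hpq' := pq_setD SA (eq_ind_r (fun z => (z <= p)%N) psp cS) hpq hf.
  have [||pi qf Sp] := IHa (A :\: S) #|S| f _ _ (cAD S SA) hpq'.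
  - by rewrite cS; apply: le_trans ps_lo _; rewrite ler_peMl// ler1n.
  - by rewrite /Dm; nlia.
  have := piercedU pf pi; apply: piercedS; first by nlia.
  by apply/subsetP => i iA; rewrite !inE iA andbT orbN.
have [S1 [S1A dS1 maxS1]] := max_disjoint_exists K A.
have cS1 : (#|Q| <= #|S1|)%N by apply: maxS1 => //; exact: subset_trans QS SA.
have ps2m : (2 * m <= ps)%N.
  rewrite -(ler_nat R); apply: le_trans ps_lo; apply: le_trans (_ : A0 <= _).
    by rewrite /A0 natrM; have : m%:R <= Dm%:R :> R; [rewrite ler_nat /Dm; nlia|have : 0 <= m%:R :> R by []; lra].
  by rewrite ler_peMr//; lra.
apply: (pierced_max_disjoint K0 Kcvx Kcpt d0 _ pA hpq S1A dS1 maxS1).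
- by move: qDm; rewrite /Dm /w0; nlia.
- move=> W f WA cW fw hpq'.
  have S1WA : S1 :|: W \subset A by rewrite subUset S1A (subset_trans WA (subsetDl _ _)).
  have [||//] := IHa (A :\: (S1 :|: W)) #|S1 :|: W| f _ _ (cAD _ S1WA) hpq'.
  + apply: le_trans ps_lo _; rewrite -natrM ler_nat.
    have : (#|S1| <= #|S1 :|: W|)%N by rewrite subset_leq_card// subsetUl.
    by move: cQ; rewrite cS; move: ps2m cS1; clear; lia.
  + by move: fw; rewrite /Dm /w0; nlia.
- apply: le_lt_trans (hn0 q qn0); rewrite ler_nat leq_mul2l; apply/orP; right.
  rewrite -(ler_nat R) natrX; apply: le_trans (_ : (p%:R `^ al) ^+ 2 <= _).
    rewrite -powR_mulrn ?powR_ge0// -powRrM -[leLHS]powRr1 ?(ltW p0')//.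
    by apply: ler_powR => //; lra.
  apply: lerXn2r; rewrite ?nnegrE ?powR_ge0//.
  by apply: le_trans hq; rewrite ler_peMl ?powR_ge0.
Qed.

End TightRange.

(** * Families with the (p, q)_r property *)

(** Passage from finite sets of sets to families indexed by a finite type: [fsub] is injective on
    the subfamilies counted. *)
Lemma pqr_property_card {R : realType} {d : nat} (F : {fset set 'rV[R]_d}) p q r :
  pqr_property p q r F -> forall G : {set F}, #|G| = p ->
  (r <= #|[set Q : {set F} | [&& Q \subset G, #|Q| == q & `[< meets (fun i => val i) Q >] ]]|)%N.
Proof.
move=> h G cG; pose G' := [fset val i | i in G]%fset.
have G'F : (G' `<=` F)%fset by apply/fsubsetP => x /imfsetP[i _ ->]; exact: valP.
have cG' : #|` G'| = p by rewrite card_imfset//=; [rewrite -cardE|exact: val_inj].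
have GE : fsub F G' = G.
  apply/setP => i; rewrite in_fsub; apply/imfsetP/idP => [[j jG /val_inj->]//|iG].
  by exists i.
apply: leq_trans (h G' G'F cG') _; set S := [fset Q in _ | _]%fset.
have SF Q : Q \in S -> (Q `<=` F)%fset.
  by rewrite /S in_fset inE/= fpowersetE => /andP[QG _]; exact: fsubset_trans QG G'F.
have <- : #|` [fset fsub F Q | Q in S]%fset| = #|` S|.
  by rewrite card_in_imfset// => P Q /SF PF /SF QF; apply: fsub_inj.
rewrite -card_finset; apply: fsubset_leq_card; apply/fsubsetP => X /imfsetP[Q QS ->].
have QF := SF Q QS; move: QS; rewrite /S in_fset inE/= fpowersetE => /and3P[QG cQ /asboolP[x hx]].
have QG' : fsub F Q \subset G by rewrite -GE subset_fsub.
rewrite in_fset inE QG' card_fsub// cQ; apply/asboolP; exists x => i.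
by rewrite in_fsub => /hx.
Qed.

Lemma HD_le (R : realType) d p q r (b : R) :
  (forall (T : finType) (K : T -> set 'rV[R]_d),
    (forall i, (K i !=set0)%classic) -> (forall i, cvx (K i)) -> (forall i, compact (K i)) ->
    (p <= #|T|)%N -> (forall G : {set T}, #|G| = p ->
      (r <= #|[set Q : {set T} | [&& Q \subset G, #|Q| == q & `[< meets K Q >] ]]|)%N) ->
    exists2 m : nat, m%:R <= b & pierced K m [set: T]) ->
  (HD R d p q r <= b%:E)%E.
Proof.
move=> H; apply: ub_ereal_sup => _ [F [Fcc pF hF] <-].
have [||||m mb [s sm hs]] := H F (fun i => val i) _ _ _ _ (pqr_property_card hF).
- by move=> i; have [] := Fcc _ (valP i).
- move=> i x y t t0 t1 Kx Ky; have [_ _ cF] := Fcc _ (valP i).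
  by have := cF x y (Itv01 t0 t1); rewrite !in_setE; apply.
- by move=> i; have [] := Fcc _ (valP i).
- by rewrite -cardfE.
pose S := [fset x in s]%fset.
apply: le_trans (_ : (#|` S|%:R)%:E <= _)%E; last first.
  rewrite lee_fin; apply: le_trans mb; rewrite ler_nat card_fseq.
  exact: leq_trans (size_undup s) sm.
apply: ereal_inf_lbound; exists S => // L LF.
have [//|x xs Lx] := hs [` LF]%fset; exists x => //.
by rewrite in_fset.
Qed.

Section Counting.
Context {R : realType} {d : nat} {T : finType}.
Variable K : T -> set 'rV[R]_d.
Hypotheses (Kcvx : forall i, cvx (K i)) (Kcpt : forall i, compact (K i)).

(** For k <= q one intersecting q-tuple suffices, so the counting condition is imposed only for q <
    k. *)
Lemma pq_upgrade p q k r : (0 < d)%N -> (d < q)%N -> (0 < r)%N ->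
  (forall G : {set T}, #|G| = p ->
    (r <= #|[set Q : {set T} | [&& Q \subset G, #|Q| == q & `[< meets K Q >] ]]|)%N) ->
  ((q < k)%N -> ('C(p, d) * 'C(k.-1 - d, q - d) < r)%N) -> pq K p (maxn q k) [set: T].
Proof.
move=> d0 dq r0 hr hk G _ cG; have [qk|kq] := ltnP q k; last first.
  have /card_gt0P[Q] := leq_trans r0 (hr G cG).
  by rewrite inE => /and3P[QG /eqP cQ /asboolP mQ]; exists Q; split.
apply: contrapT => nQ.
have : (r < r)%N; last by rewrite ltnn.
apply: leq_ltn_trans (hk qk); apply: leq_trans (hr G cG) _.
rewrite -cG; apply: card_meets_le d0 (ltnW dq) _ => // Q QG mQ.
rewrite subnK; last by move: dq qk; clear; lia.
rewrite leqNgt; apply/negP => kQ.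
have [|Q' [_ Q'Q cQ']] := @subset_card_between _ set0 Q k (sub0set _).
  by rewrite cards0 (leq_trans (leqSpred k)).
by apply: nQ; exists Q'; split => //; [exact: subset_trans QG|exact: meetsS mQ].
Qed.

End Counting.

(** * Comparison with ordinary binomial coefficients *)

Section GeneralizedBinomial.
Context {R : realType}.
Implicit Types (x : R) (n j d p : nat).

Lemma bin_le_gbinom x n j : (j <= n)%N -> n%:R <= x -> 'C(n, j)%:R <= gbinom x j.
Proof.
move=> jn nx; rewrite /gbinom ler_pdivlMr ?ltr0n ?fact_gt0// -natrM bin_ffact ffact_prod natr_prod.
apply: ler_prod => i _; rewrite ler0n/= natrB ?lerD2r//.
exact: leq_trans (ltnW (ltn_ord i)) jn.
Qed.

Lemma bin_le_expn n j : ('C(n, j) * j`! <= n ^ j)%N.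
Proof.
rewrite bin_ffact ffact_prod -[X in (_ <= n ^ X)%N](card_ord j) -prod_nat_const.
by apply: leq_prod => i _; exact: leq_subr.
Qed.

(** For small p some factors p/d - i are negative, so the product is taken over absolute values. A
    nonzero factor is |p - i d| / d with |p - i d| a positive integer and i < d, whence p <= 2 d^2
    |p - i d|. *)
Lemma bin_le_gbinom_div d p : (0 < d)%N -> 0 < gbinom (p%:R / d%:R : R) d ->
  'C(p, d)%:R <= (2 * d%:R ^+ 3) ^+ d * gbinom (p%:R / d%:R : R) d.
Proof.
move=> d0 g0; have d0' : 0 < d%:R :> R by rewrite ltr0n.
have f0 : 0 < d`!%:R :> R by rewrite ltr0n fact_gt0.
set x := p%:R / d%:R.
have E : gbinom x d * d`!%:R = \prod_(i < d) `|x - i%:R|.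
  have -> : gbinom x d * d`!%:R = \prod_(i < d) (x - i%:R) by rewrite /gbinom divfK// gt_eqF.
  rewrite -normr_prod ger0_norm//; move: g0.
  by rewrite /gbinom pmulr_lgt0 ?invr_gt0// => /ltW.
have P0 : 0 < \prod_(i < d) `|x - i%:R| by rewrite -E mulr_gt0.
rewrite -(ler_pM2r f0) -mulrA E -natrM.
apply: le_trans (_ : p%:R ^+ d <= _).
  by rewrite -natrX ler_nat bin_le_expn.
rewrite -[X in p%:R ^+ X](card_ord d) -[X in _ ^+ X * _](card_ord d) -!prodr_const -big_split/=.
apply: ler_prod => i _; rewrite ler0n/=.
have n0 : x - i%:R != 0.
  by apply: contraTneq P0 => e; rewrite (bigD1 i)//= e normr0 mul0r ltxx.
have nat_case : (p <= (if (i * d <= p)%N then p - i * d else i * d - p) * (2 * d ^ 2))%N.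
  have : (p != i * d)%N.
    by apply: contraNneq n0 => e; rewrite /x e natrM mulfK ?lt0r_neq0// subrr.
  move: (ltn_ord i) d0; rewrite /x; move: (nat_of_ord i) => j; clear; case: ifP; nia.
have -> : x - i%:R = (p%:R - (i * d)%:R) / d%:R.
  by rewrite mulrBl natrM mulfK// gt_eqF.
rewrite normrM (ger0_norm (x := d%:R^-1)) ?invr_ge0//.
have -> : 2 * d%:R ^+ 3 * (`|p%:R - (i * d)%:R : R| / d%:R) =
    `|p%:R - (i * d)%:R| * (2 * d ^ 2)%:R.
  by rewrite (natrM _ 2) natrX; field; rewrite gt_eqF.
case: ifP nat_case => [le|/negbT]; last rewrite -ltnNge => lt; move=> h.
  by rewrite -natrB// ger0_norm// -natrM ler_nat.
by rewrite distrC -natrB ?(ltnW lt)// ger0_norm// -natrM ler_nat.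
Qed.

End GeneralizedBinomial.

Lemma ltr_powRr (R : realType) (x a b : R) : 1 < x -> a < b -> x `^ a < x `^ b.
Proof.
move=> x1 ab; have x0 : 0 < x by lra.
by rewrite -ltr_ln ?posrE ?powR_gt0// !ln_powR ltr_pM2r// ln_gt0.
Qed.

(** * The two bounds on [HD] *)

Section PiercingTheorems.
Context {R : realType} {d : nat} (d0 : (0 < d)%N).

Lemma natrB_succ_max (p q k : nat) : (maxn q k <= p)%N ->
  (p.+1 - maxn q k)%:R <= Num.min (p%:R - q%:R + 1) (p%:R - k%:R + 1) :> R.
Proof.
move=> sp; rewrite natrB ?(leqW sp)// -natr1 le_min.
have : q%:R <= (maxn q k)%:R :> R by rewrite ler_nat leq_maxl.
have : k%:R <= (maxn q k)%:R :> R by rewrite ler_nat leq_maxr.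
by lra.
Qed.

Lemma HD_le_hadwiger_debrunner : exists c : R, 0 < c /\
  forall p q r : nat,
    (d.+1 <= q)%N -> (q <= p)%N -> (1 <= r)%N ->
    0 < gbinom (p%:R / d%:R : R) d ->
    c * gbinom ((d%:R - 1) / d%:R * p%:R) (q - d) * gbinom (p%:R / d%:R) d <= r%:R ->
    (HD R d p q r <= (Num.min (p%:R - q%:R + 1) (p%:R / d%:R - 1))%:E)%E.
Proof.
have d0' : 0 < d%:R :> R by rewrite ltr0n.
pose c : R := (2 * d%:R ^+ 3) ^+ d.
have c0 : 0 < c by rewrite exprn_gt0// mulr_gt0// exprn_gt0.
(* The factor 2 makes the inequality of the count strict. *)
exists (2 * c); split; first by rewrite mulr_gt0.
move=> p q r dq qp r0 g0 hr; apply: HD_le => T K K0 Kcvx Kcpt pT hT.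
(* With this k the bound p - k + 1 equals p %/ d - 1. For d >= 2 also k - 1 - d <= (d - 1) p / d, as
   the comparison with [gbinom] requires; for d = 1 it is 2, so q < k cannot occur. *)
pose k := (p - p %/ d + 2)%N.
have pd : (p %/ d * d <= p)%N by exact: leq_trunc_div.
have pd' : (p < (p %/ d).+1 * d)%N by exact: ltn_ceil.
have hk : (q < k)%N -> ('C(p, d) * 'C(k.-1 - d, q - d) < r)%N.
  move=> qk; have d2 : (1 < d)%N.
    rewrite ltn_neqAle d0 andbT; apply/eqP => d1; move: qk dq.
    by rewrite /k -d1 divn1 subnn; lia.
  have jN : (q - d <= k.-1 - d)%N by move: qk; clear; lia.
  have B1 : (0 < 'C(k.-1 - d, q - d))%N by rewrite bin_gt0.
  have C1 : (0 < 'C(p, d))%N by rewrite bin_gt0; lia.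
  have Nx : (k.-1 - d)%:R <= (d%:R - 1) / d%:R * p%:R :> R.
    rewrite mulrAC ler_pdivlMr// mulrBl mul1r -natrM -natrM lerBrDr -natrD ler_nat.
    by move: pd pd' d2; rewrite /k; move: (p %/ d)%N => u; clear; nia.
  have h1 := bin_le_gbinom jN Nx; have h2 := bin_le_gbinom_div d0 g0.
  rewrite -(ltr_nat R); apply: lt_le_trans hr; rewrite natrM.
  apply: lt_le_trans (_ : 2 * ('C(p, d)%:R * 'C(k.-1 - d, q - d)%:R) <= _).
    by rewrite ltr_pMl ?ltr1n// mulr_gt0// ltr0n.
  move: h1 h2; move: (gbinom _ (q - d)) (gbinom _ d) => g1 g2 h1 h2.
  have -> : 2 * c * g1 * g2 = 2 * (c * g2 * g1) by ring.
  by rewrite ler_pM2l// ler_pM.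
have hpq := pq_upgrade Kcvx Kcpt d0 dq r0 hT hk.
have pT' : (p <= #|[set: T]|)%N by rewrite cardsT.
have sp := pq_le pT' hpq.
exists (p.+1 - maxn q k)%N; last first.
  apply: hadwiger_debrunner => //.
  have : (k <= maxn q k)%N by exact: leq_maxr.
  move: pd d0; rewrite /k; move: (p %/ d)%N (maxn _ _) => u s; clear.
  by case: d => // d' /=; nia.
apply: le_trans (natrB_succ_max sp) _; rewrite le_min !ge_min lexx/=.
apply/orP; right; rewrite /k natrD natrB; last by exact: leq_div.
have : (p %/ d)%:R <= p%:R / d%:R :> R by rewrite ler_pdivlMr// -natrM ler_nat.
by lra.
Qed.

(** [pq_tight] is applied with eps / 2, and the remaining p^(eps/2) absorbs [B] for large p. If al
    >= 1, then q >= p; this case and d = 1 are in the Hadwiger-Debrunner range. *)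
Lemma pierced_large (eps : R) (al := (d%:R - 1) / d%:R + eps) : 0 < eps ->
  exists p0 : nat, forall (T : finType) (K : T -> set 'rV[R]_d),
    (forall i, (K i !=set0)%classic) -> (forall i, cvx (K i)) -> (forall i, compact (K i)) ->
    forall (p q : nat) (A : {set T}), (p0 < p)%N -> (d < q)%N -> p%:R `^ al <= q%:R ->
    (p <= #|A|)%N -> pq K p q A -> pierced K (p.+1 - q) A.
Proof.
move=> e0; have d0' : 0 < d%:R :> R by rewrite ltr0n.
have [al1|al1] := leP 1 al.
  exists 0%N => T K K0 Kcvx Kcpt p q A p0 dq hq pA hpq.
  have qp := pq_le pA hpq; apply: hadwiger_debrunner => //.
  have : (p <= q)%N.
    by rewrite -(ler_nat R); apply: le_trans hq; apply: le1r_powR => //; rewrite ler1n.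
  by move: dq qp d0; clear; case: d => // d' /=; nia.
have [d2|d1] := ltnP 1 d; last first.
  exists 0%N => T K K0 Kcvx Kcpt p q A p0 dq hq pA hpq; apply: hadwiger_debrunner => //.
  by have -> : d = 1%N; [lia|move: dq; rewrite mul0n mul1n add0n; lia].
have ed : eps < d%:R^-1.
  by move: al1; rewrite /al mulrBl divff ?gt_eqF// mul1r; lra.
have e2 : 0 < eps / 2 by rewrite divr_gt0.
have [B B1 hB] := pq_tight d2 e2 (lt_trans (ltac:(lra) : eps / 2 < eps) ed).
have [p0 hp0] := nat_above (B `^ (eps / 2)^-1).
exists p0 => T K K0 Kcvx Kcpt p q A pp0 dq hq; apply: hB => //; first by lia.
have p1 : 0 < p%:R :> R by rewrite ltr0n; lia.
apply: le_trans hq; rewrite /al.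
have -> : (d%:R - 1) / d%:R + eps = eps / 2 + ((d%:R - 1) / d%:R + eps / 2) by lra.
rewrite [leRHS]powRD; last by apply/implyP; rewrite [p%:R == _]gt_eqF.
rewrite ler_wpM2r ?powR_ge0//.
have -> : B = (B `^ (eps / 2)^-1) `^ (eps / 2) by rewrite -powRrM mulVf ?gt_eqF// powRr1//; lra.
apply: ge0_ler_powR; rewrite ?nnegrE ?powR_ge0 ?(ltW e2) ?(ltW p1)//.
by apply: le_trans hp0 _; rewrite ler_nat ltnW.
Qed.

Lemma HD_le_pq_tight (eps : R) : 0 < eps ->
  exists (p0 : nat) (c : R), 0 < c /\
    forall p q r : nat,
      (d.+1 <= q)%N -> (q <= p)%N -> (p0 < p)%N ->
      c * (p%:R `^ (((d%:R - 1) / d%:R + eps) * q%:R + 1) / (q - d)`!%:R) <= r%:R ->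
      (HD R d p q r <= (Num.min (p%:R - q%:R + 1)
         (p%:R - p%:R `^ ((d%:R - 1) / d%:R + eps) + 2))%:E)%E.
Proof.
move=> e0; have [p0 hp0] := pierced_large e0.
exists (maxn p0 1), 1; split => // p q r dq qp; rewrite gtn_max => /andP[pp0 p1].
set al := (d%:R - 1) / d%:R + eps; rewrite mul1r => hr.
have d0' : 0 < d%:R :> R by rewrite ltr0n.
have p1' : 1 < p%:R :> R by rewrite ltr1n.
have p0' : 0 < p%:R :> R by lra.
have f0 : 0 < (q - d)`!%:R :> R by rewrite ltr0n fact_gt0.
have r0 : (0 < r)%N.
  by rewrite -(ltr0n R); apply: lt_le_trans hr; rewrite divr_gt0// powR_gt0.
apply: HD_le => T K K0 Kcvx Kcpt pT hT.
pose k := (Num.truncn (p%:R `^ al)).+1.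
have k_lo : p%:R `^ al < k%:R by exact: truncnS_gt.
have k_hi : k.-1%:R <= p%:R `^ al by rewrite /k/= truncn_le// powR_ge0.
have hk : (q < k)%N -> ('C(p, d) * 'C(k.-1 - d, q - d) < r)%N.
  move=> qk; rewrite -(ltr_nat R); apply: lt_le_trans hr.
  rewrite ltr_pdivlMr// -natrM -mulnA.
  apply: le_lt_trans (_ : p%:R `^ d%:R * p%:R `^ (al * (q - d)%:R) < _).
    rewrite natrM powR_mulrn ?(ltW p0')// powRrM powR_mulrn ?powR_ge0//.
    apply: ler_pM => //.
      rewrite -natrX ler_nat; apply: leq_trans (bin_le_expn p d).
      by rewrite leq_pmulr// fact_gt0.
    apply: le_trans (_ : (k.-1 - d)%:R ^+ (q - d) <= _).
      by rewrite -natrX ler_nat bin_le_expn.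
    apply: lerXn2r; rewrite ?nnegrE ?powR_ge0//; apply: le_trans k_hi.
    by rewrite ler_nat leq_subr.
  rewrite -powRD; last by apply/implyP; rewrite [p%:R == _]gt_eqF.
  apply: ltr_powRr => //; rewrite natrB ?(ltnW dq)//.
  have : d%:R * al = d%:R - 1 + d%:R * eps by rewrite /al mulrDr mulrCA divff ?gt_eqF ?mulr1.
  have : 0 < d%:R * eps by rewrite mulr_gt0.
  by move: (d%:R * eps) => y; rewrite mulrBr (mulrC al d%:R) => y0 ->; lra.
have hpq := pq_upgrade Kcvx Kcpt d0 dq r0 hT hk.
have pT' : (p <= #|[set: T]|)%N by rewrite cardsT.
have sp := pq_le pT' hpq.
exists (p.+1 - maxn q k)%N; last first.
  apply: hp0 => //; first by rewrite (leq_trans dq)// leq_maxl.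
  by apply: le_trans (ltW k_lo) _; rewrite ler_nat leq_maxr.
apply: le_trans (natrB_succ_max sp) _; rewrite le_min !ge_min lexx/=.
by apply/orP; right; lra.
Qed.

End PiercingTheorems.

Theorem theorem2 (R : realType) (d : nat) (hd : (1 <= d)%N) :
  (exists c : R, 0 < c /\
    forall p q r : nat,
      (d.+1 <= q)%N -> (q <= p)%N -> (1 <= r)%N ->
      0 < gbinom (p%:R / d%:R : R) d ->
      c * gbinom ((d%:R - 1) / d%:R * p%:R) (q - d) * gbinom (p%:R / d%:R) d
        <= r%:R ->
      (HD R d p q r <= (Num.min (p%:R - q%:R + 1) (p%:R / d%:R - 1))%:E)%E)
  /\
  (forall eps : R, 0 < eps ->
    exists (p0 : nat) (c : R), 0 < c /\
      forall p q r : nat,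
        (d.+1 <= q)%N -> (q <= p)%N -> (p0 < p)%N ->
        c * (p%:R `^ (((d%:R - 1) / d%:R + eps) * q%:R + 1) / (q - d)`!%:R)
          <= r%:R ->
        (HD R d p q r <=
          (Num.min (p%:R - q%:R + 1)
             (p%:R - p%:R `^ ((d%:R - 1) / d%:R + eps) + 2))%:E)%E).
Proof. by split; [exact: HD_le_hadwiger_debrunner|exact: HD_le_pq_tight]. Qed.
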